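(* Consider the semi-discrete problem (M1)--(M4) given in the context with $f=0$ and homogeneous boundary conditions ($h=0$ on $\Gamma_N$; the homogeneous Dirichlet condition on $\Gamma_D$ being built into $\bar V_h$). For a suitably large penalty parameter $\alpha$ (i.e. there is $\alpha_0>0$ such that the following holds for all $\alpha\ge\alpha_0$), if $(u_h,\bar u_h,p_h,\bar p_h)\in V_h\times\bar V_h\times Q_h\times\bar Q_h$ satisfies (M1)--(M4), then $$\frac{d}{dt}\sum_{K\in\mathcal T}\int_K|u_h|^2\,dx\le0.$$
   Context: Setting. $\Omega\subset\mathbb R^d$ is a polygonal ($d=2$) or polyhedral ($d=3$) domain with outward unit normal $n$; $I=(0,t_N]$ is the time interval; $\partial\Omega=\Gamma_D\cup\Gamma_N$ with $\Gamma_D\cap\Gamma_N=\emptyset$; $\nu>0$ is the kinematic viscosity; $f$ is a forcing term with $f\in[L^2(\Omega)]^d$ and $h\in[L^2(\Gamma_N)]^d$ is boundary data (at each time). $\mathcal T=\{K\}$ is a triangulation of $\Omega$ into non-overlapping simplices $K$; $n$ also denotes the outward unit normal on $\partial K$; $h_K$ is the size (diameter) of $K$. Two adjacent cells $K^+,K^-$ share an interior facet $F=\partial K^+\cap\partial K^-$; a facet of $\partial K$ lying on $\partial\Omega$ is a boundary facet. $\mathcal F$ is the set of all (interior and boundary) facets. Spaces. $P_l(D)$ denotes polynomials of degree (at most) $l$ on $D$, and $k\ge2$ is an integer. $V_h=\{v_h\in[L^2(\mathcal T)]^d: v_h|_K\in[P_k(K)]^d\ \forall K\in\mathcal T\}$;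 $\bar V_h=\{\bar v_h\in[L^2(\mathcal F)]^d:\bar v_h|_F\in[P_k(F)]^d\ \forall F\in\mathcal F,\ \bar v_h=0\text{ on }\Gamma_D\}$; $Q_h=\{q_h\in L^2(\mathcal T): q_h|_K\in P_{k-1}(K)\ \forall K\in\mathcal T\}$; $\bar Q_h=\{\bar q_h\in L^2(\mathcal F):\bar q_h|_F\in P_k(F)\ \forall F\in\mathcal F\}$. Functions in $\bar V_h,\bar Q_h$ live only on facets and are single-valued there; functions in $V_h,Q_h$ may be discontinuous across facets, and in integrals over $\partial K$ their traces from inside $K$ are used. Fluxes. $(a\otimes b)_{ij}=a_ib_j$, $(\nabla u)_{ij}=\partial u_i/\partial x_j$, $\mathbb I$ is the identity tensor. $\sigma_h=\sigma_{a,h}+\sigma_{d,h}$ with $\sigma_{a,h}=u_h\otimes u_h$ and $\sigma_{d,h}=p_h\mathbb I-\nu\nabla u_h$. The numerical flux is $\hat\sigma_h=\hat\sigma_{a,h}+\hat\sigma_{d,h}$ with $\hat\sigma_{a,h}=\sigma_{a,h}+(\bar u_h-u_h)\otimes\lambda u_h$ and $\hat\sigma_{d,h}=\bar p_h\mathbb I-\nu\nabla u_h-\frac{\nu\alpha}{h_K}(\bar u_h-u_h)\otimes n$, where $\lambda=1$ on parts of cell boundaries with $u_h\cdot n<0$, $\lambda=0$ where $u_h\cdot n\ge0$, and $\alpha>0$ is a penalty parameter. Semi-discrete problem: at each time in $I$, find $(u_h,\bar u_h,p_h,\bar p_h)\in V_h\times\bar V_h\times Q_h\times\bar Q_h$ such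 that (M1) $0=\sum_K\int_K u_h\cdot\nabla q_h\,dx-\sum_K\int_{\partial K}u_h\cdot n\,q_h\,ds$ for all $q_h\in Q_h$; (M2) $0=\sum_K\int_{\partial K}u_h\cdot n\,\bar q_h\,ds-\int_{\partial\Omega}\bar u_h\cdot n\,\bar q_h\,ds$ for all $\bar q_h\in\bar Q_h$; (M3) $\int_\Omega f\cdot v_h\,dx=\int_\Omega\partial_tu_h\cdot v_h\,dx-\sum_K\int_K\sigma_h:\nabla v_h\,dx+\sum_K\int_{\partial K}\hat\sigma_h:(v_h\otimes n)\,ds+\sum_K\int_{\partial K}\nu\,((\bar u_h-u_h)\otimes n):\nabla v_h\,ds$ for all $v_h\in V_h$; (M4) $\int_{\Gamma_N}h\cdot\bar v_h\,ds=\sum_K\int_{\partial K}\hat\sigma_h:(\bar v_h\otimes n)\,ds-\int_{\Gamma_N}(1-\lambda)(\bar u_h\cdot n)\,\bar u_h\cdot\bar v_h\,ds$ for all $\bar v_h\in\bar V_h$. The solution is understood to depend on time with $u_h$ differentiable in time. *)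

(* Defs.v *)
From HB Require Import structures.
From mathcomp Require Import all_boot all_order all_algebra.
(* Before MathComp-Analysis and without its notations, which clash. *)
From mathcomp Require Import -(notations) mpoly.
From mathcomp Require Import all_classical all_reals all_analysis.

Set Implicit Arguments.
Unset Strict Implicit.
Unset Printing Implicit Defensive.

Import Order.TTheory GRing.Theory Num.Theory.
Import numFieldNormedType.Exports.

Local Open Scope classical_set_scope.
Local Open Scope ring_scope.

(* Lebesgue measure on R^n, carried by n.-tuple R with its product (Borel)
   sigma-algebra: the Dirac mass at the empty tuple for n = 0, and the image
   of lambda^1 \x lambda^n under (x, t) |-> x :: t for n + 1. *)
Section lebesgue_measure_tuple.
Variable R : realType.
Local Notation mR := (measurableTypeR R).

Definition tcons n (xt : mR * n.-tuple mR) : n.+1.-tuple mR :=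
  [tuple of xt.1 :: xt.2].

Lemma measurable_tcons n : measurable_fun [set: mR * n.-tuple mR] (@tcons n).
Proof. exact: measurable_cons. Qed.

Section step.
Variables (n : nat) (mu1 : {sigma_finite_measure set mR -> \bar R}).
Variable (mu : {sigma_finite_measure set (n.-tuple mR) -> \bar R}).

Definition measure_tcons : set (n.+1.-tuple mR) -> \bar R :=
  pushforward (mu1 \x mu)%E (@tcons n).

Let measure_tcons0 : measure_tcons set0 = 0%E.
Proof. by rewrite /measure_tcons /pushforward preimage_set0 measure0. Qed.

Let measure_tcons_ge0 A : (0 <= measure_tcons A)%E.
Proof. exact: (measure_ge0 (mu1 \x mu)%E). Qed.

Let measure_tcons_sigma_additive : semi_sigma_additive measure_tcons.
Proof.
move=> F mF tF mUF; rewrite /measure_tcons /pushforward preimage_bigcup.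
apply: measure_semi_sigma_additive.
- by move=> i; rewrite -[X in measurable X]setTI; exact: measurable_tcons.
- apply/trivIsetP => /= i j _ _ ij; rewrite -preimage_setI.
  by move/trivIsetP : tF => /(_ _ _ _ _ ij) ->//; rewrite preimage_set0.
- by rewrite -preimage_bigcup -[X in measurable X]setTI; exact: measurable_tcons.
Qed.

HB.instance Definition _ := isMeasure.Build _ _ _ measure_tcons
  measure_tcons0 measure_tcons_ge0 measure_tcons_sigma_additive.

Let measure_tcons_sigma_finite : sigma_finite setT measure_tcons.
Proof.
have /sigma_finiteP[F [TF ndF Foo]] := sigma_finiteT mu1.
have /sigma_finiteP[G [TG ndG Goo]] := sigma_finiteT mu.
pose g (t : n.+1.-tuple mR) : mR * n.-tuple mR := (thead t, [tuple of behead t]).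
have tconsK : cancel (@tcons n) g.
  by move=> [x t]; congr pair; apply: val_inj.
have mg : measurable_fun setT g.
  by apply/measurable_fun_pair; [exact: measurable_tnth|exact: measurable_behead].
exists (fun i => g @^-1` (F i `*` G i)).
  rewrite -preimage_bigcup -(preimage_setT g); congr preimage.
  rewrite -setXTT TF TG predeqE => -[x y]; split.
    move=> [/= [i _ Fix] [j _ Gjy]]; exists (maxn i j) => //; split.
    - by move: x Fix; exact/subsetPset/ndF/leq_maxl.
    - by move: y Gjy; exact/subsetPset/ndG/leq_maxr.
  by move=> [i _ []/= ? ?]; split; exists i.
move=> i; have [mF Fi] := Foo i; have [mG Gi] := Goo i; split.
  by rewrite -[X in measurable X]setTI; apply: mg => //; exact: measurableX.
rewrite /measure_tcons /pushforward -comp_preimage.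
rewrite (_ : g \o _ = id); last by apply/funext => x; exact: tconsK.
by rewrite preimage_id product_measure1E// lte_mul_pinfty// ge0_fin_numE.
Qed.

HB.instance Definition _ := Measure_isSigmaFinite.Build _ _ _ measure_tcons
  measure_tcons_sigma_finite.

End step.

Fixpoint lebesgue_tuple n : {sigma_finite_measure set (n.-tuple mR) -> \bar R} :=
  if n is n'.+1 then measure_tcons lebesgue_measure (lebesgue_tuple n') else \d_[tuple].

End lebesgue_measure_tuple.

Section euclidean.
Variables (R : realType) (d : nat).
Implicit Types (a b x : 'rV[R]_d) (A B : 'M[R]_d) (D : set 'rV[R]_d).

Definition dotp a b : R := \sum_i a 0 i * b 0 i.

(* The library norm on 'rV[R]_d is the maximum norm. *)
Definition norm2 a : R := Num.sqrt (dotp a a).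

Definition tensor a b : 'M[R]_d := a^T *m b.

Definition ddot A B : R := \sum_i \sum_j A i j * B i j.

Definition row_of_tuple (t : d.-tuple (measurableTypeR R)) : 'rV[R]_d :=
  \row_i tnth t i.

Definition borel_set D := measurable (row_of_tuple @^-1` D).

Definition vol_integral D (g : 'rV[R]_d -> R) : R :=
  (\int[lebesgue_tuple R d]_(t in row_of_tuple @^-1` D) g (row_of_tuple t))%R.

Definition frontier D : set 'rV[R]_d := closure D `\` interior D.

(* Polynomials are taken on all of R^d: a polynomial on a set D is represented
   by a polynomial of R^d, of which only the values on D are used.  On a cell
   the representative is unique, and its values and derivatives on the boundary
   of the cell are the traces from inside. *)
Definition spoly := mpoly.mpoly d R.
Definition vpoly := 'I_d -> spoly.

Definition has_deg (l : nat) (p : spoly) : Prop := (mpoly.msize p <= l.+1)%N.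

Definition peval (p : spoly) x : R := mpoly.meval (fun i => x 0 i) p.
Definition veval (v : vpoly) x : 'rV[R]_d := \row_i peval (v i) x.
Definition grad (p : spoly) x : 'rV[R]_d := \row_j peval (mpoly.mderiv j p) x.
Definition vgrad (v : vpoly) x : 'M[R]_d :=
  \matrix_(i, j) peval (mpoly.mderiv j (v i)) x.

End euclidean.

Arguments spoly : clear implicits.
Arguments vpoly : clear implicits.

(* A family of simplices: points, and simplices given by their vertex sets. *)
Record simplices (R : realType) (d : nat) := Simplices {
  vertex : finType;
  vertex_pos : vertex -> 'rV[R]_d;
  cells : {set {set vertex}} }.

Section mesh.
Variables (R : realType) (d : nat) (M : simplices R d).
Local Notation V := (vertex M).
Local Notation p := (@vertex_pos R d M).
Implicit Types (K F S : {set V}) (x n : 'rV[R]_d).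

Definition hull S : set 'rV[R]_d := [set x | exists w : V -> R,
  [/\ forall v, v \in S -> 0 <= w v, \sum_(v in S) w v = 1
    & x = \sum_(v in S) w v *: p v]].

Definition affinely_independent S : Prop := forall w : V -> R,
  \sum_(v in S) w v = 0 -> \sum_(v in S) w v *: p v = 0 ->
  forall v, v \in S -> w v = 0.

Definition is_dsimplex K : Prop := #|K| = d.+1 /\ affinely_independent K.

Definition facets_of K : {set {set V}} := [set K :\ v | v in K].

Definition facets : {set {set V}} := \bigcup_(K in cells M) facets_of K.

Definition is_outward_normal K F n : Prop :=
  [/\ dotp n n = 1,
      forall v w, v \in F -> w \in F -> dotp n (p w - p v) = 0
    & forall v w, v \in F -> w \in K :\: F -> dotp n (p w - p v) < 0].

Definition normal K F : 'rV[R]_d := xget 0 (is_outward_normal K F).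

Definition diameter K : R :=
  sup [set r | exists x y, [/\ hull K x, hull K y & r = norm2 (x - y)]].

Definition cell_integral K (g : 'rV[R]_d -> R) : R := vol_integral (hull K) g.

(* Affine parametrization of a (d - 1)-simplex F with vertices a_0, ..., a_(d-1)
   by the reference simplex of R^(d-1), y |-> a_0 + \sum_i y_i (a_(i+1) - a_0),
   and the surface integral over F `&` A, with area element sqrt (det (E E^T))
   for E the matrix of the edge vectors. *)
Definition facet_vertex F (i : nat) : 'rV[R]_d := nth 0 [seq p v | v <- enum F] i.

Definition facet_edges F : 'M[R]_(d.-1, d) :=
  \matrix_(i < d.-1) (facet_vertex F i.+1 - facet_vertex F 0%N).

Definition facet_param F (y : 'rV[R]_d.-1) : 'rV[R]_d :=
  facet_vertex F 0%N + y *m facet_edges F.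

Definition ref_simplex : set 'rV[R]_d.-1 :=
  [set y | (forall i, 0 <= y 0 i) /\ \sum_i y 0 i <= 1].

Definition facet_integral_on (A : set 'rV[R]_d) F (g : 'rV[R]_d -> R) : R :=
  Num.sqrt (\det (facet_edges F *m (facet_edges F)^T)) *
  vol_integral (ref_simplex `&` facet_param F @^-1` A) (g \o facet_param F).

Definition facet_integral := facet_integral_on setT.

Definition facet_null F (A : set 'rV[R]_d) : Prop :=
  (lebesgue_tuple R d.-1).-negligible
    (@row_of_tuple R d.-1 @^-1` (ref_simplex `&` facet_param F @^-1` A)).

Definition simplicial_family : Prop := forall K, K \in cells M -> is_dsimplex K.

Definition covered : set 'rV[R]_d := \bigcup_(K in [set` cells M]) hull K.

(* The last condition is conformity: a facet of a cell which does not lie on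
   the boundary of Omega is a facet of an adjacent cell. *)
Definition triangulation (Omega : set 'rV[R]_d) : Prop :=
  [/\ injective p,
      simplicial_family,
      closure Omega = covered,
      (forall K L, K \in cells M -> L \in cells M -> K != L ->
         interior (hull K) `&` interior (hull L) = set0)
    & (forall K F, K \in cells M -> F \in facets_of K ->
         hull F `<=` frontier Omega \/
         exists2 L, L \in cells M & L != K /\ F \in facets_of L)].

End mesh.

(* The requirement that Omega be the interior of the union excludes slits. *)
Definition polyhedral_domain (R : realType) (d : nat) (Omega : set 'rV[R]_d) :=
  [/\ open Omega, Omega !=set0, connected Omega
    & exists2 M : simplices R d, simplicial_family M
        & Omega = interior (covered M)].

(* Differentiability and derivative at t of a function of time defined on I;
   one-sided if t is an end point of I. *)
Section time_derivative.
Variables (R : realType) (V : normedModType R) (I : set R).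

Definition time_derivable (g : R -> V) (t : R) : Prop :=
  cvg ((fun s => (s - t)^-1 *: (g s - g t)) @ within I t^').

Definition time_derive (g : R -> V) (t : R) : V :=
  lim ((fun s => (s - t)^-1 *: (g s - g t)) @ within I t^').

End time_derivative.

Section discretization.
Variables (R : realType) (d : nat) (M : simplices R d).
Variables (Omega GammaD GammaN : set 'rV[R]_d) (k : nat).
Local Notation S := {set vertex M}.
Local Notation point := 'rV[R]_d.

(* Cell and facet functions are families indexed by the cells and the facets;
   their values at other vertex sets are never used. *)
Definition in_Vh (v : S -> vpoly R d) : Prop :=
  forall K, K \in cells M -> forall i, has_deg k (v K i).

Definition in_barVh (vb : S -> vpoly R d) : Prop :=
  forall F, F \in facets M ->
    (forall i, has_deg k (vb F i)) /\
    facet_null F [set x | GammaD x /\ veval (vb F) x != 0].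

Definition in_Qh (q : S -> spoly R d) : Prop :=
  forall K, K \in cells M -> has_deg k.-1 (q K).

Definition in_barQh (qb : S -> spoly R d) : Prop :=
  forall F, F \in facets M -> has_deg k (qb F).

Definition sum_cells (g : S -> point -> R) : R :=
  \sum_(K in cells M) cell_integral K (g K).

(* Sum over the cells K of integrals over the boundary of K; the integrand
   takes the cell, the facet and the point. *)
Definition sum_cell_boundaries (g : S -> S -> point -> R) : R :=
  \sum_(K in cells M) \sum_(F in facets_of K) facet_integral F (g K F).

(* Integral over the part of the boundary of Omega lying in A. *)
Definition boundary_integral_on (A : set point) (g : S -> S -> point -> R) : R :=
  \sum_(K in cells M)
    \sum_(F in facets_of K | `[< hull F `<=` frontier Omega >])
      facet_integral_on A F (g K F).

Definition boundary_integral := boundary_integral_on setT.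

Variables (nu alpha : R).

Section forms.
Variables (u : S -> vpoly R d) (ub : S -> vpoly R d).
Variables (p : S -> spoly R d) (pb : S -> spoly R d).
Implicit Types (K F : S) (x : point).

Definition sigma_a K x : 'M[R]_d := tensor (veval (u K) x) (veval (u K) x).

Definition sigma_d K x : 'M[R]_d := (peval (p K) x)%:M - nu *: vgrad (u K) x.

Definition sigma K x : 'M[R]_d := sigma_a K x + sigma_d K x.

Definition upwind K F x : R :=
  if dotp (veval (u K) x) (normal K F) < 0 then 1 else 0.

Definition jump K F x : point := veval (ub F) x - veval (u K) x.

Definition hat_sigma_a K F x : 'M[R]_d :=
  sigma_a K x + tensor (jump K F x) (upwind K F x *: veval (u K) x).

Definition hat_sigma_d K F x : 'M[R]_d :=
  (peval (pb F) x)%:M - nu *: vgrad (u K) x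
  - (nu * alpha / diameter K) *: tensor (jump K F x) (normal K F).

Definition hat_sigma K F x : 'M[R]_d := hat_sigma_a K F x + hat_sigma_d K F x.

Definition cell_continuity : Prop := forall q, in_Qh q ->
  0 = sum_cells (fun K x => dotp (veval (u K) x) (grad (q K) x))
    - sum_cell_boundaries (fun K F x =>
        dotp (veval (u K) x) (normal K F) * peval (q K) x).

Definition facet_continuity : Prop := forall qb, in_barQh qb ->
  0 = sum_cell_boundaries (fun K F x =>
        dotp (veval (u K) x) (normal K F) * peval (qb F) x)
    - boundary_integral (fun K F x =>
        dotp (veval (ub F) x) (normal K F) * peval (qb F) x).

(* f is the forcing term and du the time derivative of u. *)
Definition cell_momentum (f : point -> point) (du : S -> point -> point) : Prop :=
  forall v, in_Vh v ->
  sum_cells (fun K x => dotp (f x) (veval (v K) x)) =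
    sum_cells (fun K x => dotp (du K x) (veval (v K) x))
    - sum_cells (fun K x => ddot (sigma K x) (vgrad (v K) x))
    + sum_cell_boundaries (fun K F x =>
        ddot (hat_sigma K F x) (tensor (veval (v K) x) (normal K F)))
    + sum_cell_boundaries (fun K F x =>
        nu * ddot (tensor (jump K F x) (normal K F)) (vgrad (v K) x)).

(* h is the boundary datum on GammaN. *)
Definition facet_momentum (h : point -> point) : Prop :=
  forall vb, in_barVh vb ->
  boundary_integral_on GammaN (fun K F x => dotp (h x) (veval (vb F) x)) =
    sum_cell_boundaries (fun K F x =>
      ddot (hat_sigma K F x) (tensor (veval (vb F) x) (normal K F)))
    - boundary_integral_on GammaN (fun K F x =>
        (1 - upwind K F x) * dotp (veval (ub F) x) (normal K F) *
        dotp (veval (ub F) x) (veval (vb F) x)).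

End forms.

Definition semidiscrete_solution (I : set R) (f h : R -> point -> point)
    (u : R -> S -> vpoly R d) (ub : R -> S -> vpoly R d)
    (p : R -> S -> spoly R d) (pb : R -> S -> spoly R d) : Prop :=
  forall t, I t ->
  [/\ [/\ in_Vh (u t), in_barVh (ub t), in_Qh (p t) & in_barQh (pb t)],
      (forall K x, K \in cells M -> hull K x ->
         time_derivable I (fun s => veval (u s K) x) t),
      cell_continuity (u t), facet_continuity (u t) (ub t)
    & cell_momentum (u t) (ub t) (p t) (pb t) (f t)
        (fun K x => time_derive I (fun s => veval (u s K) x) t)
      /\ facet_momentum (u t) (ub t) (pb t) (h t)].

(* \sum_K \int_K |u_h|^2 dx *)
Definition kinetic_energy (u : S -> vpoly R d) : R :=
  sum_cells (fun K x => norm2 (veval (u K) x) ^+ 2).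

End discretization.

(* Main.v *)
(* Test the momentum equations with v = u and vb = ub.  The mass equations,
   tested with div u and with the total flux of the jump ub - u through each
   facet, make u divergence-free in every cell and cancel that flux against any
   single-valued facet function.  The pressure terms then vanish, and the
   convective terms reduce, by the divergence theorem in each cell and because
   the normals of adjacent cells are opposite, to the integrals of
   - |u.n| |ub - u|^2 / 2 over the boundaries of the cells and of
   - |u.n| |ub|^2 / 2 over the boundary of Omega.  The viscous terms are
   dissipative by Young's inequality and the discrete trace inequality, once
   alpha dominates the trace constants.  The time derivative of u is again a
   polynomial in each cell, because the coefficients of a polynomial are fixed
   linear combinations of its values at finitely many points. *)
From HB Require Import structures.
From mathcomp Require Import -(notations) mpoly.
(* Before Defs, whose [normal] the one of fingroup would shadow. *)
From mathcomp Require Import perm fingroup.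
Require Import Defs.
From mathcomp Require Import all_boot all_order all_algebra.
From mathcomp Require Import all_classical all_reals all_analysis.
From mathcomp Require Import measurable_realfun ring lra.
Set Implicit Arguments.
Unset Strict Implicit.
Unset Printing Implicit Defensive.
Import Order.TTheory GRing.Theory Num.Theory.
Import numFieldNormedType.Exports.
Local Open Scope classical_set_scope.
Local Open Scope ring_scope.

(** * Lebesgue measure under linear maps *)

(** The mass equations admit only polynomial test functions of bounded degree, while the energy
    balance needs weights such as [|ub|^2] and the upwind switch, which are not admissible. The way
    out is that the residuals are admissible themselves: [div u] has degree at most [k.-1] in each
    cell, and the total normal flux of the jump through a facet has degree at most [k]. Hence their
    squares integrate to 0, and they cancel against every bounded measurable weight. This is why
    integrands are kept in a class of bounded measurable functions. Upwinding looks at [u], whereas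
    the outflow term of (M4) carries [ub]; the same cancellation exchanges their normal components.
    Integrals over cells and facets are pulled back to reference simplices, so that the divergence
    theorem rests on the fundamental theorem of calculus in one coordinate, on the linear change of
    variables, and on volume being height times area. All viscous terms carry the factor [nu], so
    the threshold for [alpha] depends only on the mesh and the degree. *)

Section lebesgue_affine.
Variable R : realType.
Local Notation mu := (@lebesgue_measure R).
Implicit Types (a b : R) (f : R -> \bar R).

Let measurable_affine a b :
  measurable_fun setT ((fun x => a * x + b) : measurableTypeR R -> measurableTypeR R).
Proof.
exact: measurable_realfun.measurable_funD.
Qed.

(** Multiplied by [|a|], the pushforward gives each interval []c, e]] its length, which
    characterizes Lebesgue measure. For negative [a] the preimage is half-open on the other side,
    with the same length. *)
Let pushforward_affine a b (A : set R) : a != 0 -> measurable A ->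
  pushforward mu ((fun x => a * x + b) : measurableTypeR R -> measurableTypeR R) A
  = (`|a|^-1%:E * mu A)%E.
Proof.
move=> a0 mA.
pose phi := (fun x => a * x + b) : measurableTypeR R -> measurableTypeR R.
have mphi : measurable_fun setT phi by exact: measurable_affine.
pose pm : {measure set (measurableTypeR R) -> \bar R} :=
  measure_function_pushforward__canonical__measure_function_Measure mu mphi.
pose m := mscale (NngNum (normr_ge0 a)) pm.
have -> : mu A = m A.
  apply: lebesgue_measure_unique => // _ [[c e]] _ <-.
  change (mu `]c, e] = `|a|%:E * mu (phi @^-1` `]c, e]))%E.
  have [an|ap|a00] := ltgtP a 0; last by rewrite a00 eqxx in a0.
    have -> : phi @^-1` `]c, e] = `[(e - b) / a, (c - b) / a[%classic.
      apply/seteqP; split => x /=; rewrite !in_itv/= ltr_ndivlMr// ler_ndivrMr//;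
        by rewrite ltrBlDr lerBrDr [x * a]mulrC andbC.
    rewrite !lebesgue_measure_itv/= !lte_fin ltr_nM2r ?invr_lt0// ltrD2r.
    case: ifP => _; last by rewrite mule0.
    by rewrite -!EFinB -EFinM ltr0_norm//; congr EFin; field; rewrite lt_eqF.
  have -> : phi @^-1` `]c, e] = `](c - b) / a, (e - b) / a]%classic.
    apply/seteqP; split => x /=; rewrite !in_itv/= ltr_pdivrMr// ler_pdivlMr//;
      by rewrite ltrBlDr lerBrDr mulrC.
  rewrite !lebesgue_measure_itv/= !lte_fin ltr_pM2r ?invr_gt0// ltrD2r.
  case: ifP => _; last by rewrite mule0.
  by rewrite -!EFinB -EFinM gtr0_norm//; congr EFin; field; rewrite gt_eqF.
by rewrite /m /mscale/= muleA -EFinM mulVf ?normr_eq0// mul1e.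
Qed.

Lemma integral_affine a b f : a != 0 -> measurable_fun setT f ->
  (forall x, 0 <= f x)%E ->
  (\int[mu]_x f (a * x + b)%R = (`|a|^-1)%:E * \int[mu]_x f x)%E.
Proof.
move=> a0 mf f0.
pose phi := (fun x => a * x + b) : measurableTypeR R -> measurableTypeR R.
have mphi : measurable_fun setT phi by exact: measurable_affine.
rewrite -[LHS](@ge0_integral_pushforward _ _ _ _ _ phi mphi mu setT f)//.
have a0' : 0 <= `|a|^-1 by rewrite invr_ge0.
rewrite -[X in (X * _)%E]/((NngNum a0')%:num%:E) -ge0_integral_mscale//.
by apply: eq_measure_integral => A mA _; exact: (pushforward_affine b a0 mA).
Qed.

End lebesgue_affine.

(** * Measurability and Tonelli's theorem on row vectors *)

Section integral_row.
Variable R : realType.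
Implicit Types m n : nat.
Local Notation mR := (measurableTypeR R).
Local Notation mu := (@lebesgue_measure R).

(** The sigma-algebra and the measure live on tuples, while matrices act on rows; functions of rows
    are therefore measured and integrated through [row_of_tuple]. *)
Definition emeas n (f : 'rV[R]_n -> \bar R) :=
  measurable_fun [set: n.-tuple mR] (f \o @row_of_tuple R n).

Definition rmeas n (f : 'rV[R]_n -> R) :=
  measurable_fun [set: n.-tuple mR] (f \o @row_of_tuple R n).

Definition eint n (f : 'rV[R]_n -> \bar R) : \bar R :=
  (\int[lebesgue_tuple R n]_t f (row_of_tuple t))%E.

Definition tuple_of_row n (x : 'rV[R]_n) : n.-tuple mR := [tuple x 0 i | i < n].

Lemma tuple_of_rowK n : cancel (@tuple_of_row n) (@row_of_tuple R n).
Proof. by move=> x; apply/rowP => i; rewrite mxE tnth_mktuple. Qed.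

Lemma rmeas_coord n i : rmeas (fun x : 'rV[R]_n => x 0 i).
Proof.
rewrite /rmeas (_ : _ \o _ = @tnth n mR ^~ i).
  exact: measurable_tnth.
by apply/funext => t /=; rewrite mxE.
Qed.

Lemma rmeas_cst n (c : R) : rmeas (fun _ : 'rV[R]_n => c).
Proof. exact: measurable_cst. Qed.

Lemma rmeasD n (f g : 'rV[R]_n -> R) : rmeas f -> rmeas g ->
  rmeas (fun x => f x + g x).
Proof. exact: measurable_funD. Qed.

Lemma rmeasM n (f g : 'rV[R]_n -> R) : rmeas f -> rmeas g ->
  rmeas (fun x => f x * g x).
Proof. exact: measurable_funM. Qed.

Lemma rmeasN n (f : 'rV[R]_n -> R) : rmeas f -> rmeas (fun x => - f x).
Proof. exact: measurable_funN. Qed.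

Lemma rmeas_sum n I (s : seq I) (P : pred I) (f : I -> 'rV[R]_n -> R) :
  (forall i, P i -> rmeas (f i)) -> rmeas (fun x => \sum_(i <- s | P i) f i x).
Proof.
move=> mf; elim: s => [|i s IH].
  by under eq_fun do rewrite big_nil; exact: rmeas_cst.
under eq_fun do rewrite big_cons.
by have [Pi|] := boolP (P i) => //; apply: rmeasD => //; exact: mf.
Qed.

Lemma measurable_row_of_tuple_comp d (T : measurableType d) n
    (phi : T -> 'rV[R]_n) :
  (forall i, measurable_fun setT (fun t => phi t 0 i)) ->
  measurable_fun setT (fun t => tuple_of_row (phi t)).
Proof.
move=> mphi; apply/measurable_fun_tnthP => i.
rewrite (_ : _ \o _ = fun t => phi t 0 i); first exact: mphi.
by apply/funext => t /=; rewrite tnth_mktuple.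
Qed.

Lemma emeas_comp m n (phi : 'rV[R]_m -> 'rV[R]_n) (f : 'rV[R]_n -> \bar R) :
  (forall i, rmeas (fun x => phi x 0 i)) -> emeas f -> emeas (f \o phi).
Proof.
move=> mphi mf; rewrite /emeas.
rewrite (_ : _ \o _ = (f \o @row_of_tuple R n) \o
   (fun t : m.-tuple mR => tuple_of_row (phi (row_of_tuple t)))); last first.
  by apply/funext => t /=; rewrite tuple_of_rowK.
apply: measurableT_comp => //.
exact: measurable_row_of_tuple_comp.
Qed.

Lemma rmeas_comp m n (phi : 'rV[R]_m -> 'rV[R]_n) (f : 'rV[R]_n -> R) :
  (forall i, rmeas (fun x => phi x 0 i)) -> rmeas f -> rmeas (f \o phi).
Proof.
move=> mphi mf; rewrite /rmeas.
rewrite (_ : _ \o _ = (f \o @row_of_tuple R n) \o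
   (fun t : m.-tuple mR => tuple_of_row (phi (row_of_tuple t)))); last first.
  by apply/funext => t /=; rewrite tuple_of_rowK.
apply: measurableT_comp => //.
exact: measurable_row_of_tuple_comp.
Qed.

Lemma rmeas_mulmx m n (A : 'M[R]_(m, n)) (b : 'rV[R]_n) i :
  rmeas (fun x : 'rV[R]_m => (x *m A + b) 0 i).
Proof.
under eq_fun do rewrite mxE [X in X + _]mxE.
apply: rmeasD; last exact: rmeas_cst.
by apply: rmeas_sum => j _; apply: rmeasM; [exact: rmeas_coord|exact: rmeas_cst].
Qed.

Lemma emeas_affine m n (A : 'M[R]_(m, n)) (b : 'rV[R]_n) (f : 'rV[R]_n -> \bar R) :
  emeas f -> emeas (fun x => f (x *m A + b)).
Proof. by apply: emeas_comp => i; exact: rmeas_mulmx. Qed.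

Lemma rmeas_affine m n (A : 'M[R]_(m, n)) (b : 'rV[R]_n) (f : 'rV[R]_n -> R) :
  rmeas f -> rmeas (fun x => f (x *m A + b)).
Proof. by apply: rmeas_comp => i; exact: rmeas_mulmx. Qed.

(** The counterpart of [tcons] for rows, built by [row_mx] so that it multiplies well with block
    matrices. *)
Definition rcons0 n (x : R) (y : 'rV[R]_n) : 'rV[R]_n.+1 :=
  row_mx (x%:M : 'M[R]_1) y.

Lemma row_of_tuple_tcons n (x : R) (t : n.-tuple mR) :
  row_of_tuple (tcons (x, t)) = rcons0 x (row_of_tuple t).
Proof.
apply/rowP => i; rewrite mxE /rcons0 mxE.
case: splitP => j ij.
  rewrite ord1 mxE eqxx mulr1n.
  have -> : i = ord0 by apply: val_inj; rewrite /= ij ord1.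
  by [].
have -> : i = lift ord0 j by apply: val_inj; rewrite /= ij.
by rewrite mxE tnthS.
Qed.

Let F n (f : 'rV[R]_n.+1 -> \bar R) (xt : mR * n.-tuple mR) : \bar R :=
  f (rcons0 xt.1 (row_of_tuple xt.2)).

Let mF n (f : 'rV[R]_n.+1 -> \bar R) : emeas f -> measurable_fun setT (F f).
Proof.
move=> mf; rewrite (_ : F f = (f \o @row_of_tuple R n.+1) \o @tcons R n).
  by apply: measurableT_comp => //; exact: measurable_tcons.
by apply/funext => -[x t]; rewrite /F/= row_of_tuple_tcons.
Qed.

Let eint_prod n (f : 'rV[R]_n.+1 -> \bar R) : emeas f -> (forall x, 0 <= f x)%E ->
  eint f = (\int[mu \x lebesgue_tuple R n]_z F f z)%E.
Proof.
move=> mf f0; rewrite /eint /=.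
rewrite [LHS](@ge0_integral_pushforward _ _ _ _ _ (@tcons R n)
  (@measurable_tcons R n) (mu \x lebesgue_tuple R n)%E setT
  (f \o @row_of_tuple R n.+1))//.
  by apply: eq_integral => -[x t] _; rewrite /F/= row_of_tuple_tcons.
by move=> t _; exact: f0.
Qed.

Lemma eint_tonelli1 n (f : 'rV[R]_n.+1 -> \bar R) :
  emeas f -> (forall x, 0 <= f x)%E ->
  eint f = (\int[mu]_x eint (fun y => f (rcons0 x y)))%E.
Proof.
move=> mf f0; rewrite eint_prod//.
by rewrite (fubini_tonelli1 (F f))//; [exact: mF|move=> z; exact: f0].
Qed.

Lemma eint_tonelli2 n (f : 'rV[R]_n.+1 -> \bar R) :
  emeas f -> (forall x, 0 <= f x)%E ->
  eint f = eint (fun y => \int[mu]_x f (rcons0 x y))%E.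
Proof.
move=> mf f0; rewrite eint_prod//.
by rewrite (fubini_tonelli2 (F f))//; [exact: mF|move=> z; exact: f0].
Qed.

Lemma measurable_tonelli1 n (f : 'rV[R]_n.+1 -> \bar R) :
  emeas f -> (forall x, 0 <= f x)%E ->
  measurable_fun setT (fun x => eint (fun y => f (rcons0 x y))).
Proof.
by move=> mf f0; apply: (measurable_fun_fubini_tonelli_F (F f)) => //; [exact: mF|move=> z; exact: f0].
Qed.

Lemma emeas_rcons0 n (f : 'rV[R]_n.+1 -> \bar R) x :
  emeas f -> emeas (fun y => f (rcons0 x y)).
Proof.
apply: (@emeas_comp _ _ (rcons0 x)) => i; rewrite /rcons0.
under eq_fun do rewrite mxE; case: splitP => j _.
  exact: rmeas_cst.
exact: rmeas_coord.
Qed.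

Lemma measurable_rcons0 n (f : 'rV[R]_n.+1 -> \bar R) y :
  emeas f -> measurable_fun [set: R] (fun x => f (rcons0 x y)).
Proof.
move=> mf.
rewrite (_ : (fun x => _) = (f \o @row_of_tuple R n.+1) \o
   (fun x : mR => tuple_of_row (rcons0 x y))); last first.
  by apply/funext => t /=; rewrite tuple_of_rowK.
apply: measurableT_comp => //; apply: measurable_row_of_tuple_comp => i.
under eq_fun do rewrite mxE; case: splitP => j _; last exact: measurable_cst.
rewrite ord1; under eq_fun do rewrite mxE eqxx mulr1n; exact: measurable_id.
Qed.

Lemma eint_ge0 n (f : 'rV[R]_n -> \bar R) : (forall x, 0 <= f x)%E -> (0 <= eint f)%E.
Proof. by move=> f0; apply: integral_ge0 => t _. Qed.

Lemma eq_eint n (f g : 'rV[R]_n -> \bar R) : f =1 g -> eint f = eint g.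
Proof. by move=> fg; apply: eq_integral => t _. Qed.

Lemma eintZ n (c : R) (f : 'rV[R]_n -> \bar R) : emeas f ->
  (forall x, 0 <= f x)%E -> 0 <= c -> eint (fun x => c%:E * f x)%E = (c%:E * eint f)%E.
Proof. by move=> mf f0 c0; rewrite /eint ge0_integralZl. Qed.

End integral_row.

(** * Change of variables under translations and invertible matrices *)

Section linear_change.
Variable R : realType.
Local Notation mu := (@lebesgue_measure R).

Lemma rcons0D n (x x' : R) (y y' : 'rV[R]_n) :
  rcons0 x y + rcons0 x' y' = rcons0 (x + x') (y + y').
Proof. by rewrite /rcons0 raddfD; exact: (@add_row_mx R 1 1 n). Qed.

Lemma rcons0_mulmx n (x : R) (y : 'rV[R]_n) (a : 'M[R]_1) (b : 'rV[R]_n)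
    (c : 'cV[R]_n) (D : 'M[R]_n) :
  rcons0 x y *m (block_mx a b c D : 'M[R]_n.+1) =
  rcons0 (x * a 0 0 + (y *m c) 0 0) (x *: b + y *m D).
Proof.
apply: etrans (@mul_row_block R 1 1 n 1 n _ _ a b c D) _.
congr (@row_mx R 1 1 n _ _).
  apply/matrixP => i j; rewrite !ord1 !mxE eqxx mulr1n; congr (_ + _).
  by rewrite big_ord1 !mxE eqxx mulr1n.
by rewrite mul_scalar_mx.
Qed.

Lemma rcons0_split n (b : 'rV[R]_n.+1) : exists b0 b', b = rcons0 b0 b'.
Proof.
exists (b 0 0), (rsubmx (b : 'rV_(1 + n))); rewrite /rcons0.
apply: etrans (esym (@hsubmxK R 1 1 n b)) _; congr (@row_mx R 1 1 n _ _).
apply/matrixP => i j; rewrite !ord1 !mxE eqxx mulr1n; congr (b _ _).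
exact: val_inj.
Qed.

Lemma eint_translate n (b : 'rV[R]_n) f : emeas f -> (forall x, 0 <= f x)%E ->
  eint (fun x => f (x + b)) = eint f.
Proof.
elim: n b f => [|n IH] b f mf f0.
  by apply: eq_eint => x; congr f; apply/rowP; case.
have mfb : emeas (fun x => f (x + b)).
  by have := emeas_affine 1%:M b mf; under eq_fun do rewrite mulmx1.
rewrite (eint_tonelli1 mf f0) (eint_tonelli1 mfb (fun x => f0 _)).
have [b0 [b' ->]] := rcons0_split b.
transitivity (\int[mu]_x eint (fun y => f (rcons0 (1 * x + b0) y)))%E.
  apply: eq_integral => x _; rewrite -(IH b' (fun y => f (rcons0 (1 * x + b0) y)) (emeas_rcons0 _ mf) (fun y => f0 _)).
  by apply: eq_eint => y; rewrite rcons0D mul1r.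
pose g x := eint (fun y => f (rcons0 x y)).
have := @integral_affine R 1 b0 g; rewrite normr1 invr1 mul1e; apply.
- exact: oner_neq0.
- exact: measurable_tonelli1.
- by move=> x; apply: eint_ge0.
Qed.

(** The change of variables formula as a property of [A], so that it can be proved factor by factor.
    Nonnegative integrands keep integrability out of the way. *)
Definition det_scaling n (A : 'M[R]_n) := forall f, emeas f ->
  (forall x, 0 <= f x)%E ->
  eint f = (`|\det A|%:E * eint (fun x => f (x *m A)))%E.

Lemma emeas_mulmx m n (A : 'M[R]_(m, n)) (f : 'rV[R]_n -> \bar R) :
  emeas f -> emeas (fun x => f (x *m A)).
Proof. by move=> /(emeas_affine A 0); under eq_fun do rewrite addr0. Qed.

Lemma det_scalingM n (A B : 'M[R]_n) :
  det_scaling A -> det_scaling B -> det_scaling (A *m B).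
Proof.
move=> hA hB f mf f0; rewrite (hB f)//.
rewrite (hA (fun x => f (x *m B)))//; last exact: emeas_mulmx.
rewrite muleA -EFinM -normrM mulrC -det_mulmx; congr (_ * _)%E.
by apply: eq_eint => x; rewrite mulmxA.
Qed.

(** For fixed first coordinate [x], this shear translates the other coordinates by [x *: b]. *)
Lemma det_scaling_upper n (b : 'rV[R]_n) :
  det_scaling (block_mx (1 : 'M[R]_1) b 0 1%:M : 'M[R]_n.+1).
Proof.
move=> f mf f0; rewrite (@det_ublock R 1 n) !det1 mulr1 normr1 mul1e.
rewrite (eint_tonelli1 mf f0) (eint_tonelli1 (emeas_mulmx _ mf) (fun x => f0 _)).
apply: eq_integral => x _; rewrite -(eint_translate (x *: b) (emeas_rcons0 x mf) (fun y => f0 _)).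
apply: eq_eint => y; rewrite rcons0_mulmx mxE mulmx0 mxE mulr1 addr0.
by rewrite mulmx1 addrC.
Qed.

(** For fixed remaining coordinates [y], this shear translates the first one by [y *m c]; hence the
    opposite order of integration. *)
Lemma det_scaling_lower n (c : 'cV[R]_n) :
  det_scaling (block_mx (1 : 'M[R]_1) 0 c 1%:M : 'M[R]_n.+1).
Proof.
move=> f mf f0; rewrite (@det_lblock R 1 n) !det1 mulr1 normr1 mul1e.
rewrite (eint_tonelli2 mf f0) (eint_tonelli2 (emeas_mulmx _ mf) (fun x => f0 _)).
apply: eq_eint => y.
have := @integral_affine R 1 ((y *m c) 0 0) (fun x => f (rcons0 x y)).
rewrite normr1 invr1 mul1e => <- //.
- apply: eq_integral => x _.
  by rewrite rcons0_mulmx [(1 : 'M[R]_1) 0 0]mxE mulr1 scaler0 add0r mulmx1 mul1r.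
- exact: measurable_rcons0.
Qed.

Lemma det_scaling_diag n (a : R) (D : 'M[R]_n) : a != 0 -> det_scaling D ->
  det_scaling (block_mx (a%:M : 'M[R]_1) 0 0 D : 'M[R]_n.+1).
Proof.
move=> a0 hD f mf f0; rewrite (@det_ublock R 1 n) det_scalar1.
rewrite (eint_tonelli1 mf f0) (eint_tonelli1 (emeas_mulmx _ mf) (fun x => f0 _)).
pose g x := eint (fun y => f (rcons0 x (y *m D))).
have mh : emeas (fun x : 'rV[R]_n.+1 => f (x *m (block_mx (1 : 'M[R]_1) 0 0 D : 'M[R]_n.+1))).
  exact: emeas_mulmx.
have mg : measurable_fun setT g.
  rewrite /g; have := measurable_tonelli1 mh (fun x => f0 _).
  congr (measurable_fun _ _); apply/funext => x; apply: eq_eint => y.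
  by rewrite rcons0_mulmx mxE mulmx0 mxE mulr1 addr0 scaler0 add0r.
have g0 x : (0 <= g x)%E by apply: eint_ge0.
transitivity (`|\det D|%:E * \int[mu]_x g x)%E.
  rewrite -ge0_integralZl//.
  apply: eq_integral => x _; rewrite (hD (fun y => f (rcons0 x y)))//.
  exact: emeas_rcons0.
have : (\int[mu]_x g x = `|a|%:E * \int[mu]_x g (a * x + 0)%R)%E.
  by rewrite (integral_affine _ a0 mg g0) muleA -EFinM divff ?normr_eq0// mul1e.
move=> ->; rewrite muleA -EFinM -normrM mulrC; congr (_ * _)%E.
apply: eq_integral => x _; apply: eq_eint => y.
rewrite rcons0_mulmx mxE mulmx0 mxE !addr0 eqxx mulr1n scaler0 add0r.
by rewrite mulrC.
Qed.

(* Induction on the dimension by block LU factorization; a vanishing pivot is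
   made nonzero by adding another row to the first one. *)
Lemma det_scaling_unitmx n (A : 'M[R]_n) : A \in unitmx -> det_scaling A.
Proof.
elim: n A => [|n IH] A.
  move=> _ f mf f0; rewrite det_mx00 normr1 mul1e; apply: eq_eint => x.
  by congr f; apply/rowP; case.
have pivot (B : 'M[R]_n.+1) : B \in unitmx -> B 0 0 != 0 -> det_scaling B.
  move=> uB a0.
  pose B' : 'M[R]_(1 + n) := B.
  pose a := B 0 0; pose b := ursubmx B'; pose c := dlsubmx B'; pose D := drsubmx B'.
  have Ba : ulsubmx B' = a%:M.
    apply/matrixP => i j; rewrite !ord1 !mxE eqxx mulr1n /a.
    by congr (B _ _); apply: val_inj.
  (* The Schur complement of the pivot, invertible because [\det B = a * \det S]. *)
  pose S := D - a^-1 *: (c *m b).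
  have eB : B = (block_mx (1 : 'M[R]_1) 0 (a^-1 *: c) 1%:M : 'M[R]_n.+1) *m
    ((block_mx (a%:M : 'M[R]_1) 0 0 S : 'M[R]_n.+1) *m (block_mx (1 : 'M[R]_1) (a^-1 *: b) 0 1%:M : 'M[R]_n.+1)).
    apply: etrans (esym (submxK B')) _; rewrite Ba -/b -/c -/D.
    rewrite !(@mulmx_block R 1 n 1 n 1 n) !mulmx0 !mul0mx !addr0 !add0r !mul1mx !mulmx1.
    rewrite [RHS](_ : _ = block_mx a%:M b c D)//; congr block_mx.
    - by rewrite mul_scalar_mx scalerA divff// scale1r.
    - by rewrite addr0 mul_mx_scalar scalerA divff// scale1r.
    - by rewrite mul_scalar_mx scalerA divff// scale1r -scalemxAl /S addrC subrK.
  have detB : \det B = a * \det S.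
    rewrite {1}eB !det_mulmx (@det_lblock R 1 n) !(@det_ublock R 1 n).
    by rewrite !det1 !mul1r mulr1 det_scalar1.
  have uS : S \in unitmx.
    move: uB; rewrite !unitmxE !unitfE detB mulf_eq0 negb_or => /andP[_].
    by [].
  rewrite eB; apply: det_scalingM; first exact: det_scaling_lower.
  apply: det_scalingM; last exact: det_scaling_upper.
  by apply: det_scaling_diag => //; exact: IH.
move=> uA; have [A00|A00] := eqVneq (A 0 0) 0; last exact: pivot.
have [i Ai0] : exists i, A i 0 != 0.
  apply/existsP; apply: contraT => /existsPn h.
  have : col 0 A = 0 by apply/colP => i; rewrite !mxE; apply/eqP/negPn.
  move=> c0; move: uA; rewrite unitmxE unitfE (expand_det_col _ 0).
  rewrite big1 ?eqxx// => i _; have /colP/(_ i) := c0.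
  by rewrite !mxE => ->; rewrite mul0r.
case: (unliftP 0 i) Ai0 => [j ->|->]; last by rewrite A00 eqxx.
move=> Aj0.
(* Left multiplication by [E e] adds [e] times the row of index [lift 0 j] to the first row, so
   [E (-1)] undoes [E 1]. *)
pose E e : 'M[R]_n.+1 := block_mx (1 : 'M[R]_1) (e *: delta_mx 0 j : 'rV[R]_n) 0 1%:M.
have uE e : E e \in unitmx.
  by rewrite unitmxE (@det_ublock R 1 n) !det1 mulr1 unitr1.
have -> : A = E (-1) *m (E 1 *m A).
  rewrite mulmxA [E _ *m E _](_ : _ = 1%:M) ?mul1mx//.
  rewrite /E (@mulmx_block R 1 n 1 n 1 n) !mulmx0 !mul0mx !addr0 !add0r !mul1mx !mulmx1.
  rewrite -scalerDl subrr scale0r.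
  by rewrite [LHS](_ : _ = block_mx (1%:M : 'M[R]_1) 0 0 1%:M)// -scalar_mx_block.
apply: det_scalingM; first exact: det_scaling_upper.
apply: pivot; first by rewrite unitmx_mul uE.
have -> : (E 1 *m A) 0 0 = A 0 0 + A (lift 0 j) 0.
  rewrite mxE (big_ord_recl n) (bigD1 j)//= big1 ?addr0 => [|l lj].
    have -> : E 1 0 0 = 1.
      have := @block_mxEul R 1 n 1 n 1 (1 *: delta_mx 0 j) 0 1%:M 0 0.
      rewrite [(1 : 'M[R]_1) 0 0]mxE eqxx mulr1n => e; apply: etrans e.
      by congr (E 1 _ _); exact: val_inj.
    have -> : E 1 0 (lift 0 j) = 1.
      have := @block_mxEur R 1 n 1 n 1 (1 *: delta_mx 0 j) 0 1%:M 0 j.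
      move=> e; apply: etrans (etrans e _); first by congr (E 1 _ _); exact: val_inj.
      by rewrite !mxE !eqxx mulr1.
    by rewrite !mul1r.
  have -> : E 1 0 (lift 0 l) = 0.
    have := @block_mxEur R 1 n 1 n 1 (1 *: delta_mx 0 j) 0 1%:M 0 l.
    move=> e; apply: etrans (etrans e _); first by congr (E 1 _ _); exact: val_inj.
    by rewrite !mxE (negbTE lj) mulr0.
  by rewrite mul0r.
by rewrite A00 add0r.
Qed.

End linear_change.

(** * Integrals of bounded measurable functions over sets of finite volume *)

Section set_integral.
Variable R : realType.
Implicit Types n : nat.
Local Notation mR := (measurableTypeR R).
Local Notation mu := (@lebesgue_measure R).
Local Notation leb n := (lebesgue_tuple R n).
Local Notation rot n := (@row_of_tuple R n).

Definition finite_vol n (D : set 'rV[R]_n) :=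
  borel_set D /\ (leb n (@row_of_tuple R n @^-1` D) < +oo)%E.

(** On a set of finite volume this implies integrability, and unlike integrability it is stable
    under products. *)
Definition bmeas n (D : set 'rV[R]_n) (f : 'rV[R]_n -> R) :=
  rmeas f /\ exists C, forall x, D x -> `|f x| <= C.

Definition bounded_box n (D : set 'rV[R]_n) :=
  exists C : R, forall x, D x -> forall i, `|x 0 i| <= C.

Lemma borel_setI n (D E : set 'rV[R]_n) : borel_set D -> borel_set E ->
  borel_set (D `&` E).
Proof. exact: measurableI. Qed.

Lemma borel_le n (f g : 'rV[R]_n -> R) : rmeas f -> rmeas g ->
  borel_set [set x | f x <= g x].
Proof.
move=> mf mg; have mfg := measurable_fun_ler mf mg.
have := mfg measurableT [set true] I; rewrite setTI.
by congr measurable; apply/seteqP; split.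
Qed.

Lemma borel_forall n m (D : 'I_m -> set 'rV[R]_n) : (forall i, borel_set (D i)) ->
  borel_set [set x | forall i, D i x].
Proof.
move=> mD; rewrite /borel_set.
rewrite (_ : _ @^-1` _ = \bigcap_(i in [set: 'I_m]) (rot n @^-1` D i)).
  by apply: fin_bigcap_measurable => [|i _]; [exact: finite_finset|exact: mD].
by apply/seteqP; split => [t /= h i _|t h i]; [exact: h|exact: (h i I)].
Qed.

Lemma borel_comp m n (phi : 'rV[R]_m -> 'rV[R]_n) D :
  (forall i, rmeas (fun x => phi x 0 i)) -> borel_set D -> borel_set (phi @^-1` D).
Proof.
move=> mphi mD; have /= := measurable_row_of_tuple_comp mphi.
move=> /(_ measurableT _ mD); rewrite setTI.
by congr measurable; apply/seteqP; split => t /=; rewrite tuple_of_rowK.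
Qed.

Lemma borel_affine m n (A : 'M[R]_(m, n)) (b : 'rV[R]_n) D :
  borel_set D -> borel_set [set y | D (y *m A + b)].
Proof. by apply: (@borel_comp _ _ (fun y => y *m A + b)) => i; exact: rmeas_mulmx. Qed.

Lemma rmeas_indic n (D : set 'rV[R]_n) : borel_set D -> rmeas (\1_D : _ -> R).
Proof.
move=> mD; rewrite /rmeas (_ : _ \o _ = \1_(rot n @^-1` D)).
  exact: measurable_indic.
by apply/funext => t; rewrite /= !indicE; congr (nat_of_bool _)%:R; apply/idP/idP => /[!inE].
Qed.

Lemma emeas_EFin n (f : 'rV[R]_n -> R) : rmeas f -> emeas (fun x => (f x)%:E).
Proof. by move=> mf; apply/measurable_EFinP. Qed.

Lemma vol_set_eint n (D : set 'rV[R]_n) : borel_set D ->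
  leb n (rot n @^-1` D) = eint (fun x => (\1_D x)%:E).
Proof.
move=> mD; by rewrite -[X in leb n X]setIT -(integral_indic (leb n)).
Qed.

Lemma vol_eint n (D : set 'rV[R]_n) f : (forall x, D x -> 0 <= f x) ->
  vol_integral D f = fine (eint (fun x => (f x * \1_D x)%:E)).
Proof.
move=> f0; rewrite /vol_integral /Rintegral; congr fine; rewrite integral_mkcond.
apply: eq_integral => t _; rewrite patchE indicE.
have -> : (t \in rot n @^-1` D) = (row_of_tuple t \in D) by apply/idP/idP => /[!inE].
by case: ifP => _; rewrite ?mulr1// mulr0.
Qed.

Lemma rmeas_norm n (f : 'rV[R]_n -> R) : rmeas f -> rmeas (fun x => `|f x|).
Proof. exact: (measurableT_comp (@normr_measurable R setT)). Qed.

Lemma rcons0E0 n x (y : 'rV[R]_n) : rcons0 x y 0 0 = x.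
Proof.
transitivity ((x%:M : 'M[R]_1) 0 0); last by rewrite mxE eqxx mulr1n.
rewrite -(@row_mxEl R 1 1 n x%:M y 0 0).
by congr (rcons0 _ _ _ _); exact: val_inj.
Qed.

Lemma rcons0ES n x (y : 'rV[R]_n) i : rcons0 x y 0 (lift ord0 i) = y 0 i.
Proof.
rewrite -(@row_mxEr R 1 1 n x%:M y 0 i).
by congr (rcons0 _ _ _ _); exact: val_inj.
Qed.

Definition cube n (c : 'rV[R]_n) (r : R) : set 'rV[R]_n :=
  [set x | forall i, `|x 0 i - c 0 i| <= r].

Lemma borel_cube n (c : 'rV[R]_n) r : borel_set (cube c r).
Proof.
apply: borel_forall => i; apply: borel_le; last exact: rmeas_cst.
by apply: rmeas_norm; apply: rmeasD; [exact: rmeas_coord|exact: rmeas_cst].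
Qed.

Lemma cube_vol n (c : 'rV[R]_n) r : 0 <= r ->
  leb n (rot n @^-1` cube c r) = ((2 * r) ^+ n)%:E.
Proof.
move=> r0.
elim: n c => [|n IH] c.
  rewrite (_ : _ @^-1` _ = setT); last by apply/seteqP; split => // t _ [].
  by rewrite expr0 /= diracT.
have [c0 [c' cE]] := rcons0_split c.
rewrite vol_set_eint; last exact: borel_cube.
rewrite eint_tonelli2//; last first.
  by apply: emeas_EFin; apply: rmeas_indic; exact: borel_cube.
pose E := cube c' r; pose J : set R := `[c0 - r, c0 + r]%classic.
transitivity (eint (fun y => (2 * r)%:E * (\1_E y)%:E))%E.
  apply: eq_eint => y.
  under eq_integral => x _.
    rewrite (_ : \1__ _ = \1_J x * \1_E y); last first.
      rewrite !indicE -natrM mulnb; congr (nat_of_bool _)%:R.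
      apply/idP/andP; rewrite !inE cE /=.
        move=> h; split; last by move=> i; have := h (lift ord0 i); rewrite !rcons0ES.
        by have := h 0; rewrite !rcons0E0 ler_distl /J/= in_itv.
      move=> [h1 h2] i; case: (unliftP ord0 i) => [j ->|->].
        by rewrite !rcons0ES; exact: h2.
      by rewrite !rcons0E0 ler_distl; move: h1; rewrite /J/= in_itv.
    rewrite EFinM.
    over.
  have mJ : measurable (J : set mR) by exact: measurable_itv.
  rewrite ge0_integralZr//=; last by apply/measurable_EFinP; exact: measurable_indic.
  have -> : (\int[mu]_x (\1_J x)%:E = mu J)%E by rewrite (integral_indic mu measurableT mJ) setIT.
  rewrite lebesgue_measure_itv/= lte_fin.
  case: ltP => h; last by (have -> : r = 0 by lra); rewrite mulr0.
  by rewrite -EFinB; congr (_%:E * _)%E; ring.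
rewrite eintZ; [|by apply: emeas_EFin; apply: rmeas_indic; exact: borel_cube|by move=> x; rewrite lee_fin|lra].
by rewrite -vol_set_eint ?IH -?EFinM ?exprS//; exact: borel_cube.
Qed.

Lemma bounded_finite_vol n (D : set 'rV[R]_n) : borel_set D -> bounded_box D ->
  finite_vol D.
Proof.
move=> mD [C DC]; split => //.
have D0 : D `<=` cube 0 `|C|.
  by move=> x Dx i; rewrite mxE subr0 (le_trans (DC _ Dx i))// ler_norm.
apply: (@le_lt_trans _ _ (leb n (rot n @^-1` cube 0 `|C|))).
  by apply: le_measure; rewrite ?inE//; [exact: borel_cube|move=> t; exact: D0].
by rewrite cube_vol// ltry.
Qed.

Section bmeas.
Variables (n : nat) (D : set 'rV[R]_n).
Implicit Types f g : 'rV[R]_n -> R.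

Lemma bmeas_cst c : bmeas D (fun=> c).
Proof. by split; [exact: rmeas_cst|exists `|c|]. Qed.

Lemma bmeasD f g : bmeas D f -> bmeas D g -> bmeas D (fun x => f x + g x).
Proof.
move=> [mf [C fC]] [mg [C' gC]]; split; first exact: rmeasD.
by exists (C + C') => x Dx; rewrite (le_trans (ler_normD _ _))// lerD ?fC ?gC.
Qed.

Lemma bmeasM f g : bmeas D f -> bmeas D g -> bmeas D (fun x => f x * g x).
Proof.
move=> [mf [C fC]] [mg [C' gC]]; split; first exact: rmeasM.
by exists (C * C') => x Dx; rewrite normrM ler_pM ?fC ?gC.
Qed.

Lemma bmeasZ c f : bmeas D f -> bmeas D (fun x => c * f x).
Proof. exact/bmeasM/bmeas_cst. Qed.

Lemma bmeasN f : bmeas D f -> bmeas D (fun x => - f x).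
Proof. by move=> [mf [C fC]]; split; [exact: rmeasN|exists C => x /fC; rewrite normrN]. Qed.

Lemma bmeasB f g : bmeas D f -> bmeas D g -> bmeas D (fun x => f x - g x).
Proof. by move=> nf /bmeasN; exact: bmeasD. Qed.

Lemma bmeasX f k : bmeas D f -> bmeas D (fun x => f x ^+ k).
Proof.
move=> nf; elim: k => [|k IH]; first exact: bmeas_cst.
by under eq_fun do rewrite exprS; exact: bmeasM.
Qed.

Lemma bmeas_sum I (s : seq I) (P : pred I) (f : I -> 'rV[R]_n -> R) :
  (forall i, P i -> bmeas D (f i)) -> bmeas D (fun x => \sum_(i <- s | P i) f i x).
Proof.
move=> nf; elim: s => [|i s IH].
  by under eq_fun do rewrite big_nil; exact: bmeas_cst.
under eq_fun do rewrite big_cons.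
by have [Pi|] := boolP (P i) => //; apply: bmeasD => //; exact: nf.
Qed.

Lemma bmeas_coord i : bounded_box D -> bmeas D (fun x => x 0 i).
Proof. by move=> [C DC]; split; [exact: rmeas_coord|exists C => x /DC]. Qed.

Hypothesis fD : finite_vol D.

Lemma bmeas_integrable f : bmeas D f ->
  (leb n).-integrable (rot n @^-1` D) (EFin \o (fun t => f (row_of_tuple t))).
Proof.
move=> [mf [C fC]]; apply: measurable_bounded_integrable; [exact: fD.1|exact: fD.2| |].
  exact: measurable_funTS.
exists C; split; first exact: num_real.
by move=> x Cx t Dt /=; rewrite (le_trans _ (ltW Cx))// fC.
Qed.

Lemma volD f g : bmeas D f -> bmeas D g ->
  vol_integral D (fun x => f x + g x) = vol_integral D f + vol_integral D g.
Proof.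
by move=> nf ng; apply: RintegralD; [exact: fD.1|exact: bmeas_integrable|exact: bmeas_integrable].
Qed.

Lemma volB f g : bmeas D f -> bmeas D g ->
  vol_integral D (fun x => f x - g x) = vol_integral D f - vol_integral D g.
Proof.
by move=> nf ng; apply: RintegralB; [exact: fD.1|exact: bmeas_integrable|exact: bmeas_integrable].
Qed.

Lemma volZ c f : bmeas D f ->
  vol_integral D (fun x => c * f x) = c * vol_integral D f.
Proof. by move=> nf; apply: RintegralZl; [exact: fD.1|exact: bmeas_integrable]. Qed.

Lemma vol0 : vol_integral D (fun=> 0) = 0.
Proof. by have := volZ 0 (bmeas_cst 0); rewrite !mul0r. Qed.

Lemma vol_sum I (s : seq I) (P : pred I) (f : I -> 'rV[R]_n -> R) :
  (forall i, P i -> bmeas D (f i)) ->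
  vol_integral D (fun x => \sum_(i <- s | P i) f i x) =
  \sum_(i <- s | P i) vol_integral D (f i).
Proof.
move=> nf; elim: s => [|i s IH].
  by under eq_fun do rewrite big_nil; rewrite big_nil vol0.
under eq_fun do rewrite big_cons; rewrite big_cons.
case: ifPn => Pi; last exact: IH.
by rewrite volD ?IH//; [exact: nf|exact: bmeas_sum].
Qed.

Lemma le_vol f g : bmeas D f -> bmeas D g -> (forall x, D x -> f x <= g x) ->
  vol_integral D f <= vol_integral D g.
Proof.
move=> nf ng fg; apply: le_Rintegral; [exact: fD.1|exact: bmeas_integrable|exact: bmeas_integrable|].
by move=> t; exact: fg.
Qed.

(* [2 |wg| <= e g^2 + w^2 / e] for all [e > 0] *)
Lemma vol_mul_eq0 w g : bmeas D w -> bmeas D g ->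
  vol_integral D (fun x => w x ^+ 2) = 0 -> vol_integral D (fun x => w x * g x) = 0.
Proof.
move=> nw ng w0; pose b := vol_integral D (fun x => w x * g x).
pose a := vol_integral D (fun x => g x ^+ 2).
have key c : 2 * c * b <= a * c ^+ 2.
  have : 0 <= vol_integral D (fun x => (c * g x - w x) ^+ 2).
    by apply: Rintegral_ge0 => t _; exact: sqr_ge0.
  rewrite (_ : (fun x => _) = (fun x => c ^+ 2 * g x ^+ 2 + (w x ^+ 2 + (- 2 * c) * (w x * g x)))).
    have nwg := bmeasM nw ng.
    rewrite volD ?volD ?volZ ?w0 -/a -/b; do ?[exact: bmeasX|exact: bmeasZ|
      apply: bmeasZ; exact: bmeasX|apply: bmeasD; [exact: bmeasX|exact: bmeasZ]|by []].
    lra.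
  by apply/funext => x; ring.
have a0 : 0 <= a by apply: Rintegral_ge0 => t _; exact: sqr_ge0.
(* With [c = b / (a + 1)], [key] reads [2 * (a + 1) * c ^+ 2 <= a * c ^+ 2], which forces [c = 0].
   The added 1 keeps the denominator nonzero when [a = 0]. *)
have := key (b / (a + 1)).
rewrite -/b; have a1 : a + 1 != 0 by rewrite gt_eqF// ltr_wpDl.
have -> : 2 * (b / (a + 1)) * b = 2 * (a + 1) * (b / (a + 1)) ^+ 2 by field.
move=> h; have : (b / (a + 1)) ^+ 2 <= 0.
  have s0 := sqr_ge0 (b / (a + 1)); nra.
rewrite exprn_even_le0//= mulf_eq0 invr_eq0 (negbTE a1) orbF.
by move/eqP.
Qed.

End bmeas.

Lemma vol_ge0 n (D : set 'rV[R]_n) f : (forall x, D x -> 0 <= f x) -> 0 <= vol_integral D f.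
Proof. by move=> f0; apply: Rintegral_ge0 => t; exact: f0. Qed.

Lemma eq_vol n (D : set 'rV[R]_n) f g : (forall x, D x -> f x = g x) ->
  vol_integral D f = vol_integral D g.
Proof. by move=> fg; apply: eq_Rintegral => t; rewrite inE => /fg. Qed.

(** Off a null set, the extensions by zero of [f] from [D] and from the intersection of [D] with [A]
    agree. This serves the Dirichlet condition, which holds only almost everywhere on facets. *)
Lemma vol_setI_null n (D A : set 'rV[R]_n) f : finite_vol D -> borel_set A ->
  bmeas D f ->
  (leb n).-negligible (rot n @^-1` (D `&` [set x | ~ A x /\ f x != 0])) ->
  vol_integral D f = vol_integral (D `&` A) f.
Proof.
move=> fD mA nf [N [mN N0 sN]].
have mDA : borel_set (D `&` A) by apply: borel_setI => //; exact: fD.1.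
rewrite /vol_integral /Rintegral; congr fine.
have fi := bmeas_integrable fD nf.
rewrite (negligible_integral mN fD.1 fi)//.
rewrite [RHS](negligible_integral mN mDA)//; last first.
  by apply: integrableS fi => //; [exact: fD.1|move=> t []].
rewrite integral_mkcond [RHS]integral_mkcond; apply: eq_integral => t _.
rewrite !patchE.
have [h1|h1] := pselect ((rot n @^-1` D `\` N) t); last first.
  by rewrite memNset// memNset// => -[[Dt _] Nt]; apply: h1.
rewrite mem_set//.
have [h2|h2] := pselect ((rot n @^-1` (D `&` A) `\` N) t); first by rewrite mem_set.
rewrite memNset//=; congr EFin; apply/eqP/negP => /negP f0.
case: h1 => Dt Nt; apply: (Nt); apply: sN; split => //=; split => // At.
by apply: h2; split => //; exact: Nt.
Qed.

Lemma eint_mulmx_affine n (A : 'M[R]_n) (b : 'rV[R]_n) (f : 'rV[R]_n -> \bar R) :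
  A \in unitmx -> emeas f ->
  (forall x, 0 <= f x)%E ->
  eint f = (`|\det A|%:E * eint (fun x => f (x *m A + b)%R))%E.
Proof.
move=> uA mf f0; rewrite -(eint_translate b mf f0).
apply: (det_scaling_unitmx uA) => //.
by have := emeas_affine 1%:M b mf; under eq_fun do rewrite mulmx1.
Qed.

Section affine.
Variables (n : nat) (A : 'M[R]_n) (b : 'rV[R]_n) (D : set 'rV[R]_n).
Hypotheses (uA : A \in unitmx) (fD : finite_vol D).
Local Notation D' := [set y | D (y *m A + b)].

Lemma finite_vol_affine : finite_vol D'.
Proof.
have mD' : borel_set D' by apply: borel_affine; exact: fD.1.
split => //; have := fD.2; rewrite !vol_set_eint//; last exact: fD.1.
rewrite (eint_mulmx_affine b uA); last 2 first.
- by apply: emeas_EFin; apply: rmeas_indic; exact: fD.1.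
- by move=> x; rewrite lee_fin.
rewrite (_ : eint (fun x => (\1_D (x *m A + b)%R)%:E) = eint (fun x => (\1_D' x)%:E)); last first.
  by apply: eq_eint => x; rewrite !indicE; congr ((nat_of_bool _)%:R)%:E;
    apply/idP/idP => /[!inE].
have d0 : 0 < `|\det A| by rewrite normr_gt0 -unitfE -unitmxE.
case: (eint _) => [r _||//]; first by rewrite ltry.
by rewrite gt0_muley ?lte_fin// ltxx.
Qed.

Lemma bmeas_affine f : bmeas D f -> bmeas D' (fun y => f (y *m A + b)).
Proof.
move=> [mf [C fC]]; split; first exact: rmeas_affine.
by exists C => x Dx; apply: fC.
Qed.

Let vol_affine_ge0 f : bmeas D f -> (forall x, D x -> 0 <= f x) ->
  vol_integral D f = `|\det A| * vol_integral D' (fun y => f (y *m A + b)).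
Proof.
move=> nf f0; rewrite !vol_eint => [|x Dx|x Dx]; [|exact: f0|exact: f0].
have mf : emeas (fun x => (f x * \1_D x)%:E).
  by apply: emeas_EFin; apply: rmeasM; [exact: nf.1|apply: rmeas_indic; exact: fD.1].
have f0' x : (0 <= (f x * \1_D x)%:E)%E.
  rewrite lee_fin indicE; case: (boolP (x \in D)) => [|_]; last by rewrite mulr0.
  by rewrite inE mulr1 => /f0.
rewrite (eint_mulmx_affine b uA mf f0') fineM//.
have := bmeas_integrable finite_vol_affine (bmeas_affine nf).
move=> /(integrable_fin_num finite_vol_affine.1).
rewrite integral_mkcond; set I1 := (X in X \is a fin_num -> _).
suff -> : I1 = eint (fun x => (f (x *m A + b) * \1_D (x *m A + b))%:E) by [].
apply: eq_integral => t _.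
rewrite patchE indicE.
have -> : (t \in rot n @^-1` D') = (row_of_tuple t *m A + b \in D).
  by apply/idP/idP => /[!inE].
by case: ifP => _ /=; rewrite ?mulr1// mulr0.
Qed.

(** Adding a bound [C] makes the integrand nonnegative; the formula for the constant [C] is then
    subtracted. *)
Lemma vol_affine f : bmeas D f ->
  vol_integral D f = `|\det A| * vol_integral D' (fun y => f (y *m A + b)).
Proof.
move=> nf; have [mf [C fC]] := nf.
have fC0 x : D x -> 0 <= f x + C.
  by move=> Dx; rewrite -lerBlDr sub0r lerNl (le_trans _ (fC x Dx))// -normrN ler_norm.
(* A point of [D] is what makes the bound [C] nonnegative. *)
have [[x Dx]|D0] := pselect (exists x, D x); last first.
  rewrite (@eq_vol _ D f (fun=> 0)); last by move=> x Dx; exfalso; apply: D0; exists x.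
  rewrite (@eq_vol _ D' _ (fun=> 0)); last first.
    by move=> x Dx; exfalso; apply: D0; exists (x *m A + b).
  by rewrite !vol0// ?mulr0//; exact: finite_vol_affine.
have C0 : 0 <= C by rewrite (le_trans _ (fC x Dx)).
have nC E : bmeas E (fun _ : 'rV[R]_n => C) by exact: bmeas_cst.
have := vol_affine_ge0 (bmeasD nf (nC D)) fC0.
rewrite !volD//; last 2 first.
- exact: finite_vol_affine.
- exact: bmeas_affine.
by rewrite mulrDr -(vol_affine_ge0 (nC D))// => /addIr.
Qed.

End affine.

End set_integral.

(** * Simplices and the divergence theorem *)

Section reference_simplex.
Variable R : realType.
Implicit Types n : nat.
Local Notation mu := (@lebesgue_measure R).
(** [ref_simplex] is indexed by the dimension of the space that contains the facet, so [rs n] is the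
    simplex of dimension [n]. *)
Local Notation rs n := (@ref_simplex R n.+1).

Lemma vol_gt0 n (D : set 'rV[R]_n) f c r a : finite_vol D -> bmeas D f ->
  0 < r -> cube c r `<=` D -> 0 < a -> (forall x, D x -> 0 <= f x) ->
  (forall x, cube c r x -> a <= f x) -> 0 < vol_integral D f.
Proof.
move=> fD nf r0 cD a0 f0 fa.
have nc : bmeas D (\1_(cube c r) : _ -> R).
  split; first by apply: rmeas_indic; exact: borel_cube.
  by exists 1 => x _; rewrite indicE; case: (_ \in _); rewrite ?normr0 ?normr1.
apply: (@lt_le_trans _ _ (vol_integral D (fun x => a * \1_(cube c r) x))); last first.
  apply: le_vol => //; first exact: bmeasZ.
  move=> x Dx; rewrite indicE; case: (boolP (x \in _)) => [/set_mem cx|_].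
    by rewrite mulr1; exact: fa.
  by rewrite mulr0; exact: f0.
rewrite volZ// mulr_gt0// vol_eint//.
rewrite (_ : eint _ = ((2 * r) ^+ n)%:E); first by rewrite /= exprn_gt0// mulr_gt0.
rewrite -(cube_vol c (ltW r0)) vol_set_eint; last exact: borel_cube.
apply: eq_eint => x; rewrite !indicE; case: (boolP (x \in cube c r)) => [/set_mem cx|_].
  by rewrite mem_set ?mulr1//; exact: cD.
by rewrite mul0r.
Qed.

Lemma rs_coord n (y : 'rV[R]_n) i : rs n y -> 0 <= y 0 i <= 1.
Proof.
move=> [y0 y1]; rewrite y0/= (le_trans _ y1)// (bigD1 i)//= lerDl.
by apply: sumr_ge0 => j _; exact: y0.
Qed.

Lemma rs_box n : bounded_box (rs n).
Proof. by exists 1 => y ry i; have /andP[y0 y1] := rs_coord i ry; rewrite ger0_norm. Qed.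

Lemma borel_rs n : borel_set (rs n).
Proof.
apply: borel_setI.
  by apply: borel_forall => i; apply: borel_le; [exact: rmeas_cst|exact: rmeas_coord].
apply: borel_le; last exact: rmeas_cst.
by apply: rmeas_sum => i _; exact: rmeas_coord.
Qed.

Lemma finite_vol_rs n : finite_vol (rs n).
Proof. exact: bounded_finite_vol (@borel_rs n) (@rs_box n). Qed.

Lemma rs_vol_gt0 n : 0 < vol_integral (rs n) (fun=> 1).
Proof.
(* The cube of half-side [r] centred at [(r, ..., r)] has coordinates in [[0, 2r]], whose sum is at
   most [n / (n + 1)]; this also covers [n = 0]. *)
pose r : R := (2 * n.+1%:R)^-1.
have n0 : (0 : R) < n.+1%:R by rewrite ltr0n.
have r0 : 0 < r by rewrite invr_gt0 mulr_gt0.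
apply: (@vol_gt0 _ _ _ (const_mx r) r 1) => //; first exact: finite_vol_rs.
  exact: bmeas_cst.
move=> y cy.
have h i : 0 <= y 0 i <= 2 * r by have := cy i; rewrite mxE ler_distl => /andP[]; lra.
split; first by move=> i; have /andP[] := h i.
apply: (@le_trans _ _ (\sum_(i < n) 2 * r)).
  by apply: ler_sum => i _; have /andP[] := h i.
rewrite sumr_const card_ord -mulr_natr [X in X <= 1](_ : _ = n%:R / n.+1%:R); last first.
  by rewrite /r; field; rewrite gt_eqF.
by rewrite ler_pdivrMr// mul1r ler_nat.
Qed.

Lemma sum_rcons0 n x (y : 'rV[R]_n) : \sum_i rcons0 x y 0 i = x + \sum_i y 0 i.
Proof. by rewrite big_ord_recl rcons0E0; under eq_bigr do rewrite rcons0ES. Qed.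

Lemma rs_rcons0 n x (y : 'rV[R]_n) :
  rs n.+1 (rcons0 x y) <-> rs n y /\ 0 <= x <= 1 - \sum_i y 0 i.
Proof.
split=> [[h1]|[[h1 h2]]/andP[x0 x1]].
  rewrite sum_rcons0 => h2.
  have y0 i : 0 <= y 0 i by have := h1 (lift ord0 i); rewrite rcons0ES.
  have x0 : 0 <= x by have := h1 0; rewrite rcons0E0.
  by split; [split => //; lra|lra].
split; last by rewrite sum_rcons0; lra.
move=> i; case: (unliftP ord0 i) => [j ->|->]; first by rewrite rcons0ES; exact: h1.
by rewrite rcons0E0.
Qed.

Lemma rmeas_rcons0 n (h : 'rV[R]_n -> R) (f : 'rV[R]_n.+1 -> R) : rmeas h -> rmeas f ->
  rmeas (fun y => f (rcons0 (h y) y)).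
Proof.
move=> mh; apply: (@rmeas_comp _ _ _ (fun y => rcons0 (h y) y)) => i.
case: (unliftP ord0 i) => [j ->|->].
  by under eq_fun do rewrite rcons0ES; exact: rmeas_coord.
by under eq_fun do rewrite rcons0E0.
Qed.

Section derive.
Variables (n : nat).
Implicit Types (G f : 'rV[R]_n.+1 -> R).

(** The values of [G] at the two ends of the fibre of the simplex over [y]. *)
Let slanted G (y : 'rV[R]_n) := G (rcons0 (1 - \sum_i y 0 i) y).
Let bottom G (y : 'rV[R]_n) := G (rcons0 0 y).

Lemma bmeas_slanted G : bmeas (rs n.+1) G -> bmeas (rs n) (slanted G).
Proof.
move=> [mG [C GC]]; split.
  apply: rmeas_rcons0 => //; apply: rmeasD; first exact: rmeas_cst.
  by apply: rmeasN; apply: rmeas_sum => i _; exact: rmeas_coord.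
exists C => y ry; apply: GC; apply/rs_rcons0; split => //.
by rewrite lexx andbT subr_ge0; exact: ry.2.
Qed.

Lemma bmeas_bottom G : bmeas (rs n.+1) G -> bmeas (rs n) (bottom G).
Proof.
move=> [mG [C GC]]; split.
  by apply: rmeas_rcons0 => //; exact: rmeas_cst.
exists C => y ry; apply: GC; apply/rs_rcons0; split => //.
by rewrite lexx subr_ge0; exact: ry.2.
Qed.

Let FTC (F f : R -> R) (b : R) : 0 <= b -> continuous f ->
  (forall x : R, is_derive x 1 F (f x)) ->
  (\int[mu]_(x in `[0%R, b]) (f x)%:E = (F b - F 0%R)%:E)%E.
Proof.
rewrite le_eqVlt => /predU1P[<- _ _|b0 cf dF].
  by rewrite set_itv1 integral_set1 subrr.
rewrite EFinB; apply: continuous_FTC2 => //.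
- by apply: continuous_subspaceT.
- have cF : continuous F.
    by move=> x; apply/differentiable_continuous/derivable1_diffP; have [] := dF x.
  split.
  + by move=> x _; have [] := dF x.
  + exact/cvg_at_right_filter/cF.
  + exact/cvg_at_left_filter/cF.
- by move=> x _; rewrite derive1E; have [] := dF x.
Qed.

Let vol_rs_derive_ge0 G f : bmeas (rs n.+1) G -> bmeas (rs n.+1) f ->
  (forall y, continuous (fun x => f (rcons0 x y))) ->
  (forall y (x : R), is_derive x 1 (fun x => G (rcons0 x y)) (f (rcons0 x y))) ->
  (forall x, rs n.+1 x -> 0 <= f x) ->
  vol_integral (rs n.+1) f = vol_integral (rs n) (fun y => slanted G y - bottom G y).
Proof.
move=> nG nf cf dG f0.
have mf : emeas (fun x => (f x * \1_(rs n.+1) x)%:E).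
  by apply: emeas_EFin; apply: rmeasM; [exact: nf.1|apply: rmeas_indic; exact: borel_rs].
have f0' x : (0 <= (f x * \1_(rs n.+1) x)%:E)%E.
  rewrite lee_fin indicE; case: (boolP (x \in _)) => [|_]; last by rewrite mulr0.
  by rewrite inE mulr1 => /f0.
have key y : rs n y -> (\int[mu]_x (f (rcons0 x y) * \1_(rs n.+1) (rcons0 x y))%:E =
    (slanted G y - bottom G y)%:E)%E.
  move=> ry; rewrite /slanted /bottom.
  have b0 : 0 <= 1 - \sum_i y 0 i by rewrite subr_ge0; exact: ry.2.
  rewrite -(FTC b0 (cf y) (dG y)).
  rewrite [RHS]integral_mkcond; apply: eq_integral => x _; rewrite patchE indicE.
  have -> : (rcons0 x y \in rs n.+1) = (x \in `[0, 1 - \sum_i y 0 i]%classic).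
    apply/idP/idP; rewrite !inE/= in_itv/=.
      by move=> /rs_rcons0[].
    by move=> h; apply/rs_rcons0.
  by case: ifP => _; rewrite ?mulr1// mulr0.
have h0 y : rs n y -> 0 <= slanted G y - bottom G y.
  by move=> ry; rewrite -lee_fin -key//; exact: integral_ge0.
rewrite vol_eint// (eint_tonelli2 mf f0') vol_eint//; congr fine.
apply: eq_eint => y; have [ry|ry] := pselect (rs n y).
  by rewrite key// indicE mem_set// mulr1.
rewrite [\1__ y]indicE memNset// mulr0; apply: integral0_eq => x _.
by rewrite indicE memNset ?mulr0// => /rs_rcons0[].
Qed.

(** The fundamental theorem of calculus along the fibres in the first coordinate. Tonelli's theorem
    asks for a nonnegative [f], so a bound [C] is added to [f] and its antiderivative [P] to [G]. *)
Lemma vol_rs_derive G f : bmeas (rs n.+1) G -> bmeas (rs n.+1) f ->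
  (forall y, continuous (fun x => f (rcons0 x y))) ->
  (forall y (x : R), is_derive x 1 (fun x => G (rcons0 x y)) (f (rcons0 x y))) ->
  vol_integral (rs n.+1) f =
  vol_integral (rs n) (fun y => G (rcons0 (1 - \sum_i y 0 i) y))
  - vol_integral (rs n) (fun y => G (rcons0 0 y)).
Proof.
move=> nG nf cf dG; have [_ [C0 fC0]] := nf; pose C := `|C0|.
have fC x : rs n.+1 x -> - C <= f x <= C.
  by move=> rx; rewrite -ler_norml (le_trans (fC0 _ rx))// ler_norm.
have frs := @finite_vol_rs n; have frs1 := @finite_vol_rs n.+1.
pose P (x : 'rV[R]_n.+1) := C * x 0 0.
have nP : bmeas (rs n.+1) P by apply: bmeasZ; apply: bmeas_coord; exact: rs_box.
have dP y (x : R) : is_derive x 1 (fun x => P (rcons0 x y)) C.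
  rewrite /P; under eq_fun do rewrite rcons0E0.
  by apply: is_derive_eq; rewrite /GRing.scale/= mulr1.
have hP : vol_integral (rs n.+1) (fun=> C) =
    vol_integral (rs n) (fun y => slanted P y - bottom P y).
  apply: vol_rs_derive_ge0 => //; first exact: bmeas_cst.
  - by move=> y x; exact: cvg_cst.
  - by move=> x _; exact: normr_ge0.
have h : vol_integral (rs n.+1) (fun x => f x + C) = vol_integral (rs n)
    (fun y => slanted (fun x => G x + P x) y - bottom (fun x => G x + P x) y).
  apply: vol_rs_derive_ge0.
  - exact: bmeasD.
  - by apply: bmeasD => //; exact: bmeas_cst.
  - by move=> y x; apply: cvgD; [exact: cf|exact: cvg_cst].
  - by move=> x /fC; lra.
have nsG := bmeas_slanted nG; have nbG := bmeas_bottom nG.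
have nsP := bmeas_slanted nP; have nbP := bmeas_bottom nP.
move: h; rewrite volD => [|//|//|]; last exact: bmeas_cst.
rewrite (@eq_vol _ _ (rs n) _
  (fun y => (slanted G y - bottom G y) + (slanted P y - bottom P y))); last first.
  by move=> y _; rewrite /slanted /bottom; ring.
rewrite volD//; [|exact: bmeasB|exact: bmeasB].
by rewrite -hP volB// => /addIr.
Qed.

End derive.

End reference_simplex.

(** * Affine parametrizations of simplices and reordering of vertices *)

Section parametrization.
Variables (R : realType) (N : nat).
Implicit Types (m : nat) (s t : seq 'rV[R]_N).
Local Notation rs n := (@ref_simplex R n.+1).

Definition edges m s : 'M[R]_(m, N) := \matrix_(i < m) (s`_i.+1 - s`_0).

Definition param m s (y : 'rV[R]_m) : 'rV[R]_N := s`_0 + y *m edges m s.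

(** Barycentric coordinates, that of the base vertex at index 0. They treat all vertices alike,
    which reference coordinates do not. *)
Definition bary m (y : 'rV[R]_m) : 'rV[R]_m.+1 := rcons0 (1 - \sum_i y 0 i) y.

Lemma bary0 m (y : 'rV[R]_m) : bary y 0 0 = 1 - \sum_i y 0 i.
Proof. exact: rcons0E0. Qed.

Lemma baryS m (y : 'rV[R]_m) i : bary y 0 (lift ord0 i) = y 0 i.
Proof. exact: rcons0ES. Qed.

Lemma sum_bary m (y : 'rV[R]_m) : \sum_i bary y 0 i = 1.
Proof. by rewrite sum_rcons0 subrK. Qed.

Lemma param_bary m s (y : 'rV[R]_m) : param s y = \sum_(i < m.+1) bary y 0 i *: s`_i.
Proof.
rewrite /param big_ord_recl bary0 mulmx_sum_row.
rewrite (eq_bigr (fun i : 'I_m => y 0 i *: s`_i.+1 - y 0 i *: s`_0)); last first.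
  by move=> i _; rewrite rowK scalerBr.
rewrite [X in _ = _ + X](eq_bigr (fun i : 'I_m => y 0 i *: s`_i.+1)); last first.
  by move=> i _; rewrite baryS.
rewrite sumrB -scaler_suml scalerBl scale1r /=; set S := (\sum_i y 0 i *: _).
by apply/rowP => i; rewrite !mxE; ring.
Qed.

(** The first coordinate moves parallel to the edge from [b] to [a], starting on the facet opposite
    [a]; by [param_slanted] the fibre ends on the facet opposite [b]. *)
Lemma param_cons m a b s x (y : 'rV[R]_m) :
  param [:: b, a & s] (rcons0 x y) = param (b :: s) y + x *: (a - b).
Proof.
rewrite !param_bary !big_ord_recl /= !rcons0E0.
rewrite (_ : rcons0 _ _ 0 (lift _ _) = x); last by rewrite /bary rcons0ES rcons0E0.
rewrite sum_rcons0.
under eq_bigr do rewrite /bary !rcons0ES; under [X in _ = _ + X + _]eq_bigr do rewrite /bary !rcons0ES.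
set T := (\sum_(i < m) y 0 i *: _); set S := \sum_i y 0 i.
by apply/rowP => i; rewrite !mxE; ring.
Qed.

Lemma param_slanted m a b s (y : 'rV[R]_m) :
  param [:: b, a & s] (rcons0 (1 - \sum_i y 0 i) y) = param (a :: s) y.
Proof.
rewrite param_cons !param_bary !big_ord_recl /= !rcons0E0 addrAC; congr (_ + _).
by rewrite -scalerDr addrCA subrr addr0.
Qed.

Section reorder.
Variables (m : nat) (tau : 'S_m.+1).

(** The affine map that permutes barycentric coordinates by [tau]; [reorder_mx] is its linear
    part. *)
Definition reorder (y : 'rV[R]_m) : 'rV[R]_m :=
  \row_j bary y 0 (tau (lift ord0 j)).

Lemma bary_reorder y i : bary (reorder y) 0 i = bary y 0 (tau i).
Proof.
case: (unliftP ord0 i) => [j ->|->]; first by rewrite /bary rcons0ES mxE.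
rewrite {1}/bary rcons0E0; under eq_bigr do rewrite mxE.
have := sum_bary y; rewrite (reindex_inj (@perm_inj _ tau)) big_ord_recl /=.
move=> <-; ring.
Qed.

Definition reorder_mx : 'M[R]_m :=
  \matrix_(k, j) (bary (delta_mx 0 k) 0 (tau (lift ord0 j)) - bary 0 0 (tau (lift ord0 j))).

Lemma bary_affine (y : 'rV[R]_m) i :
  bary y 0 i = bary 0 0 i + \sum_k y 0 k * (bary (delta_mx 0 k) 0 i - bary 0 0 i).
Proof.
have z0 k : (0 : 'rV[R]_m) 0 k = 0 by rewrite mxE.
have zd k j : (delta_mx 0 k : 'rV[R]_m) 0 j = (j == k)%:R by rewrite mxE eqxx.
case: (unliftP ord0 i) => [j ->|->].
  rewrite !baryS z0 add0r (bigD1 j)//= baryS zd eqxx subr0 mulr1 big1 ?addr0//.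
  by move=> k kj; rewrite baryS zd eq_sym (negbTE kj) subr0 mulr0.
have s0 : \sum_i (0 : 'rV[R]_m) 0 i = 0 by rewrite big1.
rewrite !bary0 s0 subr0; congr (_ + _); rewrite -sumrN; apply: eq_bigr => k _.
rewrite bary0 (bigD1 k)//= zd eqxx big1 => [|j jk]; last by rewrite zd (negbTE jk).
by rewrite mulr1n; ring.
Qed.

Lemma reorderE y : reorder y = y *m reorder_mx + reorder 0.
Proof.
apply/rowP => j; rewrite [LHS]mxE bary_affine addrC [RHS]mxE; congr (_ + _).
  by rewrite [RHS]mxE; apply: eq_bigr => k _; rewrite [reorder_mx _ _]mxE.
by rewrite [RHS]mxE.
Qed.

Lemma rs_bary (y : 'rV[R]_m) : rs m y <-> forall i, 0 <= bary y 0 i.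
Proof.
split=> [[y0 y1] i|h].
  case: (unliftP ord0 i) => [j ->|->]; first by rewrite /bary rcons0ES.
  by rewrite /bary rcons0E0 subr_ge0.
split; first by move=> j; have := h (lift ord0 j); rewrite /bary rcons0ES.
by have := h 0; rewrite /bary rcons0E0 subr_ge0.
Qed.

Lemma bary_inj (y z : 'rV[R]_m) : (forall i, bary y 0 i = bary z 0 i) -> y = z.
Proof. by move=> h; apply/rowP => j; have := h (lift ord0 j); rewrite /bary !rcons0ES. Qed.

Lemma rs_reorder y : rs m (reorder y) <-> rs m y.
Proof.
split=> /rs_bary h; apply/rs_bary => i; last by rewrite bary_reorder.
by have := h ((tau^-1)%g i); rewrite bary_reorder permKV.
Qed.

End reorder.

Lemma reorderK m (tau : 'S_m.+1) : cancel (reorder tau) (reorder (tau^-1)%g).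
Proof. by move=> y; apply: bary_inj => i; rewrite !bary_reorder permKV. Qed.

Lemma reorder_mx_unit m (tau : 'S_m.+1) : reorder_mx tau \in unitmx.
Proof.
have [] // := @mulmx1_unit _ _ (reorder_mx tau) (reorder_mx (tau^-1)%g).
have E y : (y *m reorder_mx tau + reorder tau 0) *m reorder_mx (tau^-1)%g +
    reorder (tau^-1)%g 0 = y by rewrite -!reorderE reorderK.
have h (y : 'rV[R]_m) : y *m (reorder_mx tau *m reorder_mx (tau^-1)%g) = y.
  have := E y; have := E 0; rewrite mul0mx add0r mulmxDl -addrA => ->.
  by rewrite addr0 mulmxA.
by apply/row_matrixP => i; rewrite !rowE h mulmx1.
Qed.

(* The reordering maps the reference simplex onto itself, so it preserves a
   finite positive volume. *)
Lemma det_reorder_mx m (tau : 'S_m.+1) : `|\det (reorder_mx tau)| = 1.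
Proof.
have := vol_affine (reorder tau 0) (reorder_mx_unit tau) (@finite_vol_rs R m)
  (bmeas_cst (rs m) 1).
rewrite (_ : [set y | _] = rs m); last first.
  by apply/seteqP; split => y /=; rewrite -reorderE => /rs_reorder.
have v0 := @rs_vol_gt0 R m; rewrite -[LHS]mul1r => /mulIf -> //.
by rewrite gt_eqF.
Qed.

Lemma param_reorder m (tau : 'S_m.+1) s s' (y : 'rV[R]_m) :
  (forall i : 'I_m.+1, s'`_i = s`_(tau i)) ->
  param s' y = param s (reorder (tau^-1)%g y).
Proof.
move=> ss'; rewrite !param_bary [RHS](reindex_inj (@perm_inj _ tau)).
by apply: eq_bigr => i _; rewrite bary_reorder permK ss'.
Qed.

(** [facet_param] lists the vertices in the order of [enum], while differentiation along an edge
    needs its two end points in front; this lemma reconciles the orders. *)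
Lemma vol_param_perm m s s' (f : 'rV[R]_N -> R) : perm_eq s s' -> size s = m.+1 ->
  bmeas (rs m) (fun y => f (param s y)) ->
  vol_integral (rs m) (fun y => f (param s' y)) =
  vol_integral (rs m) (fun y => f (param s y)).
Proof.
move=> pss' sz nf.
have sz1 : size s == m.+1 by rewrite sz.
move: pss'; rewrite perm_sym -[s]/(tval (Tuple sz1)) => /tuple_permP[tau s'E].
have ss' (i : 'I_m.+1) : s'`_i = s`_(tau i).
  rewrite s'E -[in RHS]/(tval (Tuple sz1)) -!(tnth_nth 0) tnth_mktuple.
  by [].
rewrite (@eq_vol _ _ _ _ (fun y => f (param s (reorder (tau^-1)%g y)))) => [|y _]; last first.
  by rewrite (param_reorder _ ss').
pose A := reorder_mx (tau^-1)%g; pose b := reorder (tau^-1)%g (0 : 'rV[R]_m).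
rewrite [RHS](vol_affine b (reorder_mx_unit (tau^-1)%g) (@finite_vol_rs R m))//.
rewrite det_reorder_mx mul1r.
rewrite (_ : [set y | _] = rs m); last first.
  by apply/seteqP; split => y /=; rewrite -reorderE => /rs_reorder.
by apply: eq_vol => y _; rewrite reorderE.
Qed.

End parametrization.

(** * Polynomials as functions: evaluation, derivatives, degree *)

Section polynomials.
Variables (R : realType) (d : nat).
Implicit Types (p q : spoly R d) (x z e : 'rV[R]_d).

Lemma mpoly_alg_ind (P : spoly R d -> Prop) :
  (forall c, P (mpolyC d c)) -> (forall i, P (mpolyX R (mnm1 i))) ->
  (forall p q, P p -> P q -> P (p + q)) -> (forall p q, P p -> P q -> P (p * q)) ->
  forall p, P p.
Proof.
move=> PC PX PD PM p; rewrite (mpolyE p).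
have PXm m : P (mpolyX R m).
  rewrite mpolyXE_id; apply: (big_ind P) => [|//|i _]; first by rewrite -(mpolyC1 d R).
  elim: (m i) => [|k IH]; first by rewrite expr0 -(mpolyC1 d R).
  by rewrite exprS; exact: PM.
apply: (big_ind P) => [|//|m _]; first by rewrite -(mpolyC0 d R).
by rewrite -mul_mpolyC; exact: PM.
Qed.

Lemma pevalC c x : peval (mpolyC d c) x = c. Proof. exact: mevalC. Qed.
Lemma pevalX i x : peval (mpolyX R (mnm1 i)) x = x 0 i. Proof. exact: mevalXU. Qed.
Lemma peval0 x : peval (0 : spoly R d) x = 0. Proof. exact: meval0. Qed.
Lemma pevalD p q x : peval (p + q) x = peval p x + peval q x. Proof. exact: mevalD. Qed.
Lemma pevalB p q x : peval (p - q) x = peval p x - peval q x. Proof. exact: mevalB. Qed.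
Lemma pevalM p q x : peval (p * q) x = peval p x * peval q x. Proof. exact: mevalM. Qed.
Lemma pevalZ c p x : peval (c *: p) x = c * peval p x. Proof. exact: mevalZ. Qed.
Lemma peval_sum I (s : seq I) (P : pred I) (F : I -> spoly R d) x :
  peval (\sum_(i <- s | P i) F i) x = \sum_(i <- s | P i) peval (F i) x.
Proof. exact: raddf_sum. Qed.

Lemma gradE p x j : grad p x 0 j = peval (mderiv j p) x. Proof. by rewrite mxE. Qed.

Definition dirderiv e p : spoly R d := \sum_j e 0 j *: mderiv j p.

Lemma peval_dirderiv e p x : peval (dirderiv e p) x = dotp e (grad p x).
Proof. by rewrite peval_sum; apply: eq_bigr => j _; rewrite pevalZ gradE. Qed.

Lemma bmeas_peval (D : set 'rV[R]_d) p : bounded_box D -> bmeas D (peval p).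
Proof.
move=> bD; elim/mpoly_alg_ind: p => [c|i|p q mp mq|p q mp mq].
- by rewrite (funext (pevalC c)); exact: bmeas_cst.
- by rewrite (funext (pevalX i)); exact: bmeas_coord.
- by rewrite (funext (pevalD p q)); exact: bmeasD.
- by rewrite (funext (pevalM p q)); exact: bmeasM.
Qed.

Lemma is_derive_peval p z e (t : R) :
  is_derive t 1 (fun t => peval p (z + t *: e)) (dotp e (grad p (z + t *: e))).
Proof.
elim/mpoly_alg_ind: p => [c|i|p q hp hq|p q hp hq].
- under eq_fun do rewrite pevalC; apply: is_derive_eq.
  by rewrite /dotp big1// => j _; rewrite gradE mderivC peval0 mulr0.
- under eq_fun do rewrite pevalX !mxE.
  apply: is_derive_eq; rewrite /dotp (bigD1 i)//= big1 => [|j ji].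
    rewrite gradE mderivX mnmE eqxx scale1r (_ : mnm_sub _ _ = mnm0) ?mpolyX0 -?(mpolyC1 d R) ?pevalC; last first.
      by apply/mnmP => j; rewrite !mnmE subnn.
    by rewrite /GRing.scale/=; ring.
  by rewrite gradE mderivX mnmE eq_sym (negbTE ji) scale0r peval0 mulr0.
- under eq_fun do rewrite pevalD; apply: is_derive_eq.
  by rewrite /dotp -big_split/=; apply: eq_bigr => j _; rewrite !gradE mderivD pevalD mulrDr.
- under eq_fun do rewrite pevalM; apply: is_derive_eq.
  rewrite /dotp /GRing.scale/= !mulr_sumr -big_split/=; apply: eq_bigr => j _.
  by rewrite !gradE mderivM pevalD !pevalM; ring.
Qed.

Lemma continuous_peval_line p z e : continuous (fun t : R => peval p (z + t *: e)).
Proof.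
by move=> t; apply/differentiable_continuous/derivable1_diffP; have [] := is_derive_peval p z e t.
Qed.

Lemma continuous_peval p : continuous (peval p).
Proof.
elim/mpoly_alg_ind: p => [c|i|p q mp mq|p q mp mq] x.
- by rewrite (funext (pevalC c)); exact: cst_continuous.
- by rewrite (funext (pevalX i)); exact: coord_continuous.
- by rewrite (funext (pevalD p q)); apply: continuousD; [exact: mp|exact: mq].
- by rewrite (funext (pevalM p q)); apply: continuousM; [exact: mp|exact: mq].
Qed.

Lemma has_degD k p q : has_deg k p -> has_deg k q -> has_deg k (p + q).
Proof.
rewrite /has_deg => hp hq; apply: leq_trans (msizeD_le _ _) _.
by rewrite geq_max hp hq.
Qed.

Lemma has_degN k p : has_deg k p -> has_deg k (- p).
Proof. by rewrite /has_deg msizeN. Qed.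

Lemma has_deg0 k : has_deg k (0 : spoly R d).
Proof. by rewrite /has_deg msize0. Qed.

Lemma has_degZ k c p : has_deg k p -> has_deg k (c *: p).
Proof. by rewrite /has_deg => hp; apply: leq_trans (msizeZ_le _ _) hp. Qed.

Lemma has_deg_sum k I (s : seq I) (P : pred I) (F : I -> spoly R d) :
  (forall i, P i -> has_deg k (F i)) -> has_deg k (\sum_(i <- s | P i) F i).
Proof.
by move=> hF; elim/big_ind : _ => //; [exact: has_deg0|exact: has_degD].
Qed.

Lemma has_deg_mderiv k i p : has_deg k p -> has_deg k.-1 (mderiv i p).
Proof.
rewrite /has_deg => hp; rewrite [msize _]mmeasureE; apply/bigmax_leqP_seq => m + _.
rewrite mcoeff_msupp mcoeff_mderiv => hm.
have : (mnm_add m (mnm1 i)) \in msupp p.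
  by rewrite mcoeff_msupp; apply: contraNneq hm => ->; rewrite mul0rn.
move=> /msize_mdeg_lt; rewrite mdegD mdeg1 addn1 => /leq_trans/(_ hp).
(* For [k = 0] the assumption is contradictory, so the truncation in [k.-1] does no harm. *)
by case: k {hp}.
Qed.

End polynomials.

(** * Integrals over a cell and over its facets *)

Section simplex.
Variables (R : realType) (n : nat) (M : simplices R n.+1).
Local Notation V := (vertex M).
Local Notation p := (@vertex_pos R n.+1 M).
Local Notation rs n := (@ref_simplex R n.+1).
Implicit Types (K F S : {set V}) (s : seq V) (x e : 'rV[R]_n.+1) (g : spoly R n.+1).

Definition pts s : seq 'rV[R]_n.+1 := [seq p v | v <- s].

Lemma nth_pts s v0 i : (i < size s)%N -> (pts s)`_i = p (nth v0 s i).
Proof. by move=> si; rewrite (nth_map v0). Qed.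

Lemma sum_simplex (Z : zmodType) m S s v0 (f : V -> Z) :
  perm_eq s (enum S) -> size s = m.+1 ->
  \sum_(v in S) f v = \sum_(i < m.+1) f (nth v0 s i).
Proof.
move=> pS sz; rewrite -big_enum -(perm_big _ pS)/= (big_nth v0) big_mkord sz.
by [].
Qed.

(** Turns coordinates indexed by positions in [s] into weights on vertices, the form used by [hull]
    and [affinely_independent]. *)
Definition weight m s (c : 'rV[R]_m.+1) v : R := c 0 (inord (index v s)).

Lemma weightE m s (c : 'rV[R]_m.+1) v0 (i : 'I_m.+1) : uniq s -> size s = m.+1 ->
  weight s c (nth v0 s i) = c 0 i.
Proof. by move=> us sz; rewrite /weight index_uniq// ?sz// inord_val. Qed.

Lemma perm_enum_uniq S s : perm_eq s (enum S) -> uniq s.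
Proof. by move/perm_uniq ->; exact: enum_uniq. Qed.

Lemma hull_param m S s x : perm_eq s (enum S) -> size s = m.+1 ->
  hull S x <-> exists2 y : 'rV[R]_m, rs m y & x = param (pts s) y.
Proof.
move=> pS sz; have us := perm_enum_uniq pS.
case: s sz us pS => // v0 s' sz us pS; set s := v0 :: s' in sz us pS *.
have sS i : (i < m.+1)%N -> nth v0 s i \in S.
  by move=> im; rewrite -mem_enum -(perm_mem pS) mem_nth// sz.
split=> [[w [w0 w1 ->]]|[y ry ->]].
  rewrite (sum_simplex v0 _ pS sz) in w1; rewrite (sum_simplex v0 _ pS sz).
  pose y : 'rV[R]_m := \row_j w (nth v0 s j.+1).
  have yE i : bary y 0 i = w (nth v0 s i).
    case: (unliftP ord0 i) => [j ->|->]; first by rewrite baryS mxE.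
    have yj j : y 0 j = w (nth v0 s (lift ord0 j)) by rewrite mxE.
    by rewrite bary0 (eq_bigr _ (fun j _ => yj j)) -w1 big_ord_recl addrK.
  exists y; first by apply/rs_bary => i; rewrite yE w0// sS.
  rewrite param_bary; apply: eq_bigr => i _.
  by rewrite yE (nth_pts v0)// sz.
have wE := weightE (bary y) v0 _ us sz.
exists (weight s (bary y)); split.
- move=> v vS; have vs : v \in s by rewrite (perm_mem pS) mem_enum.
  by rewrite /weight; move/rs_bary : ry.
- rewrite (sum_simplex v0 _ pS sz) -(sum_bary y); apply: eq_bigr => i _.
  exact: wE.
- rewrite (sum_simplex v0 _ pS sz) param_bary; apply: eq_bigr => i _.
  by rewrite wE (nth_pts v0)// sz.
Qed.

Lemma hull_vertex S v : v \in S -> hull S (p v).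
Proof.
move=> vS; exists (fun w => (w == v)%:R); split => //.
  by rewrite (bigD1 v)//= eqxx big1 ?addr0// => w /andP[_ /negbTE ->].
rewrite (bigD1 v)//= eqxx scale1r big1 ?addr0// => w /andP[_ /negbTE ->].
by rewrite scale0r.
Qed.

Lemma bounded_param m (t : seq 'rV[R]_n.+1) i :
  bmeas (rs m) (fun y => param t y 0 i).
Proof.
under eq_fun do rewrite /param mxE [X in _ + X]mxE.
apply: bmeasD; first exact: bmeas_cst.
apply: bmeas_sum => j _; apply: bmeasM; last exact: bmeas_cst.
exact/bmeas_coord/rs_box.
Qed.

Lemma bounded_hull S : bounded_box (hull S).
Proof.
have [->|[v vS]] := set_0Vmem S.
  by exists 0 => x [w [_ /eqP]]; rewrite big_set0 eq_sym oner_eq0.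
have pS : perm_eq (enum S) (enum S) by [].
have sz : size (enum S) = #|S|.-1.+1 by rewrite -cardE prednK//; apply/card_gt0P; exists v.
have bd i : exists C : R, forall y, rs #|S|.-1 y -> `|param (pts (enum S)) y 0 i| <= C.
  by have [_] := @bounded_param #|S|.-1 (pts (enum S)) i.
pose C i := projT1 (cid (bd i)).
exists (\sum_i `|C i|) => x /(hull_param _ pS sz)[y ry ->] i.
rewrite (le_trans (projT2 (cid (bd i)) y ry))// -/(C i) (bigD1 i)//=.
by rewrite (le_trans (ler_norm _))// lerDl sumr_ge0.
Qed.

Section cell.
Variable K : {set V}.
Hypothesis hK : is_dsimplex K.

Lemma size_cell s : perm_eq s (enum K) -> size s = n.+2.
Proof. by move=> /perm_size ->; rewrite -cardE hK.1. Qed.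

(** The base vertex receives minus the sum of the other weights. A combination of edges thus becomes
    one of vertices with total weight 0, to which affine independence applies. *)
Lemma weight_edges s (y : 'rV[R]_n.+1) : perm_eq s (enum K) ->
  let c := weight s (rcons0 (- \sum_i y 0 i) y) in
  \sum_(v in K) c v = 0 /\ \sum_(v in K) c v *: p v = y *m edges n.+1 (pts s).
Proof.
move=> pK; have sz := size_cell pK; have us := perm_enum_uniq pK.
case: s sz us pK => // v0 s' sz us pK; set s := v0 :: s' in sz us pK *.
have wE i := weightE (rcons0 (- \sum_i y 0 i) y) v0 i us sz.
cbv zeta; rewrite !(sum_simplex v0 _ pK sz); split.
  by rewrite (eq_bigr _ (fun i _ => wE i)) sum_rcons0 addNr.
rewrite big_ord_recl wE rcons0E0 mulmx_sum_row.
rewrite [RHS](eq_bigr (fun i : 'I_n.+1 => y 0 i *: p (nth v0 s i.+1) - y 0 i *: p (nth v0 s 0))); last first.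
  by move=> i _; rewrite rowK scalerBr !(nth_pts v0) ?sz// ltnS.
rewrite sumrB -scaler_suml addrC scaleNr; congr (_ - _).
by apply: eq_bigr => i _; rewrite wE rcons0ES.
Qed.

Lemma edges_unit s : perm_eq s (enum K) -> edges n.+1 (pts s) \in unitmx.
Proof.
move=> pK; have sz := size_cell pK; have us := perm_enum_uniq pK.
case: s sz us pK => // v0 s' sz us pK; set s := v0 :: s' in sz us pK *.
rewrite -row_free_unit; apply/inj_row_free => y yE.
have [w0 wp] := weight_edges y pK.
have := hK.2 _ w0; rewrite wp => /(_ yE) h; apply/rowP => j; rewrite mxE.
have js : (j.+1 < size s)%N by rewrite sz !ltnS -ltnS ltn_ord.
have := h (nth v0 s j.+1); rewrite -mem_enum -(perm_mem pK) mem_nth// => /(_ isT).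
by rewrite -[j.+1]/(val (lift ord0 j)) (weightE _ _ _ us sz) rcons0ES.
Qed.

Lemma hull_cell s x : perm_eq s (enum K) ->
  hull K x <-> rs n.+1 ((x - (pts s)`_0) *m invmx (edges n.+1 (pts s))).
Proof.
move=> pK; have uE := edges_unit pK; rewrite (hull_param _ pK (size_cell pK)).
split=> [[y ry ->]|h]; first by rewrite /param addrAC subrr add0r mulmxK.
exists ((x - (pts s)`_0) *m invmx (edges n.+1 (pts s))) => //.
by rewrite /param mulmxKV// addrC subrK.
Qed.

Lemma finite_vol_hull : finite_vol (hull K).
Proof.
apply: bounded_finite_vol; last exact: bounded_hull.
have pK : perm_eq (enum K) (enum K) by [].
set s := enum K in pK; pose A := invmx (edges n.+1 (pts s)).
have := borel_affine A (- (pts s)`_0 *m A) (@borel_rs R n.+1).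
congr borel_set; apply/seteqP; split => x /=; rewrite -mulmxDl => h; exact/(hull_cell _ pK).
Qed.

Lemma bmeas_hull_peval g : bmeas (hull K) (peval g).
Proof. exact/bmeas_peval/bounded_hull. Qed.

Lemma cell_integral_param s (f : 'rV[R]_n.+1 -> R) : perm_eq s (enum K) ->
  bmeas (hull K) f ->
  cell_integral K f =
  `|\det (edges n.+1 (pts s))| * vol_integral (rs n.+1) (fun y => f (param (pts s) y)).
Proof.
move=> pK nf; have uE := edges_unit pK.
rewrite /cell_integral (vol_affine (pts s)`_0 uE finite_vol_hull nf).
rewrite (_ : [set y | _] = rs n.+1); last first.
  apply/seteqP; split => y /=.
    by move=> /(hull_cell _ pK); rewrite addrK mulmxK.
  by move=> ry; apply/(hull_cell _ pK); rewrite addrK mulmxK.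
by congr (_ * _); apply: eq_vol => y _; rewrite /param addrC.
Qed.

(** A ratio of volumes rather than a determinant, hence visibly independent of the order of the
    vertices; [det_edges] identifies the two. *)
Definition vol_ratio : R := cell_integral K (fun=> 1) / vol_integral (rs n.+1) (fun=> 1).

Lemma det_edges s : perm_eq s (enum K) -> `|\det (edges n.+1 (pts s))| = vol_ratio.
Proof.
move=> pK; rewrite /vol_ratio (cell_integral_param pK (bmeas_cst _ 1)).
by rewrite mulfK// gt_eqF// rs_vol_gt0.
Qed.

(** The surface integral without its area element; it is not normalized by the volume of the
    reference simplex. *)
Definition facet_mean F g : R := vol_integral (rs n) (fun y => peval g (facet_param F y)).

Lemma bmeas_param_peval m (t : seq 'rV[R]_n.+1) g :
  bmeas (rs m) (fun y => peval g (param t y)).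
Proof.
elim/mpoly_alg_ind: g => [c|i|q r mq mr|q r mq mr].
- by rewrite (funext (fun y => pevalC c _)); exact: bmeas_cst.
- by rewrite (funext (fun y => pevalX i _)); exact: bounded_param.
- by rewrite (funext (fun y => pevalD q r _)); exact: bmeasD.
- by rewrite (funext (fun y => pevalM q r _)); exact: bmeasM.
Qed.

Lemma facet_mean_perm F t g : perm_eq t (enum F) -> size t = n.+1 ->
  vol_integral (rs n) (fun y => peval g (param (pts t) y)) = facet_mean F g.
Proof.
move=> pF sz; symmetry; apply: (@vol_param_perm _ _ _ (pts t) (pts (enum F)) (peval g)).
- exact: perm_map.
- by rewrite size_map.
- exact: bmeas_param_peval.
Qed.

(** With [b] as base vertex and [a] next, the derivative along the edge is the one in the first
    reference coordinate. Integrating along the fibres leaves the facets opposite [b] and [a]; all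
    others are parallel to the edge. *)
Lemma cell_integral_edge a b g : a \in K -> b \in K -> a != b ->
  cell_integral K (peval (dirderiv (p a - p b) g)) =
  vol_ratio * (facet_mean (K :\ b) g - facet_mean (K :\ a) g).
Proof.
move=> aK bK ab; pose t := enum (K :\ a :\ b); pose s := [:: b, a & t].
have bKa : b \in K :\ a by rewrite !inE eq_sym ab.
have aKb : a \in K :\ b by rewrite !inE ab.
have pe S v : v \in S -> perm_eq (v :: enum (S :\ v)) (enum S).
  move=> vS; apply: uniq_perm => [||w]; rewrite /= ?enum_uniq ?mem_enum ?setD11//.
  by rewrite !(inE, mem_enum); case: eqP => // ->.
have pbt : perm_eq (b :: t) (enum (K :\ a)) by exact: pe.
have pat : perm_eq (a :: t) (enum (K :\ b)).
  rewrite /t (_ : K :\ a :\ b = K :\ b :\ a); first exact: pe.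
  by apply/setP => v; rewrite !inE andbCA.
have pK : perm_eq s (enum K).
  rewrite /s (perm_trans _ (pe _ _ aK))// -[_ :: _ :: _]/([:: b] ++ [:: a] ++ t).
  rewrite perm_catCA/= perm_cons; exact: pbt.
have sz : size t = n by have := size_cell pK; rewrite /s/= => -[].
set dg := dirderiv _ g.
rewrite (cell_integral_param pK (bmeas_hull_peval dg)) (det_edges pK); congr (_ * _).
have cdg (y : 'rV[R]_n) : continuous (fun x : R => peval dg (param (pts s) (rcons0 x y))).
  rewrite /pts/=; under eq_fun do rewrite param_cons.
  exact: continuous_peval_line.
have dG (y : 'rV[R]_n) (x : R) : is_derive x 1 (fun x : R => peval g (param (pts s) (rcons0 x y)))
    (peval dg (param (pts s) (rcons0 x y))).
  rewrite /pts/=; under eq_fun do rewrite param_cons.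
  rewrite param_cons peval_dirderiv; exact: is_derive_peval.
rewrite (vol_rs_derive (bmeas_param_peval n.+1 _ g) (bmeas_param_peval n.+1 _ dg) cdg dG).
congr (_ - _).
  rewrite -(facet_mean_perm _ pat) ?sz//; last by rewrite /= sz.
  by apply: eq_vol => y _; rewrite /pts/= param_slanted.
rewrite -(facet_mean_perm _ pbt) ?sz//; last by rewrite /= sz.
by apply: eq_vol => y _; rewrite /pts/= param_cons scale0r addr0.
Qed.

End cell.

End simplex.

(** * Normals, areas and the divergence theorem on a simplex *)

Section divergence.
Variables (R : realType) (n : nat) (M : simplices R n.+1).
Local Notation V := (vertex M).
Local Notation p := (@vertex_pos R n.+1 M).
Local Notation rs n := (@ref_simplex R n.+1).
Implicit Types (K F S : {set V}) (x e nu : 'rV[R]_n.+1) (g : spoly R n.+1).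

Lemma dotpE (a b : 'rV[R]_n.+1) : dotp a b = (a *m b^T) 0 0.
Proof. by rewrite mxE; apply: eq_bigr => i _; rewrite mxE. Qed.

Lemma dotpDr (a b c : 'rV[R]_n.+1) : dotp a (b + c) = dotp a b + dotp a c.
Proof. by rewrite !dotpE linearD mulmxDr mxE. Qed.

Lemma dotpZr k (a b : 'rV[R]_n.+1) : dotp a (k *: b) = k * dotp a b.
Proof. by rewrite !dotpE linearZ -scalemxAr mxE. Qed.

Lemma dotpBr (a b c : 'rV[R]_n.+1) : dotp a (b - c) = dotp a b - dotp a c.
Proof. by rewrite -scaleN1r dotpDr dotpZr mulN1r. Qed.

Lemma dotpC (a b : 'rV[R]_n.+1) : dotp a b = dotp b a.
Proof. by apply: eq_bigr => i _; rewrite mulrC. Qed.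

Lemma dotpZl k (a b : 'rV[R]_n.+1) : dotp (k *: a) b = k * dotp a b.
Proof. by rewrite dotpC dotpZr dotpC. Qed.

Lemma dotpBl (a b c : 'rV[R]_n.+1) : dotp (a - b) c = dotp a c - dotp b c.
Proof. by rewrite dotpC dotpBr !(dotpC c). Qed.

Lemma dotpNl (a b : 'rV[R]_n.+1) : dotp (- a) b = - dotp a b.
Proof. by rewrite -scaleN1r dotpZl mulN1r. Qed.

Lemma dotp_sumr I (s : seq I) (P : pred I) (a : 'rV[R]_n.+1) (f : I -> 'rV[R]_n.+1) :
  dotp a (\sum_(i <- s | P i) f i) = \sum_(i <- s | P i) dotp a (f i).
Proof.
apply: (big_morph (dotp a)); first exact: dotpDr.
by have := dotpZr 0 a 0; rewrite scaler0 mul0r.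
Qed.

Lemma dotp_ge0 (a : 'rV[R]_n.+1) : 0 <= dotp a a.
Proof. by apply: sumr_ge0 => i _; rewrite -expr2 sqr_ge0. Qed.

Lemma dotp_eq0 (a : 'rV[R]_n.+1) : dotp a a = 0 -> a = 0.
Proof.
move=> /eqP; rewrite psumr_eq0 => [/allP h|i _]; last by rewrite -expr2 sqr_ge0.
apply/rowP => i; rewrite mxE; have := h i; rewrite mem_index_enum => /(_ isT) /=.
by rewrite mulf_eq0 orbb => /eqP.
Qed.

Definition area F : R := Num.sqrt (\det (facet_edges F *m (facet_edges F)^T)).

Lemma facet_integralE F f :
  facet_integral F f = area F * vol_integral (rs n) (f \o facet_param F).
Proof.
by rewrite /facet_integral /facet_integral_on /area preimage_setT setIT.
Qed.

Section facet.
Variables (K : {set V}) (w : V).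
Hypotheses (hK : is_dsimplex K) (wK : w \in K).
Local Notation F := (K :\ w).
Local Notation E := (facet_edges F).
Local Notation a0 := (facet_vertex F 0).

Let size_F : size (enum F) = n.+1.
Proof.
rewrite -cardE; have := cardsD1 w K; rewrite wK hK.1 add1n => -[].
by move=> <-.
Qed.

(** The edge matrix of [K] with the base vertex of [F] as origin and the apex [w] next, so that the
    edges of [F] form its lower block. *)
Definition apex_matrix : 'M[R]_n.+1 := col_mx (p w - a0 : 'M[R]_(1, n.+1)) E.

Lemma det_apex_matrix : apex_matrix \in unitmx /\ `|\det apex_matrix| = vol_ratio K.
Proof.
have pe : perm_eq (w :: enum F) (enum K).
  apply: uniq_perm => [||v]; rewrite /= ?enum_uniq ?mem_enum ?setD11//.
  by rewrite !(inE, mem_enum); case: eqP => // ->.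
move: size_F; case tE : (enum F) => [//|v0 t] [sz].
have pK : perm_eq [:: v0, w & t] (enum K).
  by rewrite (perm_trans _ pe)// tE -[_ :: _ :: _]/([:: v0] ++ [:: w] ++ t) perm_catCA.
suff <- : edges n.+1 (pts [:: v0, w & t]) = apex_matrix.
  by split; [exact: (edges_unit hK pK)|exact: (det_edges hK pK)].
apply/row_matrixP => i; rewrite rowK.
case: (unliftP ord0 i) => [j ->|->] /=.
  have -> : lift ord0 j = rshift 1 j by exact: val_inj.
  rewrite /apex_matrix (@rowKd R 1 n n.+1) rowK /facet_vertex tE/=.
  by [].
have -> : ord0 = lshift n (0 : 'I_1) by exact: val_inj.
rewrite /apex_matrix (@rowKu R 1 n n.+1) /facet_vertex tE/=.
by apply/rowP => k; rewrite !mxE.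
Qed.

Lemma facet_edge_dotp nu v : v \in F -> nu *m E^T = 0 -> dotp nu (p v - a0) = 0.
Proof.
move=> vF nE; have vt : v \in enum F by rewrite mem_enum.
have iv : (index v (enum F) < n.+1)%N by move: vt; rewrite -index_mem => h; apply: leq_trans h _; rewrite size_F.
rewrite (_ : p v = facet_vertex F (index v (enum F))); last first.
  by rewrite /facet_vertex (nth_map v) ?size_F// nth_index.
case: (index _ _) iv => [|i] iv; first by rewrite subrr -(scale0r 0) dotpZr mul0r.
pose j := Ordinal (iv : (i < n)%N).
have /rowP/(_ j) := nE; rewrite mxE [RHS]mxE => <-.
by apply: eq_bigr => k _; rewrite !mxE.
Qed.

Lemma outward_normal_edges nu : is_outward_normal K F nu -> nu *m E^T = 0.
Proof.
move=> [_ h _]; apply/rowP => j; rewrite mxE [RHS]mxE.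
have aF i : (i < n.+1)%N -> exists2 v, v \in F & facet_vertex F i = p v.
  move=> ilt; have [v0 _] : exists v, v \in enum F.
    by case: (enum F) size_F => // v0 t _; exists v0; rewrite inE eqxx.
  exists (nth v0 (enum F) i); first by rewrite -mem_enum mem_nth ?size_F.
  by rewrite /facet_vertex (nth_map v0) ?size_F.
have [v vF vE] := aF 0%N isT; have [u uF uE] := aF j.+1 (ltn_ord j).
transitivity (dotp nu (p u - p v)); last exact: h.
by rewrite -vE -uE; apply: eq_bigr => k _; rewrite !mxE.
Qed.

(** Inverting [apex_matrix] gives a [z] orthogonal to the edges of [F] and of product -1 with the
    edge to the apex; normalizing it gives the normal. Existence matters because [normal] is picked
    by [xget], with default 0. *)
Lemma exists_outward_normal : exists nu, is_outward_normal K F nu.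
Proof.
have [uX _] := det_apex_matrix.
pose z : 'rV[R]_n.+1 := (invmx apex_matrix *m - delta_mx 0 0)^T.
have Xz : apex_matrix *m z^T = - delta_mx 0 0 by rewrite trmxK mulKVmx.
have := Xz; rewrite /apex_matrix (@mul_col_mx R 1 n) => Xz'.
have zE : z *m E^T = 0.
  rewrite -[LHS]trmxK trmx_mul trmxK; apply/(canLR trmxK); rewrite trmx0.
  apply/colP => j; have /colP/(_ (rshift 1 j)) := Xz'.
  by rewrite (@col_mxEd R 1 n) => ->; rewrite !mxE -val_eqE /= oppr0.
have zw : dotp z (p w - a0) = -1.
  have /colP/(_ (lshift n (0 : 'I_1))) := Xz'.
  rewrite (@col_mxEu R 1 n) dotpC dotpE => ->; rewrite !mxE -val_eqE /=.
  by [].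
have z0 : 0 < dotp z z.
  rewrite lt_neqAle dotp_ge0 andbT eq_sym; apply/eqP => /dotp_eq0 z0.
  by move: zw; rewrite z0 dotpC -(scale0r 0) dotpZr mul0r => /eqP; rewrite eq_sym oppr_eq0 oner_eq0.
pose c := (Num.sqrt (dotp z z))^-1.
have c0 : 0 < c by rewrite invr_gt0 sqrtr_gt0.
have dc a : dotp (c *: z) a = c * dotp z a by rewrite dotpC dotpZr dotpC.
have zF v : v \in F -> dotp z (p v) = dotp z a0.
  by move=> vF; apply/eqP; rewrite -subr_eq0 -dotpBr facet_edge_dotp.
exists (c *: z); split.
- rewrite dc dotpZr mulrA -expr2 /c exprVn sqr_sqrtr ?(ltW z0)// mulVf ?gt_eqF//.
- by move=> v u vF uF; rewrite dc dotpBr !zF// subrr mulr0.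
- move=> v u vF; rewrite !inE negb_and negbK => /andP[/orP[/eqP ->|/negbTE->]//].
  move=> _; rewrite dc dotpBr (zF v)// -dotpBr zw mulrN1.
  by rewrite oppr_lt0.
Qed.

Lemma outward_normalP : is_outward_normal K F (normal K F).
Proof.
exact: (xgetPex 0 exists_outward_normal).
Qed.

(** Volume is height times area. Let [X] be [apex_matrix] and [Y] the same matrix with [nu] as first
    row. As [nu] is orthogonal to [E], the products of [X] and of [Y] with the transpose of [Y] are
    block triangular; their determinants are the height times the Gram determinant of [E], and the
    Gram determinant itself. *)
Lemma vol_ratio_area nu v : is_outward_normal K F nu -> v \in F ->
  vol_ratio K = - dotp nu (p w - p v) * area F.
Proof.
move=> hn vF; have nE := outward_normal_edges hn; have [nn _ hw] := hn.
have [uX dX] := det_apex_matrix.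
have dlt : dotp nu (p w - p v) < 0 by apply: hw => //; rewrite !inE eqxx wK.
have dE : dotp nu (p w - a0) = dotp nu (p w - p v).
  by have := facet_edge_dotp vF nE; rewrite !dotpBr => /eqP; rewrite subr_eq0 => /eqP ->.
pose Y : 'M[R]_n.+1 := col_mx (nu : 'M[R]_(1, n.+1)) E.
have EnT : E *m nu^T = 0 by rewrite -[LHS]trmxK trmx_mul trmxK nE trmx0.
have XY : \det apex_matrix * \det Y = dotp nu (p w - a0) * \det (E *m E^T).
  rewrite -[\det Y]det_tr -det_mulmx /Y /apex_matrix (@tr_col_mx R 1 n n.+1).
  rewrite (@mul_col_row R 1 n n.+1 1 n) EnT (@det_ublock R 1 n); congr (_ * _).
  by rewrite [X in \det X]mx11_scalar det_scalar1 dotpC dotpE.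
have YY : \det Y ^+ 2 = \det (E *m E^T).
  rewrite expr2 -{2}[\det Y]det_tr -det_mulmx /Y (@tr_col_mx R 1 n n.+1).
  rewrite (@mul_col_row R 1 n n.+1 1 n) EnT (@det_ublock R 1 n).
  by rewrite [X in \det X]mx11_scalar det_scalar1 -dotpE nn mul1r.
have areaE : area F = `|\det Y| by rewrite /area -YY sqrtr_sqr.
(* A singular Gram matrix would give a vanishing combination of the edges of [F], against the
   invertibility of [apex_matrix]. *)
have Y0 : \det Y != 0.
  apply/eqP => Y0; have /eqP/det0P[z z0 zE] : \det (E *m E^T) = 0 by rewrite -YY Y0 expr0n.
  have zE0 : z *m E = 0.
    by apply: dotp_eq0; rewrite dotpE trmx_mul mulmxA -(mulmxA z) zE mul0mx mxE.
  have : (row_mx (0 : 'M[R]_1) (z : 'rV[R]_n) : 'rV[R]_n.+1) *m apex_matrix = 0.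
    by rewrite /apex_matrix (@mul_row_col R 1 1 n) mul0mx zE0 addr0.
  move=> /(congr1 (mulmx^~ (invmx apex_matrix))); rewrite mulmxK// mul0mx.
  move=> /(congr1 (@rsubmx R 1 1 n)); rewrite (@row_mxKr R 1 1 n) raddf0 => z00.
  by rewrite z00 eqxx in z0.
rewrite -dX; have : \det apex_matrix = dotp nu (p w - p v) * \det Y.
  by apply: (mulIf Y0); rewrite XY dE -YY expr2 mulrA.
by move=> ->; rewrite normrM ltr0_norm// areaE.
Qed.

End facet.

Section divergence_theorem.
Variable K : {set V}.
Hypothesis hK : is_dsimplex K.

Lemma direction_weights e : exists c : V -> R,
  \sum_(v in K) c v = 0 /\ \sum_(v in K) c v *: p v = e.
Proof.
have pK : perm_eq (enum K) (enum K) by [].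
have uE := edges_unit hK pK.
have [c0 cp] := weight_edges hK (e *m invmx (edges n.+1 (pts (enum K)))) pK.
by eexists; split; [exact: c0|rewrite cp mulmxKV].
Qed.

(** All vertices but [v] lie in the facet opposite [v], at equal height, and the weights have total
    0; so only [v] contributes to the normal component of the direction. *)
Lemma normal_weight c v : \sum_(u in K) c u = 0 -> v \in K ->
  vol_ratio K * c v =
  - dotp (normal K (K :\ v)) (\sum_(u in K) c u *: p u) * area (K :\ v).
Proof.
move=> c0 vK; have hn := outward_normalP hK vK; have [_ h0 _] := hn.
have [b bF] : exists b, b \in K :\ v.
  apply/set0Pn; rewrite -card_gt0; have := cardsD1 v K.
  by rewrite vK hK.1 add1n => -[<-].
rewrite (vol_ratio_area hK vK hn bF) mulrAC mulNr; congr (- _ * _).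
rewrite dotp_sumr; under eq_bigr do rewrite dotpZr.
set nu := normal _ _ in h0 *.
transitivity (\sum_(u in K) c u * dotp nu (p u - p b)).
  rewrite (bigD1 v)//= big1 ?addr0 1?mulrC// => u /andP[uK uv].
  by rewrite h0 ?mulr0// !inE uv.
rewrite (eq_bigr (fun u => c u * dotp nu (p u) - c u * dotp nu (p b))) => [|u _]; last first.
  by rewrite dotpBr mulrBr.
by rewrite sumrB -mulr_suml c0 mul0r subr0.
Qed.

Lemma facets_of_sum (f : {set V} -> R) :
  \sum_(F in facets_of K) f F = \sum_(v in K) f (K :\ v).
Proof.
rewrite /facets_of big_imset//= => v w vK wK /setP/(_ v).
by rewrite !inE eqxx vK andbT /=; case: eqP.
Qed.

(* Both sides are linear in the direction of differentiation, so it is enough to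
   differentiate along an edge, which is parallel to all facets but two. *)
Lemma divergence_peval g j :
  cell_integral K (peval (mderiv j g)) =
  \sum_(F in facets_of K) facet_integral F (fun x => normal K F 0 j * peval g x).
Proof.
pose e : 'rV[R]_n.+1 := delta_mx 0 j.
have eE i : e 0 i = (i == j)%:R by rewrite mxE eqxx.
have [c [c0 ce]] := direction_weights e.
have [b bK] : exists b, b \in K.
  by apply/set0Pn; rewrite -card_gt0 hK.1.
have fv := finite_vol_hull hK.
rewrite facets_of_sum.
(* As the weights have total 0, [e] is the combination of the edges [p v - p b] with coefficients
   [c v]. *)
transitivity (\sum_(v in K | v != b) c v *
    cell_integral K (peval (dirderiv (p v - p b) g))).
  have nd v := bmeas_hull_peval K (dirderiv (p v - p b) g).
  transitivity (vol_integral (hull K)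
      (fun x => \sum_(v in K | v != b) c v * peval (dirderiv (p v - p b) g) x)).
    apply: eq_vol => x _; under eq_bigr do rewrite peval_dirderiv dotpC dotpBr mulrBr.
    have -> : peval (mderiv j g) x = dotp (grad g x) e.
      rewrite /dotp (bigD1 j)//= gradE eE eqxx mulr1 big1 ?addr0// => i ij.
      by rewrite eE (negbTE ij) mulr0.
    rewrite -ce dotp_sumr (bigD1 b)//= sumrB -mulr_suml.
    move: c0; rewrite (bigD1 b)//= => /eqP; rewrite addr_eq0 => /eqP ->.
    rewrite dotpZr mulNr addrC; congr (_ - _).
    by apply: eq_bigr => v _; rewrite dotpZr.
  rewrite vol_sum//; last by move=> v _; exact: bmeasZ.
  by apply: eq_bigr => v _; rewrite volZ.
(* The facet opposite [b] occurs in every edge term, with total coefficient the sum of the other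
   weights, which is [- c b]. *)
transitivity (- (\sum_(v in K) (vol_ratio K * c v) * facet_mean (K :\ v) g)).
  rewrite [in RHS](bigD1 b)//=.
  have -> : c b = - \sum_(v in K | v != b) c v.
    by move: c0; rewrite (bigD1 b)//= => /eqP; rewrite addr_eq0 => /eqP ->.
  rewrite mulrN mulNr mulr_sumr mulr_suml opprD opprK -sumrN -big_split/=.
  apply: eq_bigr => v /andP[vK vb].
  rewrite (cell_integral_edge hK g vK bK vb).
  move: (facet_mean (K :\ b) g) (facet_mean (K :\ v) g) (vol_ratio K) (c v).
  by move=> x y z t; ring.
rewrite -sumrN; apply: eq_bigr => v vK.
rewrite (normal_weight c0 vK) ce facet_integralE.
rewrite (_ : (_ \o _) = fun y => dotp (normal K (K :\ v)) e * peval g (facet_param (K :\ v) y)).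
  rewrite volZ; [|exact: finite_vol_rs|exact: bmeas_param_peval].
  rewrite -/(facet_mean _ g); move: (facet_mean _ _) (area _) (dotp _ _).
  by move=> x y z; ring.
apply/funext => y /=; congr (_ * _).
rewrite /dotp (bigD1 j)//= eE eqxx mulr1 big1 ?addr0// => i ij.
by rewrite eE (negbTE ij) mulr0.
Qed.

End divergence_theorem.

End divergence.

(** * Adjacent cells of a triangulation *)

Section geometry.
Variables (R : realType) (n : nat) (M : simplices R n.+1).
Local Notation V := (vertex M).
Local Notation p := (@vertex_pos R n.+1 M).
Implicit Types (K L F S : {set V}) (x e nu : 'rV[R]_n.+1).

Definition linpoly nu : spoly R n.+1 := \sum_i nu 0 i *: mpolyX R (mnm1 i).

Lemma peval_linpoly nu x : peval (linpoly nu) x = dotp nu x.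
Proof. by rewrite peval_sum; apply: eq_bigr => i _; rewrite pevalZ pevalX. Qed.

(* The inner distance to the hyperplane of the facet opposite to v. *)
Definition dist K v x : R :=
  dotp (normal K (K :\ v)) (facet_vertex (K :\ v) 0 - x).

Lemma continuous_dist K v : continuous (dist K v).
Proof.
pose nu := normal K (K :\ v).
rewrite (_ : dist K v = peval (mpolyC _ (dotp nu (facet_vertex (K :\ v) 0)) - linpoly nu)).
  exact: continuous_peval.
by apply/funext => x; rewrite pevalB pevalC peval_linpoly -dotpBr.
Qed.

Lemma near_dist K S x : (forall v, v \in S -> 0 < dist K v x) ->
  \forall y \near x, forall v, v \in S -> 0 < dist K v y.
Proof.
move=> h; apply: (@filter_forall _ _ _ (nbhs x)) => v.
have [vS|vS] := boolP (v \in S); last by apply: filterE.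
have /= hx := cvgr_gt _ (@continuous_dist K v x) _ (h v vS).
by apply: filterS (hx _) => y hy.
Qed.

Lemma dist_affine K v S (w : V -> R) : \sum_(u in S) w u = 1 ->
  dist K v (\sum_(u in S) w u *: p u) = \sum_(u in S) w u * dist K v (p u).
Proof.
move=> w1; rewrite /dist dotpBr dotp_sumr.
under [RHS]eq_bigr do rewrite dotpBr mulrBr.
rewrite sumrB -mulr_suml w1 mul1r; congr (_ - _).
by apply: eq_bigr => u _; rewrite dotpZr.
Qed.

Lemma dist_line K v x e (t : R) : dist K v (x + t *: (e - x)) =
  (1 - t) * dist K v x + t * dist K v e.
Proof. by rewrite /dist !(dotpBr, dotpDr, dotpZr); ring. Qed.

Section cell.
Variable K : {set V}.
Hypothesis hK : is_dsimplex K.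

Lemma facet_vertexP v : v \in K -> exists2 b, b \in K :\ v & facet_vertex (K :\ v) 0 = p b.
Proof.
move=> vK; rewrite /facet_vertex; have := cardsD1 v K.
rewrite vK hK.1 add1n => -[]; rewrite cardE; case E : (enum _) => [//|b t] _.
by exists b => //; rewrite -mem_enum E inE eqxx.
Qed.

Lemma dist_facet v u : v \in K -> u \in K :\ v -> dist K v (p u) = 0.
Proof.
move=> vK uF; rewrite /dist; have [b bF ->] := facet_vertexP vK.
by have [_ h _] := outward_normalP hK vK; rewrite h.
Qed.

Lemma dist_apex v : v \in K -> 0 < dist K v (p v).
Proof.
move=> vK; rewrite /dist; have [b bF ->] := facet_vertexP vK.
have [_ _ /(_ b v bF)] := outward_normalP hK vK; rewrite !inE eqxx vK => /(_ isT).
by rewrite !dotpBr; lra.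
Qed.

(** [dist K v] is affine, zero at the vertices other than [v] and positive at [v], so it is a
    positive multiple of the barycentric coordinate at [v]. *)
Lemma hull_dist x : hull K x <-> forall v, v \in K -> 0 <= dist K v x.
Proof.
split=> [[w [w0 w1 ->]] v vK|h].
  rewrite dist_affine//; apply: sumr_ge0 => u uK; rewrite mulr_ge0 ?w0//.
  have [->|uv] := eqVneq u v; first exact/ltW/dist_apex.
  by rewrite dist_facet// !inE uv.
have [b bK] : exists b, b \in K by apply/set0Pn; rewrite -card_gt0 hK.1.
have [c [c0 cx]] := direction_weights hK (x - p b).
pose w u := c u + (u == b)%:R.
have w1 : \sum_(u in K) w u = 1.
  rewrite big_split/= c0 add0r (bigD1 b)//= eqxx big1 ?addr0// => u /andP[_ /negbTE ->].
  by [].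
have xE : x = \sum_(u in K) w u *: p u.
  under eq_bigr do rewrite scalerDl.
  rewrite big_split/= cx (bigD1 b)//= eqxx scale1r big1 ?addr0 ?subrK// => u /andP[_ /negbTE ->].
  by rewrite scale0r.
exists w; split => // v vK.
have := h v vK; rewrite xE dist_affine// (bigD1 v)//= big1 ?addr0 => [|u /andP[uK uv]].
  by rewrite pmulr_lge0// dist_apex.
by rewrite dist_facet ?mulr0// !inE uv.
Qed.

Lemma closed_hull : closed (hull K).
Proof.
rewrite (_ : hull K = \bigcap_(v in [set` K]) [set x | 0 <= dist K v x]).
  apply: closed_bigI => v _; apply: (@closed_comp _ _ (dist K v) [set y | 0 <= y]); last exact: closed_ge.
  by move=> x _; exact: continuous_dist.
by apply/seteqP; split => x; [move/hull_dist|move=> h; apply/hull_dist].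
Qed.

Lemma interior_hull x : (forall v, v \in K -> 0 < dist K v x) -> interior (hull K) x.
Proof.
move=> /(near_dist (S := K)); apply: filterS => y hy; apply/hull_dist => v vK.
exact/ltW/hy.
Qed.

End cell.

Definition barycenter F : 'rV[R]_n.+1 := \sum_(u in F) #|F|%:R^-1 *: p u.

Lemma sum_barycenter F : (0 < #|F|)%N -> \sum_(u in F) (#|F|%:R^-1 : R) = 1.
Proof. by move=> F0; rewrite sumr_const -[LHS]mulr_natr mulVf// pnatr_eq0 -lt0n. Qed.

Lemma hull_barycenter F : (0 < #|F|)%N -> hull F (barycenter F).
Proof.
move=> F0; exists (fun=> #|F|%:R^-1); split => //; exact: sum_barycenter.
Qed.

Lemma card_facet K w : is_dsimplex K -> w \in K -> (0 < #|K :\ w|)%N.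
Proof. by move=> hK wK; have := cardsD1 w K; rewrite wK hK.1 add1n => -[<-]. Qed.

Lemma dist_barycenter_facet K w : is_dsimplex K -> w \in K ->
  dist K w (barycenter (K :\ w)) = 0.
Proof.
move=> hK wK; rewrite dist_affine ?sum_barycenter ?card_facet// big1// => u uF.
by rewrite dist_facet ?mulr0.
Qed.

Lemma dist_barycenter K w v : is_dsimplex K -> w \in K -> v \in K :\ w ->
  0 < dist K v (barycenter (K :\ w)).
Proof.
move=> hK wK vF; have F0 := card_facet hK wK.
have vK : v \in K by move: vF; rewrite !inE => /andP[].
rewrite dist_affine ?sum_barycenter// (bigD1 v)//= big1 ?addr0.
  by rewrite mulr_gt0 ?dist_apex// invr_gt0 ltr0n.
move=> u /andP[+ uv]; rewrite !inE => /andP[_ uK].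
by rewrite dist_facet ?mulr0// !inE uv.
Qed.

Section adjacent.
Variables (K L F : {set V}) (w w' : V).
Hypotheses (hK : is_dsimplex K) (hL : is_dsimplex L) (wK : w \in K) (wL : w' \in L).
Hypotheses (FK : F = K :\ w) (FL : F = L :\ w').

(** A vector orthogonal to the edges of [F] is determined by its product with the edge to the apex
    [w], because [apex_matrix] is invertible. The normals are thus proportional, and both have
    length 1. *)
Lemma normal_collinear : normal L F = normal K F \/ normal L F = - normal K F.
Proof.
have hn := outward_normalP hK wK; have hn' := outward_normalP hL wL; rewrite -FK in hn; rewrite -FL in hn'.
have E1 := outward_normal_edges hK wK; rewrite -FK in E1; have {}E1 := E1 _ hn.
have E2 := outward_normal_edges hL wL; rewrite -FL in E2; have {}E2 := E2 _ hn'.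
set nu := normal K F in hn E1 *; set nu' := normal L F in hn' E2 *.
have [uX _] := det_apex_matrix hK wK.
have dw : dotp nu (p w - facet_vertex F 0) < 0.
  have [b bF bE] := facet_vertexP hK wK; rewrite -FK in bF bE; rewrite bE.
  by have [_ _ h] := hn; apply: h => //; rewrite FK !inE eqxx wK.
pose t := dotp nu' (p w - facet_vertex F 0) / dotp nu (p w - facet_vertex F 0).
have nE : nu' = t *: nu.
  apply/eqP; rewrite -subr_eq0; apply/eqP.
  have : apex_matrix K w *m (nu' - t *: nu)^T = 0.
    rewrite /apex_matrix -FK (@mul_col_mx R 1 n) -[RHS](@col_mx0 R 1 n); congr (@col_mx R 1 n _ _ _).
      apply/matrixP => i j; rewrite !ord1 -dotpE mxE dotpC.
      have -> : dotp (nu' - t *: nu) (p w - facet_vertex F 0) =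
          dotp nu' (p w - facet_vertex F 0) - t * dotp nu (p w - facet_vertex F 0).
        by rewrite dotpBl dotpZl.
      by rewrite /t mulfVK ?subrr// lt_eqF.
    by rewrite -[LHS]trmxK trmx_mul !trmxK mulmxBl -scalemxAl E1 E2 scaler0 subr0 trmx0.
  move=> /(congr1 (mulmx (invmx (apex_matrix K w)))); rewrite mulKmx// mulmx0.
  by move=> /(congr1 trmx); rewrite trmxK trmx0.
have : t ^+ 2 = 1.
  have [n1 _ _] := hn; have [n1' _ _] := hn'; move: n1'.
  by rewrite nE dotpZr dotpC dotpZr n1 mulr1 expr2.
move=> /eqP; rewrite sqrf_eq1 => /orP[]/eqP t1; rewrite nE t1; first by left; rewrite scale1r.
by right; rewrite scaleN1r.
Qed.

Hypothesis KL : K != L.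

Hypothesis disj : interior (hull K) `&` interior (hull L) = set0.

(** With equal normals both cells would lie on the same side of [F], and points slightly off its
    barycenter towards [w] would be interior to both. *)
Lemma normal_opposite : normal L F = - normal K F.
Proof.
have [nE|//] := normal_collinear; exfalso.
have dE x : dist L w' x = dist K w x by rewrite /dist -FL -FK nE.
pose c := barycenter F.
pose x (t : R) := c + t *: (p w - c).
have h : \forall t \near (0 : R)^'+, interior (hull K) (x t) /\ interior (hull L) (x t).
  have hF G : is_dsimplex G -> (exists2 g, g \in G & F = G :\ g) ->
     \forall t \near (0 : R)^'+, forall v, v \in F -> 0 < dist G v (x t).
    move=> hG [g gG FG]; apply: filter_forall => v.
    have [vF|vF] := boolP (v \in F); last by apply: nearW.
    have a0 : 0 < dist G v c by rewrite /c FG; apply: dist_barycenter => //; rewrite -FG.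
    set a := dist G v c in a0; pose b := `|dist G v (p w)|.
    have b0 : 0 <= b by exact: normr_ge0.
    near=> t => _; rewrite dist_line -/a.
    have t0 : 0 < t by near: t; exact: nbhs_right_gt.
    (* Below this bound [(1 - t) * a - t * b] stays positive, and it bounds the distance at [x t]
       from below. *)
    have : t < a / (a + b + 1).
      near: t; apply: nbhs_right_lt; rewrite divr_gt0//; lra.
    rewrite ltr_pdivlMr; last lra.
    have : - b <= dist G v (p w).
      by rewrite /b; have := ler_norm (- dist G v (p w)); rewrite normrN; lra.
    set z := dist _ _ _; nra.
  near=> t.
  have t0 : 0 < t by near: t; exact: nbhs_right_gt.
  have dw : 0 < dist K w (x t).
    rewrite /x dist_line /c FK dist_barycenter_facet// mulr0 add0r mulr_gt0//.
    exact: dist_apex.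
  have xK : forall v, v \in F -> 0 < dist K v (x t).
    by near: t; apply: hF => //; exists w.
  have xL : forall v, v \in F -> 0 < dist L v (x t).
    by near: t; apply: hF => //; exists w'.
  split; apply: interior_hull => // v vK.
    by have [->//|vw] := eqVneq v w; apply: xK; rewrite FK !inE vw.
  have [->|vw] := eqVneq v w'; first by rewrite dE.
  by apply: xL; rewrite FL !inE vw.
have [t [tK tL]] := @filter_ex _ _ (at_right_proper_filter 0) _ h.
have : (interior (hull K) `&` interior (hull L)) (x t) by [].
by rewrite disj.
Unshelve. all: by end_near.
Qed.

(** Near the barycenter, the distances to the facets other than [F] are positive for both cells. The
    remaining ones, [dist K w] and [dist L w'], are opposite, so one of them is nonnegative. *)
Lemma barycenter_interior : interior (hull K `|` hull L) (barycenter F).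
Proof.
have nE := normal_opposite.
have dE x : dist L w' x = - dist K w x.
  by rewrite /dist -FL -FK nE dotpNl.
rewrite /interior.
have hF G : is_dsimplex G -> (exists2 g, g \in G & F = G :\ g) ->
   \forall y \near barycenter F, forall v, v \in F -> 0 < dist G v y.
  move=> hG [g gG FG]; apply: near_dist => v vF; rewrite FG.
  by apply: dist_barycenter => //; rewrite -FG.
near=> y.
have yK : forall v, v \in F -> 0 < dist K v y by near: y; apply: hF => //; exists w.
have yL : forall v, v \in F -> 0 < dist L v y by near: y; apply: hF => //; exists w'.
have [d0|d0] := leP 0 (dist K w y).
  left; apply/hull_dist => // v vK; have [->//|vw] := eqVneq v w.
  by apply/ltW/yK; rewrite FK !inE vw.
right; apply/hull_dist => // v vL; have [->//|vw] := eqVneq v w'.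
  by rewrite dE oppr_ge0 ltW.
by apply/ltW/yL; rewrite FL !inE vw.
Unshelve. all: by end_near.
Qed.

End adjacent.

End geometry.

(** * Normals of interior and boundary facets in the mesh *)

Section mesh.
Variables (R : realType) (n : nat) (M : simplices R n.+1).
Local Notation V := (vertex M).
Implicit Types (K L F S : {set V}).
Variable Omega : set 'rV[R]_n.+1.
Hypotheses (hOmega : polyhedral_domain Omega) (hM : triangulation M Omega).

Lemma facets_ofP K F : reflect (exists2 w, w \in K & F = K :\ w) (F \in facets_of K).
Proof. exact: imsetP. Qed.

Lemma closed_covered (M' : simplices R n.+1) : simplicial_family M' -> closed (covered M').
Proof. move=> hM'; apply: closed_bigcup; first exact: finite_finset.
by move=> K /= cK; apply: closed_hull; exact: hM'. Qed.

(** The closure of [Omega] stays in the closed union of simplices of which [Omega] is the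
    interior. *)
Lemma interior_closure_domain : interior (closure Omega) `<=` Omega.
Proof.
have [_ _ _ [M0 hM0 E]] := hOmega; rewrite {2}E; apply: interiorS.
by rewrite E closureE => x; apply; split; [exact: closed_covered|exact: interior_subset].
Qed.

Lemma cell_simplex K : K \in cells M -> is_dsimplex K.
Proof. by have [_ h _ _ _] := hM; exact: h. Qed.

Lemma adjacent_normal K L F : K \in cells M -> L \in cells M -> K != L ->
  F \in facets_of K -> F \in facets_of L -> normal L F = - normal K F.
Proof.
move=> cK cL KL /facets_ofP[w wK FK] /facets_ofP[w' wL FL].
have [_ _ _ dj _] := hM.
exact: (normal_opposite (cell_simplex cK) (cell_simplex cL) wK wL FK FL (dj _ _ cK cL KL)).
Qed.

(** Between two distinct cells, the barycenter of [F] would be interior to the closure of [Omega],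
    hence a point of [Omega], and not of its frontier. *)
Lemma boundary_facet_unique K L F : K \in cells M -> L \in cells M ->
  F \in facets_of K -> F \in facets_of L -> hull F `<=` frontier Omega -> K = L.
Proof.
move=> cK cL FK FL Fb; apply/eqP/negPn/negP => KL.
have [w wK FKE] := facets_ofP _ _ FK; have [w' wL FLE] := facets_ofP _ _ FL.
have [_ _ cov dj _] := hM.
have := barycenter_interior (cell_simplex cK) (cell_simplex cL) wK wL FKE FLE (dj _ _ cK cL KL).
have oO : open Omega by case: hOmega.
move=> /(@interiorS _ _ (closure Omega)) h.
have : hull F (barycenter F).
  by apply: hull_barycenter; rewrite FKE; apply: card_facet => //; exact: cell_simplex.
move=> /Fb[_]; apply; rewrite (interior_id Omega).1//.
apply: interior_closure_domain; apply: h => x; rewrite cov => -[hx|hx].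
  by exists K.
by exists L.
Qed.

Lemma unit_normal K F : K \in cells M -> F \in facets_of K ->
  dotp (normal K F) (normal K F) = 1.
Proof.
move=> cK /facets_ofP[w wK ->].
by have [] := outward_normalP (cell_simplex cK) wK.
Qed.

(** Conformity provides a second cell, with the opposite normal. A third cell is impossible: its
    normal would be opposite to two opposite unit vectors. *)
Lemma interior_facet_normals F : F \in facets M -> ~ hull F `<=` frontier Omega ->
  \sum_(K in cells M | F \in facets_of K) normal K F = 0.
Proof.
move=> /bigcupP[K cK FK] Fi; have [_ _ _ _ conf] := hM.
have [//|[L cL [LK FL]]] := conf K F cK FK.
have KL : K != L by rewrite eq_sym.
rewrite (bigD1 K) ?cK//= (bigD1 L) /= ?cL ?FL//=.
rewrite big1 ?addr0 => [|N /andP[/andP[/andP[cN FN] NK] NL]].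
  by rewrite (adjacent_normal cK cL KL FK FL) subrr.
exfalso; have h1 := adjacent_normal cK cN _ FK FN; have h2 := adjacent_normal cL cN _ FL FN.
have := unit_normal cN FN.
have nN : normal N F = - normal K F by apply: h1; rewrite eq_sym.
have : normal N F = - normal N F.
  by rewrite {1}h2 1?eq_sym// (adjacent_normal cK cL KL FK FL) opprK nN opprK.
move=> /eqP; rewrite -subr_eq0 opprK -mulr2n -scaler_nat scaler_eq0 pnatr_eq0/= => /eqP ->.
by rewrite -(scale0r 0) dotpZl mul0r => /eqP; rewrite eq_sym oner_eq0.
Qed.

End mesh.

(** * The discrete trace inequality *)

Section poly_space.
Variables (R : realType) (d k : nat).
Implicit Types (q : spoly R d).
Local Notation I := (bmultinom d k.+1).
Local Notation N := #|{: I}|.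

Definition mono (i : 'I_N) : spoly R d := mpolyX R (bmnm (enum_val i)).

(** Coordinates in the monomial basis: polynomials of degree at most [k] become points of a
    finite-dimensional normed space, where compactness and limits are available. *)
Definition pol (c : 'rV[R]_N) : spoly R d := \sum_i c 0 i *: mono i.

Definition cvec q : 'rV[R]_N := \row_i mcoeff (bmnm (enum_val i)) q.

Lemma cvecK q : has_deg k q -> pol (cvec q) = q.
Proof.
move=> hq; rewrite [RHS](mpolywE hq) /pol (reindex enum_rank) /=; last first.
  by apply: onW_bij; exact: enum_rank_bij.
by apply: eq_bigr => m _; rewrite mxE /mono enum_rankK.
Qed.

Lemma polK c : cvec (pol c) = c.
Proof.
apply/rowP => j; rewrite mxE /pol raddf_sum (bigD1 j)//= mcoeffZ mcoeffX eqxx mulr1.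
rewrite big1 ?addr0// => i ij; rewrite mcoeffZ mcoeffX.
case: eqP => [/val_inj/enum_val_inj E|_]; last by rewrite mulr0.
by rewrite E eqxx in ij.
Qed.

Lemma has_deg_pol c : has_deg k (pol c).
Proof.
apply: has_deg_sum => i _; apply: has_degZ; rewrite /has_deg /mono msizeX.
by have := bmdeg (enum_val i).
Qed.

Section functional.
Variable Lam : spoly R d -> R.
Hypotheses (LD : forall p q, Lam (p + q) = Lam p + Lam q)
  (LZ : forall a p, Lam (a *: p) = a * Lam p).

Lemma functional_sum J (s : seq J) (P : pred J) (f : J -> spoly R d) :
  Lam (\sum_(j <- s | P j) f j) = \sum_(j <- s | P j) Lam (f j).
Proof.
apply: (big_morph Lam LD).
by rewrite -(scale0r 0) LZ mul0r.
Qed.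

(** The quadratic form sending [c] to [Lam (pol c * pol c)], as a polynomial in the coefficients so
    that its continuity is immediate. *)
Definition quadratic : spoly R N :=
  \sum_i \sum_j Lam (mono i * mono j) *: (mpolyX R (mnm1 i) * mpolyX R (mnm1 j)).

Lemma functional_pol c q : Lam (pol c * q) = \sum_i c 0 i * Lam (mono i * q).
Proof.
rewrite /pol mulr_suml functional_sum; apply: eq_bigr => i _.
by rewrite -scalerAl LZ.
Qed.

Lemma quadraticE c : peval quadratic c = Lam (pol c * pol c).
Proof.
rewrite functional_pol peval_sum; apply: eq_bigr => i _.
have -> : Lam (mono i * pol c) = \sum_j c 0 j * Lam (mono j * mono i).
  by rewrite [mono i * _]mulrC functional_pol.
rewrite mulr_sumr peval_sum; apply: eq_bigr => j _.
by rewrite pevalZ pevalM !pevalX [mono j * _]mulrC; ring.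
Qed.

End functional.

End poly_space.

Section quadratic_domination.
Variable R : realType.

(* C is the maximum of B / A over the unit sphere. *)
Lemma quadratic_dominated N (A B : 'rV[R]_N -> R) :
  continuous A -> continuous B ->
  (forall a x, A (a *: x) = a ^+ 2 * A x) -> (forall a x, B (a *: x) = a ^+ 2 * B x) ->
  (forall x, x != 0 -> 0 < A x) ->
  exists2 C : R, 0 <= C & forall x, B x <= C * A x.
Proof.
move=> cA cB hA hB pA.
have A0 : A 0 = 0 by rewrite -(scale0r 0) hA expr0n mul0r.
have B0 : B 0 = 0 by rewrite -(scale0r 0) hB expr0n mul0r.
have [[x0 x00]|all0] := pselect (exists x : 'rV[R]_N, x != 0); last first.
  exists 0 => // x; have [->|x0] := eqVneq x 0; first by rewrite A0 B0 mul0r.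
  by exfalso; apply: all0; exists x.
pose S : set 'rV[R]_N := [set x | `|x| = 1].
have Sx x : x != 0 -> S (`|x|^-1 *: x).
  by move=> xn0; rewrite /S/= normrZ normfV normr_id mulVf// normr_eq0.
have cS : compact S.
  apply: bounded_closed_compact.
    by exists 1; split; [exact: num_real|move=> y y1 x /= ->; exact: ltW].
  rewrite (_ : S = (fun x : 'rV[R]_N => `|x|) @^-1` [set 1])//.
  apply: closed_comp => [x _|]; first exact: norm_continuous.
  exact: closed_eq.
have S0 : S !=set0 by exists (`|x0|^-1 *: x0); exact: Sx.
have [xm xmS hm] := EVT_min_rV S0 cS (continuous_subspaceT cA).
have [xM xMS hM] := EVT_max_rV S0 cS (continuous_subspaceT cB).
have m0 : 0 < A xm.
  apply: pA; apply/eqP => x00'; move: xmS; rewrite x00' inE /S/= normr0 => /esym/eqP.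
  by rewrite oner_eq0.
exists (`|B xM| / A xm) => [|x]; first by rewrite divr_ge0// ltW.
have [->|xn0] := eqVneq x 0; first by rewrite A0 B0 mulr0.
have nx : 0 < `|x| by rewrite normr_gt0.
have sx := Sx x xn0.
have := hm _ (mem_set sx); have := hM _ (mem_set sx).
rewrite hA hB exprVn => h1 h2.
have nx2 : 0 < `|x| ^+ 2 by rewrite exprn_gt0.
have h3 : B x <= `|x| ^+ 2 * `|B xM|.
  by rewrite -ler_pdivrMl// (le_trans h1)// ler_norm.
have h4 : `|x| ^+ 2 * A xm <= A x by rewrite -ler_pdivlMl.
apply: (le_trans h3); rewrite [leRHS]mulrAC ler_pdivlMr// [leLHS]mulrAC [leLHS]mulrC.
by rewrite ler_wpM2l.
Qed.

End quadratic_domination.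

Section positivity.
Variables (R : realType) (n : nat).
Implicit Types (q : spoly R n.+1) (x : 'rV[R]_n.+1).

Lemma peval_eq0_mderiv (U : set 'rV[R]_n.+1) q j : open U ->
  (forall x, U x -> peval q x = 0) -> forall x, U x -> peval (mderiv j q) x = 0.
Proof.
move=> oU q0 x Ux.
pose e : 'rV[R]_n.+1 := delta_mx 0 j.
have h := is_derive_peval q x e 0.
have -> : peval (mderiv j q) x = dotp e (grad q (x + (0 : R) *: e)).
  rewrite scale0r addr0 /dotp (bigD1 j)//= gradE mxE !eqxx mul1r big1 ?addr0// => i ij.
  by rewrite mxE (negbTE ij) andbF mul0r.
have <- := @derive_val _ _ _ _ _ _ _ h.
have /nbhs_ballP[r /= r0 rU] : nbhs x U by exact: open_nbhs_nbhs.
have near0 : \forall t \near (0 : R), peval q (x + t *: e) = cst 0 t.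
  near=> t; apply: q0; apply: rU; split => // i l.
  rewrite /ball/= !mxE opprD addrA subrr sub0r normrN.
  have tr : `|t| < r.
    by near: t; apply/nbhs_ballP; exists r => //= s; rewrite /ball/= sub0r normrN.
  by case: (_ && _); rewrite ?mulr1// mulr0 normr0.
by rewrite (near_eq_derive _ near0) derive_cst.
Unshelve. all: by end_near.
Qed.

(** Induction on the degree: the partial derivatives vanish on [U], hence identically, so [q] is a
    constant, and its value is 0. *)
Lemma poly_open_eq0 (U : set 'rV[R]_n.+1) k q : open U -> U !=set0 -> has_deg k q ->
  (forall x, U x -> peval q x = 0) -> q = 0.
Proof.
move=> oU U0; elim: k q => [|k IH] q hq q0.
  have [x Ux] := U0; have := q0 x Ux; move: hq; rewrite /has_deg => hq.
  have [z|p0] := posnP (msize q); first by move/eqP : z; rewrite msize_poly_eq0 => /eqP.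
  have : msize q == 1%N by rewrite eqn_leq hq.
  by move=> /msize_poly1P[c _ ->]; rewrite pevalC => ->; rewrite mpolyC0.
have d0 j : mderiv j q = 0.
  by apply: IH; [exact: (has_deg_mderiv _ hq)|exact: peval_eq0_mderiv].
have qc : q = mpolyC n.+1 (mcoeff mnm0 q).
  apply/mpolyP => m; rewrite mcoeffC; have [->|m0] := eqVneq m mnm0.
    by rewrite mulr1.
  rewrite mulr0.
  have [i mi] : exists i, m i != 0%N.
    apply/existsP; apply: contraNT m0 => /existsPn h; apply/eqP/mnmP => i.
    by rewrite mnm0E; apply/eqP/negPn/h.
  have := congr1 (mcoeff (mnm_sub m (mnm1 i))) (d0 i).
  rewrite mcoeff_mderiv mcoeff0 submK; last first.
    by apply/mnm_lepP => l; rewrite mnm1E; case: eqP => // <-; rewrite lt0n.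
  by move=> /eqP; rewrite mulrn_eq0 /= => /eqP.
have [x Ux] := U0; have := q0 x Ux; rewrite qc pevalC => ->.
by rewrite mpolyC0.
Qed.

(** If [q] were nonzero at an interior point, its square would exceed half its value there on a
    whole cube. *)
Lemma vol_sqr_eq0 (D : set 'rV[R]_n.+1) k q : finite_vol D -> bounded_box D ->
  interior D !=set0 -> has_deg k q ->
  vol_integral D (fun x => peval q x ^+ 2) = 0 -> q = 0.
Proof.
move=> fD bD D0 hq int0; apply: (poly_open_eq0 (@open_interior _ D) D0 hq) => x Dx.
apply/eqP/negPn/negP => qx0; move/eqP: int0; apply/negP; rewrite gt_eqF//.
pose a := peval (q * q) x / 2.
have h : a < peval (q * q) x.
  by rewrite /a ltr_pdivrMr// ltr_pMr ?ltr1n// pevalM -expr2 exprn_even_gt0.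
have a0 : 0 < a by rewrite divr_gt0// pevalM -expr2 exprn_even_gt0.
have : \forall y \near x, D y /\ a < peval (q * q) y.
  apply: filterI; first exact: Dx.
  exact: (cvgr_gt _ (@continuous_peval _ _ (q * q) x) _ h).
move=> /nbhs_ballP[e /= e0 eB].
have eC : cube x (e / 2) `<=` ball x e.
  move=> y cy; split => // i j; rewrite ord1 /ball/= distrC.
  by rewrite (le_lt_trans (cy j))// ltr_pdivrMr// ltr_pMr// ltr1n.
apply: (@vol_gt0 _ _ _ _ x (e / 2) a) => //.
- by apply: bmeasX; exact: bmeas_peval.
- by rewrite divr_gt0.
- by move=> y /eC/eB[].
- by move=> y _; exact: sqr_ge0.
- by move=> y /eC/eB[_]; rewrite pevalM -expr2 => /ltW.
Qed.

End positivity.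

Section trace.
Variables (R : realType) (n : nat) (M : simplices R n.+1).
Local Notation V := (vertex M).
Implicit Types (K F : {set V}) (q : spoly R n.+1).

Lemma interior_cell K : is_dsimplex K -> interior (hull K) !=set0.
Proof.
move=> hK; have K0 : (0 < #|K|)%N by rewrite hK.1.
exists (barycenter K); apply: interior_hull => // v vK.
rewrite dist_affine ?sum_barycenter// (bigD1 v)//= big1 ?addr0.
  by rewrite mulr_gt0 ?dist_apex// invr_gt0 ltr0n.
by move=> u /andP[uK uv]; rewrite dist_facet ?mulr0// !inE uv.
Qed.

Definition cellI K q : R := cell_integral K (peval q).

Definition facetI F q : R := facet_integral F (peval q).

Lemma cellID K p q : is_dsimplex K -> cellI K (p + q) = cellI K p + cellI K q.
Proof.
move=> hK; rewrite /cellI /cell_integral (funext (pevalD p q)) volD//.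
- exact: finite_vol_hull.
- exact: bmeas_hull_peval.
- exact: bmeas_hull_peval.
Qed.

Lemma cellIZ K a q : is_dsimplex K -> cellI K (a *: q) = a * cellI K q.
Proof.
move=> hK; rewrite /cellI /cell_integral (funext (pevalZ a q)) volZ//.
- exact: finite_vol_hull.
- exact: bmeas_hull_peval.
Qed.

Lemma facetID F p q : facetI F (p + q) = facetI F p + facetI F q.
Proof.
rewrite /facetI !facet_integralE (funext (pevalD p q)) -mulrDr -volD//.
- exact: finite_vol_rs.
- exact: bmeas_param_peval.
- exact: bmeas_param_peval.
Qed.

Lemma facetIZ F a q : facetI F (a *: q) = a * facetI F q.
Proof.
rewrite /facetI !facet_integralE (funext (pevalZ a q)) mulrCA; congr (_ * _).
by apply: volZ; [exact: finite_vol_rs|exact: bmeas_param_peval].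
Qed.

(** Both integrals are quadratic forms in the coefficients of [q], and the one over the cell is
    positive definite. The constant depends on the cell and the facet, which is enough on a fixed
    finite mesh. *)
Lemma trace_inequality K F k : is_dsimplex K ->
  exists2 C : R, 0 <= C & forall q, has_deg k q ->
    facet_integral F (fun x => peval q x ^+ 2) <=
    C * cell_integral K (fun x => peval q x ^+ 2).
Proof.
move=> hK; have cD p q := cellID p q hK; have cZ a q := cellIZ a q hK.
have sqE q : (fun x => peval q x ^+ 2) = peval (q * q).
  by apply/funext => x; rewrite pevalM expr2.
pose A := peval (quadratic k (cellI K)); pose B := peval (quadratic k (facetI F)).
have AE c : A c = cellI K (pol c * pol c) by exact: quadraticE.
have BE c : B c = facetI F (pol c * pol c).
  by apply: quadraticE; [exact: facetID|exact: facetIZ].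
have polZ a c : pol (a *: c) = a *: pol c :> spoly R n.+1.
  by rewrite /pol scaler_sumr; apply: eq_bigr => i _; rewrite mxE scalerA.
have [C C0 hC] : exists2 C : R, 0 <= C & forall x, B x <= C * A x.
  apply: quadratic_dominated.
  - exact: continuous_peval.
  - exact: continuous_peval.
  - by move=> a c; rewrite !AE polZ -scalerAl -scalerAr !cZ expr2 mulrA.
  - by move=> a c; rewrite !BE polZ -scalerAl -scalerAr !facetIZ expr2 mulrA.
  - move=> c c0; rewrite AE lt_neqAle; apply/andP; split; last first.
      by apply: vol_ge0 => x _; rewrite pevalM -expr2 sqr_ge0.
    apply: contra_neq c0 => /esym i0; rewrite -(polK c).
    have -> : pol c = 0; last by apply/rowP => i; rewrite !mxE mcoeff0.
    apply: (vol_sqr_eq0 (finite_vol_hull hK) (bounded_hull K) (interior_cell hK) (has_deg_pol c)).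
    by rewrite sqE.
exists C => // q hq; rewrite !sqE.
by have := hC (cvec k q); rewrite AE BE (cvecK hq).
Qed.

End trace.

(** * The time derivative of the kinetic energy *)

Section unisolvence.
Variables (R : realType) (n k : nat) (M : simplices R n.+1) (K : {set vertex M}).
Hypothesis hK : is_dsimplex K.
Local Notation N := #|{: bmultinom n.+1 k.+1}|.

Definition eval_mx r (x : 'I_r -> 'rV[R]_n.+1) : 'M[R]_(r, N) :=
  \matrix_(i, j) peval (mono R j) (x i).

Lemma eval_mxE r (x : 'I_r -> 'rV[R]_n.+1) (c : 'rV[R]_N) i :
  (eval_mx x *m c^T) i 0 = peval (pol c) (x i).
Proof.
rewrite mxE peval_sum; apply: eq_bigr => j _.
by rewrite !mxE pevalZ mulrC.
Qed.

(** Fewer than [N] points leave a nonzero polynomial that vanishes at all of them. It does not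
    vanish on the whole cell, and a point where it is nonzero can be added. *)
Lemma exists_independent_points r : (r <= N)%N ->
  exists x : 'I_r -> 'rV[R]_n.+1, (forall i, hull K (x i)) /\ row_free (eval_mx x).
Proof.
elim: r => [_|r IH rN].
  exists (fun=> 0); split; first by case.
  by rewrite -row_leq_rank.
have [x [xK xf]] := IH (ltnW rN).
have [c c0 xc] : exists2 c : 'rV[R]_N, c != 0 & eval_mx x *m c^T = 0.
  have : (0 < \rank (kermx (eval_mx x)^T))%N.
    by rewrite mxrank_ker mxrank_tr subn_gt0 (eqP xf).
  rewrite lt0n mxrank_eq0 => /rowV0Pn[c /sub_kermxP ck c0]; exists c => //.
  by rewrite -[LHS]trmxK trmx_mul trmxK ck trmx0.
have [y yK yc] : exists2 y, hull K y & peval (pol c) y != 0.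
  apply: contrapT => h; move/eqP: c0; apply.
  rewrite -(polK c) (_ : pol c = 0); first by apply/rowP => i; rewrite !mxE mcoeff0.
  apply: (poly_open_eq0 (@open_interior _ (hull K)) (interior_cell hK) (has_deg_pol c)) => z zK.
  apply/eqP/negPn/negP => zc; apply: h; exists z => //; exact: interior_subset zK.
pose x' (i : 'I_r.+1) := if unlift ord0 i is Some j then x j else y.
exists x'; split; first by move=> i; rewrite /x'; case: (unlift ord0 i).
apply/inj_row_free => v v0.
have vE (c' : 'rV[R]_N) : v *m (eval_mx x' *m c'^T) = 0 by rewrite mulmxA v0 mul0mx.
(* The polynomial of [c] vanishes at the old points and not at the new one, which has index 0, so
   pairing with it isolates this coefficient. *)
have v00 : v 0 0 = 0.
  have /matrixP/(_ 0 0) := vE c; rewrite mxE big_ord_recl big1 ?addr0 => [|i _].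
    rewrite eval_mxE /x' unlift_none mxE => /eqP; rewrite mulf_eq0 (negbTE yc) orbF.
    by move/eqP.
  rewrite eval_mxE /x' liftK -eval_mxE xc mxE mulr0.
  by [].
pose v' : 'rV[R]_r := \row_i v 0 (lift ord0 i).
have v'0 : v' = 0.
  apply: (row_free_inj xf); rewrite mul0mx; apply/rowP => j.
  have /rowP/(_ j) := v0; rewrite !mxE big_ord_recl v00 mul0r add0r => E.
  rewrite -[RHS]E; apply: eq_bigr => i _; rewrite !mxE /x' liftK.
  by [].
apply/rowP => i; rewrite mxE; case: (unliftP ord0 i) => [j ->|-> //].
by have /rowP/(_ j) := v'0; rewrite !mxE.
Qed.

(* Coefficients are fixed linear combinations of finitely many point values. *)
Lemma coef_point_values : exists (x : 'I_N -> 'rV[R]_n.+1) (W : 'M[R]_N),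
  (forall i, hull K (x i)) /\
  forall (c : 'rV[R]_N) j, c 0 j = \sum_i W j i * peval (pol c) (x i).
Proof.
have [x [xK xf]] := exists_independent_points (leqnn N).
have uX : eval_mx x \in unitmx by rewrite -row_free_unit.
exists x, (invmx (eval_mx x)); split => // c j.
have : c^T = invmx (eval_mx x) *m (eval_mx x *m c^T) by rewrite mulKmx.
move=> /matrixP/(_ j 0); rewrite !mxE => ->; apply: eq_bigr => i _.
by rewrite eval_mxE.
Qed.

End unisolvence.

Lemma cvg_sumr (R : realType) T (F : set_system T) (FF : Filter F) I (r : seq I)
    (P : pred I) (f : I -> T -> R) (l : I -> R) :
  (forall i, P i -> f i x @[x --> F] --> l i) ->
  \sum_(i <- r | P i) f i x @[x --> F] --> \sum_(i <- r | P i) l i.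
Proof.
move=> fl; elim: r => [|i r IH].
  by under eq_fun do rewrite big_nil; rewrite big_nil; exact: cvg_cst.
under eq_fun do rewrite big_cons; rewrite big_cons.
by case: ifP => Pi; [apply: cvgD => //; exact: fl|].
Qed.

Section time.
Variables (R : realType) (n k : nat) (M : simplices R n.+1) (K : {set vertex M}).
Hypothesis hK : is_dsimplex K.
Variables (F : set_system R) (FF : ProperFilter F).

(** By [coef_point_values], pointwise convergence on the cell is convergence of the coefficients, so
    the pointwise limit is again a polynomial there. *)
Lemma cvg_coef (q : R -> spoly R n.+1) (l : 'rV[R]_n.+1 -> R) :
  (\forall s \near F, has_deg k (q s)) ->
  (forall x, hull K x -> peval (q s) x @[s --> F] --> l x) ->
  exists c : 'rV[R]_#|{: bmultinom n.+1 k.+1}|,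
    (forall j, cvec k (q s) 0 j @[s --> F] --> c 0 j) /\
    (forall x, hull K x -> l x = peval (pol c) x).
Proof.
move=> hq ql; have [x [W [xK hW]]] := coef_point_values k hK.
pose c : 'rV[R]_#|{: bmultinom n.+1 k.+1}| := \row_j \sum_i W j i * l (x i).
have cc j : cvec k (q s) 0 j @[s --> F] --> c 0 j.
  rewrite mxE.
  have : \sum_i W j i * peval (q s) (x i) @[s --> F] --> \sum_i W j i * l (x i).
    apply: cvg_sumr => i _; apply: cvgM; first exact: cvg_cst.
    exact: ql.
  apply: cvg_trans; apply: near_eq_cvg; near=> s.
  by rewrite hW cvecK//; near: s.
exists c; split => // y yK; apply: (cvg_unique _ (ql y yK)) => //.
have : \sum_j cvec k (q s) 0 j * peval (mono R j) y @[s --> F] -->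
    \sum_j c 0 j * peval (mono R j) y.
  by apply: cvg_sumr => j _; apply: cvgM; [exact: cc|exact: cvg_cst].
rewrite peval_sum; under [X in _ --> X -> _]eq_bigr do rewrite -pevalZ.
apply: cvg_trans; apply: near_eq_cvg; near=> s.
have qs : has_deg k (q s) by near: s.
rewrite -{2}(cvecK qs) peval_sum; apply: eq_bigr => j _.
by rewrite pevalZ.
Unshelve. all: by end_near.
Qed.

(** In bounded degree a linear functional is a finite sum over coefficients, so integrals pass to
    the limit without a convergence theorem. *)
Lemma cvg_functional (Lam : spoly R n.+1 -> R) (q : R -> spoly R n.+1)
    (c : 'rV[R]_#|{: bmultinom n.+1 k.+1}|) r :
  (forall p q, Lam (p + q) = Lam p + Lam q) -> (forall a p, Lam (a *: p) = a * Lam p) ->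
  (\forall s \near F, has_deg k (q s)) ->
  (forall j, cvec k (q s) 0 j @[s --> F] --> c 0 j) ->
  Lam (q s * r) @[s --> F] --> Lam (pol c * r).
Proof.
move=> LD LZ hq qc; rewrite (functional_pol LD LZ).
have : \sum_i cvec k (q s) 0 i * Lam (mono R i * r) @[s --> F] -->
    \sum_i c 0 i * Lam (mono R i * r).
  by apply: cvg_sumr => j _; apply: cvgM; [exact: qc|exact: cvg_cst].
apply: cvg_trans; apply: near_eq_cvg; near=> s.
have qs : has_deg k (q s) by near: s.
by have := functional_pol LD LZ (cvec k (q s)) r; rewrite (cvecK qs).
Unshelve. all: by end_near.
Qed.

Lemma cvg_functional_sqr (Lam : spoly R n.+1 -> R) (q : R -> spoly R n.+1)
    (c : 'rV[R]_#|{: bmultinom n.+1 k.+1}|) :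
  (forall p q, Lam (p + q) = Lam p + Lam q) -> (forall a p, Lam (a *: p) = a * Lam p) ->
  (\forall s \near F, has_deg k (q s)) ->
  (forall j, cvec k (q s) 0 j @[s --> F] --> c 0 j) ->
  Lam (q s * q s) @[s --> F] --> Lam (pol c * pol c).
Proof.
move=> LD LZ hq qc.
have LE (p : 'rV[R]_#|{: bmultinom n.+1 k.+1}|) : Lam (pol p * pol p) = \sum_i p 0 i * Lam (pol p * mono R i).
  rewrite (functional_pol LD LZ); apply: eq_bigr => i _.
  by rewrite [mono R i * _]mulrC.
rewrite LE.
have : \sum_i cvec k (q s) 0 i * Lam (q s * mono R i) @[s --> F] -->
    \sum_i c 0 i * Lam (pol c * mono R i).
  apply: cvg_sumr => j _; apply: cvgM; [exact: qc|exact: cvg_functional].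
apply: cvg_trans; apply: near_eq_cvg; near=> s.
have qs : has_deg k (q s) by near: s.
by have := LE (cvec k (q s)); rewrite (cvecK qs).
Unshelve. all: by end_near.
Qed.

End time.

Section energy.
Variables (R : realType) (n k : nat) (M : simplices R n.+1).
Local Notation V := (vertex M).
Local Notation S := {set V}.
Hypothesis hM : simplicial_family M.
Variables (I : set R) (t : R).
Hypotheses (It : I t) (PF : ProperFilter (within I t^')).
Local Notation F := (within I t^').
Variable u : R -> S -> vpoly R n.+1.
Hypothesis hu : forall s, I s -> in_Vh k (u s).
Hypothesis du : forall K x, K \in cells M -> hull K x ->
  time_derivable I (fun s => veval (u s K) x) t.

Let cvg_t : s @[s --> F] --> t.
Proof. by move=> A At; apply: cvg_within; apply: cvg_within. Qed.

Let near_neq : \forall s \near F, s != t.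
Proof. by apply: (@filterS _ t^' _ _ _ _ (nbhs_dnbhs_neq t)) => s st _. Qed.

Definition quotient K i s : spoly R n.+1 := (s - t)^-1 *: (u s K i - u t K i).

Let near_deg K i : K \in cells M -> \forall s \near F, has_deg k (quotient K i s).
Proof.
move=> cK; near=> s; apply: has_degZ; apply: has_degD; last apply: has_degN.
  by apply: hu => //; near: s; exact: withinT.
exact: hu.
Unshelve. all: by end_near.
Qed.

Let cvg_quotient K i x : K \in cells M -> hull K x ->
  peval (quotient K i s) x @[s --> F] -->
  (time_derive I (fun s => veval (u s K) x) t) 0 i.
Proof.
move=> cK xK; have h := du cK xK.
have := @cvg_comp _ _ _ _ (fun z : 'rV[R]_n.+1 => z 0 i) _ _ _ h (@coord_continuous _ _ _ 0 i _).
apply: cvg_trans; apply: near_eq_cvg; apply: nearW => s /=.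
by rewrite /quotient pevalZ pevalB !mxE.
Qed.

Lemma energyE (v : S -> vpoly R n.+1) :
  kinetic_energy v = \sum_(K in cells M) \sum_i cellI K (v K i * v K i).
Proof.
rewrite /kinetic_energy /sum_cells; apply: eq_bigr => K cK.
have hK := hM cK.
rewrite /cell_integral (@eq_vol _ _ _ _ (fun x => \sum_i peval (v K i * v K i) x)); last first.
  move=> x _; rewrite /norm2 sqr_sqrtr ?dotp_ge0//; apply: eq_bigr => i _.
  by rewrite mxE pevalM.
by rewrite vol_sum//; [exact: finite_vol_hull|move=> i _; exact: bmeas_hull_peval].
Qed.

(** Pointwise derivatives give a limit of the difference quotient in each cell; [cvg_coef] makes it
    a polynomial and thereby allows differentiation under the integral. *)
Lemma energy_derivative : exists du : S -> vpoly R n.+1,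
  [/\ in_Vh k du,
      forall K x, K \in cells M -> hull K x ->
        time_derive I (fun s => veval (u s K) x) t = veval (du K) x,
      time_derivable (V := R^o) I (fun s => kinetic_energy (u s)) t &
      time_derive (V := R^o) I (fun s => kinetic_energy (u s)) t =
      2 * sum_cells (fun K x => dotp (veval (du K) x) (veval (u t K) x))].
Proof.
have : forall Ki : S * 'I_n.+1, exists c : 'rV[R]_#|{: bmultinom n.+1 k.+1}|,
    Ki.1 \in cells M ->
    (forall j, cvec k (quotient Ki.1 Ki.2 s) 0 j @[s --> F] --> c 0 j) /\
    (forall x, hull Ki.1 x -> (time_derive I (fun s => veval (u s Ki.1) x) t) 0 Ki.2
       = peval (pol c) x).
  move=> [K i] /=; have [cK|cK] := boolP (K \in cells M); last by exists 0.
  have [c hc] := cvg_coef (hM cK) PF (@near_deg K i cK) (fun x xK => @cvg_quotient K i x cK xK).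
  by exists c.
move=> /choice[c hc].
pose w K i := pol (c (K, i)).
have wk : in_Vh k w by move=> K cK i; exact: has_deg_pol.
have wE K x : K \in cells M -> hull K x ->
    time_derive I (fun s => veval (u s K) x) t = veval (w K) x.
  move=> cK xK; apply/rowP => i; rewrite [RHS]mxE.
  by have [_ ->] := hc (K, i) cK.
pose D := \sum_(K in cells M) \sum_i 2 * cellI K (w K i * u t K i).
have DE : D = 2 * sum_cells (fun K x => dotp (veval (w K) x) (veval (u t K) x)).
  rewrite /D /sum_cells mulr_sumr; apply: eq_bigr => K cK; rewrite -mulr_sumr; congr (_ * _).
  rewrite /cell_integral [RHS](@eq_vol _ _ _ _ (fun x => \sum_i peval (w K i * u t K i) x)).
    by rewrite vol_sum//; [exact/finite_vol_hull/hM|move=> i _; exact: bmeas_hull_peval].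
  by move=> x _; apply: eq_bigr => i _; rewrite !mxE pevalM.
have cD : (s - t)^-1 *: (kinetic_energy (u s) - kinetic_energy (u t) : R^o) @[s --> F] --> (D : R^o).
  (* Squaring [u s = u t + (s - t) q], with [q] the difference quotient, gives this expression; its
     second term tends to 0. *)
  have : \sum_(K in cells M) \sum_i (2 * cellI K (quotient K i s * u t K i) +
      (s - t) * cellI K (quotient K i s * quotient K i s)) @[s --> F] --> D.
    apply: cvg_sumr => K cK; apply: cvg_sumr => i _.
    have hK := hM cK; have [ci _] := hc (K, i) cK.
    have LD p q := cellID p q hK; have LZ a q := cellIZ a q hK.
    rewrite -[X in _ --> X]addr0; apply: cvgD.
      apply: cvgM; first exact: cvg_cst.
      by have := @cvg_functional R n k _ PF _ _ _ (u t K i) LD LZ (@near_deg K i cK) ci; exact.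
    rewrite -[X in _ --> X](mul0r (cellI K (w K i * w K i))); apply: cvgM.
      by rewrite -(subrr t); apply: cvgB; [exact: cvg_t|exact: cvg_cst].
    exact: (cvg_functional_sqr PF LD LZ (@near_deg K i cK) ci).
  apply: cvg_trans; apply: near_eq_cvg; near=> s.
  have st : s - t != 0 by rewrite subr_eq0; near: s.
  rewrite !energyE -sumrB scaler_sumr; apply: eq_bigr => K cK.
  rewrite -sumrB scaler_sumr; apply: eq_bigr => i _.
  have hK := hM cK.
  have -> : u s K i = u t K i + (s - t) *: quotient K i s.
    by rewrite /quotient scalerA divff// scale1r addrC subrK.
  move: (quotient K i s) (u t K i) => q v.
  have -> : (v + (s - t) *: q) * (v + (s - t) *: q) =
      v * v + ((s - t) *: (q * v) + ((s - t) *: (q * v) + (s - t) *: ((s - t) *: (q * q)))).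
    by rewrite mulrDl !mulrDr -!scalerAl -!scalerAr [v * q]mulrC !addrA.
  rewrite !(cellID _ _ hK) !(cellIZ _ _ hK) /GRing.scale/=.
  move: (cellI _ _) (cellI _ _) (cellI _ _) => a b e; field.
  by [].
exists w; split => //.
- by apply/cvg_ex; exists D.
- by rewrite -DE; apply: cvg_lim => //; exact: cD.
Unshelve. all: by end_near.
Qed.

End energy.

Lemma proper_within_itv (R : realType) (tN t : R) : `]0, tN]%classic t ->
  ProperFilter (within `]0, tN] t^').
Proof.
rewrite /= in_itv/= => /andP[t0 tT].
apply: Build_ProperFilter_ex => P.
rewrite /within/= => /nbhs_ballP[e /= e0 eP].
(* A point to the left of [t] stays in the interval even for [t = tN]; subtracting at most [t / 2]
   keeps it positive. *)
pose s := t - Num.min e t / 2.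
have m0 : 0 < Num.min e t by rewrite lt_min e0.
have me : Num.min e t <= e by rewrite ge_min lexx.
have mt : Num.min e t <= t by rewrite ge_min lexx orbT.
exists s; apply: (eP s).
- rewrite /ball/= /s opprB addrCA subrr addr0 gtr0_norm; lra.
- by rewrite /s lt_eqF//; lra.
- by rewrite /= in_itv/= /s; lra.
Qed.

(** * The energy balance *)

Section facet_functions.
Variables (R : realType) (n : nat) (M : simplices R n.+1).
Local Notation S := {set vertex M}.
Local Notation rs n := (@ref_simplex R n.+1).
Implicit Types (K F : S) (f g : 'rV[R]_n.+1 -> R) (v w : vpoly R n.+1) (e : 'rV[R]_n.+1).

Definition facet_bmeas F f := bmeas (rs n) (f \o facet_param F).

Lemma facet_bmeas_cst F c : facet_bmeas F (fun=> c).
Proof. exact: bmeas_cst. Qed.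

Lemma facet_bmeasD F f g : facet_bmeas F f -> facet_bmeas F g -> facet_bmeas F (fun x => f x + g x).
Proof. exact: bmeasD. Qed.

Lemma facet_bmeasB F f g : facet_bmeas F f -> facet_bmeas F g -> facet_bmeas F (fun x => f x - g x).
Proof. exact: bmeasB. Qed.

Lemma facet_bmeasM F f g : facet_bmeas F f -> facet_bmeas F g -> facet_bmeas F (fun x => f x * g x).
Proof. exact: bmeasM. Qed.

Lemma facet_bmeas_sum F I (s : seq I) (P : pred I) (f : I -> 'rV[R]_n.+1 -> R) :
  (forall i, P i -> facet_bmeas F (f i)) -> facet_bmeas F (fun x => \sum_(i <- s | P i) f i x).
Proof. exact: bmeas_sum. Qed.

Lemma facet_bmeas_peval F (q : spoly R n.+1) : facet_bmeas F (peval q).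
Proof. exact: bmeas_param_peval. Qed.

Lemma facet_integralD F f g : facet_bmeas F f -> facet_bmeas F g ->
  facet_integral F (fun x => f x + g x) = facet_integral F f + facet_integral F g.
Proof.
by move=> nf ng; rewrite !facet_integralE -mulrDr -volD//; exact: finite_vol_rs.
Qed.

Lemma facet_integralB F f g : facet_bmeas F f -> facet_bmeas F g ->
  facet_integral F (fun x => f x - g x) = facet_integral F f - facet_integral F g.
Proof.
by move=> nf ng; rewrite !facet_integralE -mulrBr -volB//; exact: finite_vol_rs.
Qed.

Lemma facet_integralZ F c f : facet_bmeas F f ->
  facet_integral F (fun x => c * f x) = c * facet_integral F f.
Proof.
move=> nf; rewrite !facet_integralE mulrCA; congr (_ * _).
by apply: volZ => //; exact: finite_vol_rs.
Qed.

Lemma facet_integral_sum F I (s : seq I) (P : pred I) (f : I -> 'rV[R]_n.+1 -> R) :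
  (forall i, P i -> facet_bmeas F (f i)) ->
  facet_integral F (fun x => \sum_(i <- s | P i) f i x) =
  \sum_(i <- s | P i) facet_integral F (f i).
Proof.
move=> nf; rewrite facet_integralE (@vol_sum _ _ _ (finite_vol_rs _ _) _ _ _ (fun i => f i \o facet_param F))//.
by rewrite mulr_sumr; apply: eq_bigr => i _; rewrite facet_integralE.
Qed.

Lemma area_ge0 F : 0 <= area F. Proof. exact: sqrtr_ge0. Qed.

Lemma le_facet_integral F f g : facet_bmeas F f -> facet_bmeas F g ->
  (forall x, f x <= g x) -> facet_integral F f <= facet_integral F g.
Proof.
move=> nf ng fg; rewrite !facet_integralE ler_wpM2l ?area_ge0//.
by apply: (le_vol (finite_vol_rs _ _)) => // y _; exact: fg.
Qed.

Lemma facet_integral_ge0 F f : (forall x, 0 <= f x) -> 0 <= facet_integral F f.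
Proof. move=> f0; rewrite facet_integralE; apply: mulr_ge0; first exact: area_ge0.
by apply: vol_ge0 => y _; exact: f0. Qed.

Lemma facet_integral0 F : facet_integral F (fun=> 0) = 0.
Proof. by rewrite facet_integralE (@vol0 _ _ _ (finite_vol_rs _ _)) mulr0. Qed.

Lemma facet_param_hull F y : #|F| = n.+1 -> rs n y -> hull F (facet_param F y).
Proof.
move=> cF ry; apply/(@hull_param _ _ _ n F (enum F)) => //; first by rewrite -cardE.
by exists y.
Qed.

Lemma facet_integral_on_null A F f : borel_set A -> facet_bmeas F f ->
  facet_null F [set x | ~ A x /\ f x != 0] ->
  facet_integral_on A F f = facet_integral F f.
Proof.
move=> mA nf fA; rewrite facet_integralE /facet_integral_on -/(area F); congr (_ * _).
symmetry; apply: vol_setI_null => //; first exact: finite_vol_rs.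
rewrite [X in borel_set X](_ : _ = [set y | A (y *m facet_edges F + facet_vertex F 0)]).
  exact: borel_affine.
by apply/seteqP; split => y; rewrite /= /facet_param addrC.
Qed.

Definition vdot v w : spoly R n.+1 := \sum_i v i * w i.
Definition ndot v e : spoly R n.+1 := \sum_i e 0 i *: v i.
Definition vdiv v : spoly R n.+1 := \sum_j mderiv j (v j).

Lemma peval_vdot v w x : peval (vdot v w) x = dotp (veval v x) (veval w x).
Proof. by rewrite peval_sum; apply: eq_bigr => i _; rewrite pevalM !mxE. Qed.

Lemma peval_ndot v e x : peval (ndot v e) x = dotp (veval v x) e.
Proof. by rewrite peval_sum; apply: eq_bigr => i _; rewrite pevalZ !mxE mulrC. Qed.

Lemma facet_bmeas_vdot F v w : facet_bmeas F (fun x => dotp (veval v x) (veval w x)).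
Proof. rewrite -(funext (peval_vdot v w)); exact: facet_bmeas_peval. Qed.

Lemma facet_bmeas_ndot F v e : facet_bmeas F (fun x => dotp (veval v x) e).
Proof. rewrite -(funext (peval_ndot v e)); exact: facet_bmeas_peval. Qed.

(** The upwind switch is 1 minus the indicator of a Borel set; it is the factor that takes facet
    integrands out of the polynomials. *)
Lemma facet_bmeas_upwind F (u : S -> vpoly R n.+1) K : facet_bmeas F (upwind u K F).
Proof.
split; last first.
  by exists 1 => y _; rewrite /= /upwind; case: ifP; rewrite ?normr1 ?normr0.
pose A := [set y : 'rV[R]_n | 0 <= dotp (veval (u K) (facet_param F y)) (normal K F)].
have mA : borel_set A.
  apply: borel_le; first exact: rmeas_cst.
  by have [] := facet_bmeas_ndot F (u K) (normal K F).
rewrite (_ : _ \o _ = fun y => 1 + - (\1_A y : R)).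
  by apply: rmeasD; [exact: rmeas_cst|apply: rmeasN; exact: rmeas_indic].
apply/funext => y; rewrite /= /upwind indicE; case: ltP => h.
  by rewrite memNset ?subr0//= => h'; have := lt_le_trans h h'; rewrite ltxx.
by rewrite mem_set// subrr.
Qed.

Lemma tensorE e e' i j : tensor e e' i j = e 0 i * e' 0 j.
Proof. by rewrite mxE big_ord1 mxE. Qed.

Lemma ddotC (A B : 'M[R]_n.+1) : ddot A B = ddot B A.
Proof. by apply: eq_bigr => i _; apply: eq_bigr => j _; rewrite mulrC. Qed.

Lemma ddotDl (A B C : 'M[R]_n.+1) : ddot (A + B) C = ddot A C + ddot B C.
Proof.
rewrite -big_split; apply: eq_bigr => i _; rewrite -big_split; apply: eq_bigr => j _.
by rewrite mxE mulrDl.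
Qed.

Lemma ddotZl a (A C : 'M[R]_n.+1) : ddot (a *: A) C = a * ddot A C.
Proof.
rewrite mulr_sumr; apply: eq_bigr => i _; rewrite mulr_sumr; apply: eq_bigr => j _.
by rewrite mxE mulrA.
Qed.

Lemma ddotBl (A B C : 'M[R]_n.+1) : ddot (A - B) C = ddot A C - ddot B C.
Proof. by rewrite ddotDl -scaleN1r ddotZl mulN1r. Qed.

Lemma ddot_tensor (a b c e : 'rV[R]_n.+1) :
  ddot (tensor a b) (tensor c e) = dotp a c * dotp b e.
Proof.
rewrite mulr_suml; apply: eq_bigr => i _; rewrite mulr_sumr; apply: eq_bigr => j _.
by rewrite !tensorE mulrACA.
Qed.

Lemma ddot_scalar c (B : 'M[R]_n.+1) : ddot c%:M B = c * \sum_i B i i.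
Proof.
rewrite mulr_sumr; apply: eq_bigr => i _; rewrite (bigD1 i)//= mxE eqxx mulr1n.
by rewrite big1 ?addr0// => j ji; rewrite mxE eq_sym (negbTE ji) mulr0n mul0r.
Qed.

Lemma ddot_scalar_tensor c (a e : 'rV[R]_n.+1) : ddot c%:M (tensor a e) = c * dotp a e.
Proof. by rewrite ddot_scalar; congr (_ * _); apply: eq_bigr => i _; rewrite tensorE. Qed.

Lemma facet_bmeas_grad F v w e :
  facet_bmeas F (fun x => ddot (vgrad v x) (tensor (veval w x) e)).
Proof.
apply: facet_bmeas_sum => i _; apply: facet_bmeas_sum => j _.
under eq_fun do rewrite tensorE !mxE.
apply: facet_bmeasM; first exact: facet_bmeas_peval.
by apply: facet_bmeasM; [exact: facet_bmeas_peval|exact: facet_bmeas_cst].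
Qed.

Lemma facet_bmeas_sqr_grad F v : facet_bmeas F (fun x => ddot (vgrad v x) (vgrad v x)).
Proof.
apply: facet_bmeas_sum => i _; apply: facet_bmeas_sum => j _.
under eq_fun do rewrite !mxE.
by apply: facet_bmeasM; exact: facet_bmeas_peval.
Qed.

Lemma div_theorem K v (q : spoly R n.+1) : is_dsimplex K ->
  cell_integral K (fun x => peval (vdiv v) x * peval q x) +
  cell_integral K (fun x => dotp (veval v x) (grad q x)) =
  \sum_(F in facets_of K) facet_integral F (fun x => dotp (veval v x) (normal K F) * peval q x).
Proof.
move=> hK.
have -> : (fun x => peval (vdiv v) x * peval q x) = peval (vdiv v * q).
  by apply/funext => x; rewrite pevalM.
have -> : (fun x => dotp (veval v x) (grad q x)) = peval (\sum_j v j * mderiv j q).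
  by apply/funext => x; rewrite peval_sum; apply: eq_bigr => j _; rewrite pevalM !mxE.
rewrite -[LHS](cellID _ _ hK) mulr_suml -big_split/=.
rewrite /cellI /cell_integral (funext (@peval_sum _ _ _ _ _ _)).
rewrite vol_sum; last 2 first.
- exact: finite_vol_hull.
- by move=> i _; exact: bmeas_hull_peval.
transitivity (\sum_j cell_integral K (peval (mderiv j (v j * q)))).
  by apply: eq_bigr => j _; rewrite /cell_integral mderivM.
transitivity (\sum_j \sum_(F in facets_of K)
    facet_integral F (fun x => normal K F 0 j * peval (v j * q) x)).
  by apply: eq_bigr => j _; exact: divergence_peval.
rewrite exchange_big/=; apply: eq_bigr => F _.
rewrite -facet_integral_sum; last first.
  by move=> j _; apply: facet_bmeasM; [exact: facet_bmeas_cst|exact: facet_bmeas_peval].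
congr facet_integral; apply/funext => x; rewrite mulr_suml; apply: eq_bigr => j _.
by rewrite pevalM !mxE mulrA [normal _ _ _ _ * _]mulrC.
Qed.

End facet_functions.

(** * Sums over cell boundaries and the mass equations *)

Section boundary_sums.
Variables (R : realType) (n : nat) (M : simplices R n.+1).
Local Notation S := {set vertex M}.
Implicit Types (K F : S) (G H : S -> S -> 'rV[R]_n.+1 -> R) (g : S -> 'rV[R]_n.+1 -> R).

Definition boundary_bmeas G := forall K F, K \in cells M -> F \in facets_of K -> facet_bmeas F (G K F).

Lemma sum_cell_boundariesD G H : boundary_bmeas G -> boundary_bmeas H ->
  sum_cell_boundaries (fun K F x => G K F x + H K F x) =
  sum_cell_boundaries G + sum_cell_boundaries H.
Proof.
move=> nG nH; rewrite -big_split; apply: eq_bigr => K cK; rewrite -big_split.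
by apply: eq_bigr => F FK; rewrite facet_integralD//; [exact: nG|exact: nH].
Qed.

Lemma sum_cell_boundariesZ c G : boundary_bmeas G ->
  sum_cell_boundaries (fun K F x => c * G K F x) = c * sum_cell_boundaries G.
Proof.
move=> nG; rewrite mulr_sumr; apply: eq_bigr => K cK; rewrite mulr_sumr.
by apply: eq_bigr => F FK; rewrite facet_integralZ//; exact: nG.
Qed.

Lemma sum_cell_boundariesB G H : boundary_bmeas G -> boundary_bmeas H ->
  sum_cell_boundaries (fun K F x => G K F x - H K F x) =
  sum_cell_boundaries G - sum_cell_boundaries H.
Proof.
move=> nG nH; rewrite -sumrB; apply: eq_bigr => K cK; rewrite -sumrB.
by apply: eq_bigr => F FK; rewrite facet_integralB//; [exact: nG|exact: nH].
Qed.

Lemma eq_sum_cell_boundaries G H :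
  (forall K F x, K \in cells M -> F \in facets_of K -> G K F x = H K F x) ->
  sum_cell_boundaries G = sum_cell_boundaries H.
Proof.
move=> GH; apply: eq_bigr => K cK; apply: eq_bigr => F FK; congr facet_integral.
by apply/funext => x; exact: GH.
Qed.

Lemma sum_cell_boundaries_le0 G : boundary_bmeas G ->
  (forall K F x, K \in cells M -> F \in facets_of K -> G K F x <= 0) ->
  sum_cell_boundaries G <= 0.
Proof.
move=> nG G0; apply: sumr_le0 => K cK; apply: sumr_le0 => F FK.
rewrite -(facet_integral0 F); apply: le_facet_integral; first exact: nG.
  exact: facet_bmeas_cst.
by move=> x; exact: G0.
Qed.

(** Grouping by facets brings together the contributions of adjacent cells. *)
Lemma sum_cell_boundaries_facets G : sum_cell_boundaries G =
  \sum_(F in facets M) \sum_(K in cells M | F \in facets_of K) facet_integral F (G K F).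
Proof.
apply: exchange_big_dep => K F cK FK; apply/bigcupP; by exists K.
Qed.

Variable Omega : set 'rV[R]_n.+1.

(** A real factor, so that boundary integrals become sums over all cell boundaries and combine with
    the other terms under one sum. *)
Definition bdry F : R := `[< hull F `<=` frontier Omega >]%:R.

Lemma boundary_integralE G : boundary_integral Omega G =
  sum_cell_boundaries (fun K F x => bdry F * G K F x).
Proof.
apply: eq_bigr => K _; rewrite big_mkcondr; apply: eq_bigr => F _; rewrite /bdry.
case: asboolP => _; rewrite -/(facet_integral F _) ?[LHS]/(facet_integral _ _).
  by congr facet_integral; apply/funext => x; rewrite mul1r.
by under eq_fun do rewrite mul0r; rewrite facet_integral0.
Qed.

Hypothesis hM : triangulation M Omega.

(** On an interior facet [ub] and [g] are single-valued while the normals of its cells add up to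
    0. *)
Lemma interior_flux (ub : S -> vpoly R n.+1) g :
  (forall F, F \in facets M -> facet_bmeas F (g F)) ->
  sum_cell_boundaries (fun K F x => dotp (veval (ub F) x) (normal K F) * g F x) =
  sum_cell_boundaries (fun K F x => bdry F * (dotp (veval (ub F) x) (normal K F) * g F x)).
Proof.
move=> ng; rewrite !sum_cell_boundaries_facets; apply: eq_bigr => F FM; rewrite /bdry.
case: asboolP => Fb.
  apply: eq_bigr => K _; congr facet_integral; apply/funext => x.
  by rewrite mul1r.
under [RHS]eq_bigr => K _ do
  (under eq_fun do rewrite mul0r; rewrite facet_integral0).
rewrite big1_eq -facet_integral_sum; last first.
  by move=> K _; apply: facet_bmeasM; [exact: facet_bmeas_ndot|exact: ng].
rewrite -[RHS](facet_integral0 F); congr facet_integral; apply/funext => x.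
rewrite -mulr_suml -dotp_sumr (interior_facet_normals hM FM Fb).
by rewrite -(scale0r 0) dotpZr !mul0r.
Qed.

Variables (k : nat) (u ub : S -> vpoly R n.+1).
Hypotheses (uk : in_Vh k u) (ubk : forall F, F \in facets M -> forall i, has_deg k (ub F i)).

Definition jump_poly K F : vpoly R n.+1 := fun i => ub F i - u K i.

Lemma jumpE K F x : jump u ub K F x = veval (jump_poly K F) x.
Proof. by apply/rowP => i; rewrite !mxE pevalB. Qed.

Hypothesis M2 : facet_continuity Omega k u ub.

(** Since normals are constant, the total flux [w F] of the jump through a facet is a polynomial of
    degree at most [k], admissible in (M2). With [interior_flux], this test makes the integrals of
    [w ^+ 2] vanish, hence also those of [w] times [g]. *)
Lemma jump_flux g : (forall F, F \in facets M -> facet_bmeas F (g F)) ->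
  sum_cell_boundaries (fun K F x => dotp (jump u ub K F x) (normal K F) * g F x) = 0.
Proof.
pose w F : spoly R n.+1 := \sum_(K in cells M | F \in facets_of K) ndot (jump_poly K F) (normal K F).
have FM K F : K \in cells M -> F \in facets_of K -> F \in facets M.
  by move=> cK FK; apply/bigcupP; exists K.
have jw h : (forall F, F \in facets M -> facet_bmeas F (h F)) ->
    sum_cell_boundaries (fun K F x => dotp (jump u ub K F x) (normal K F) * h F x) =
    \sum_(F in facets M) facet_integral F (fun x => peval (w F) x * h F x).
  move=> nh; rewrite sum_cell_boundaries_facets; apply: eq_bigr => F FMF.
  rewrite -facet_integral_sum; last first.
    move=> K _; under eq_fun do rewrite jumpE.
    by apply: facet_bmeasM; [exact: facet_bmeas_ndot|exact: nh].
  congr facet_integral; apply/funext => x; rewrite peval_sum mulr_suml.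
  by apply: eq_bigr => K _; rewrite peval_ndot jumpE.
have wk : in_barQh k w.
  move=> F FMF; apply: has_deg_sum => K /andP[cK FK]; apply: has_deg_sum => i _.
  by apply: has_degZ; apply: has_degD; [exact: ubk|apply: has_degN; exact: uk].
have w0 : \sum_(F in facets M) facet_integral F (fun x => peval (w F) x ^+ 2) = 0.
  under eq_bigr do under eq_fun do rewrite expr2.
  rewrite -(jw (fun F => peval (w F))) => [|F _]; last exact: facet_bmeas_peval.
  transitivity (- (0 : R)); last by rewrite oppr0.
  rewrite [in RHS](M2 wk) opprB boundary_integralE -interior_flux => [|F _]; last exact: facet_bmeas_peval.
  rewrite -sum_cell_boundariesB => [|K F _ _|K F _ _]; last 2 first.
  - by apply: facet_bmeasM; [exact: facet_bmeas_ndot|exact: facet_bmeas_peval].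
  - by apply: facet_bmeasM; [exact: facet_bmeas_ndot|exact: facet_bmeas_peval].
  by apply: eq_sum_cell_boundaries => K F x _ _; rewrite dotpBl mulrBl.
move=> ng; rewrite (jw _ ng); apply: big1 => F FMF.
have : facet_integral F (fun x => peval (w F) x ^+ 2) = 0.
  apply: (psumr_eq0P _ w0) => // F' _; apply: facet_integral_ge0 => x; exact: sqr_ge0.
have [K cK FK] := bigcupP FMF.
rewrite !facet_integralE => /eqP; rewrite mulf_eq0 => /orP[/eqP -> //|/eqP h].
  by rewrite mul0r.
apply/eqP; rewrite mulf_eq0; apply/orP; right; apply/eqP.
apply: (vol_mul_eq0 (finite_vol_rs _ _) (facet_bmeas_peval F (w F)) (ng F FMF)).
exact: h.
Qed.

Hypothesis M1 : cell_continuity k u.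

(** The divergence of [u] lies in [Q_h]. Tested with it, (M1) becomes, after integration by parts in
    each cell, the vanishing of the sum of the integrals of its square. *)
Lemma divergence_free K (q : spoly R n.+1) : K \in cells M ->
  cell_integral K (fun x => peval (vdiv (u K)) x * peval q x) = 0.
Proof.
have hc L : L \in cells M -> is_dsimplex L by exact: (cell_simplex hM).
move=> cK; have hK := hc K cK.
pose D L := vdiv (u L).
have Dk : in_Qh k D.
  by move=> L cL; apply: has_deg_sum => j _; apply: has_deg_mderiv; exact: uk.
have D0 : \sum_(L in cells M) cell_integral L (fun x => peval (D L) x ^+ 2) = 0.
  have := M1 Dk; rewrite /sum_cells /sum_cell_boundaries -sumrB => /esym/eqP.
  rewrite -oppr_eq0 -sumrN => /eqP h; rewrite -[RHS]h; apply: eq_bigr => L cL.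
  rewrite -(div_theorem _ _ (hc L cL)) opprB addrK.
  by congr cell_integral; apply/funext => x; rewrite expr2.
apply: (vol_mul_eq0 (finite_vol_hull hK)); do ?exact: bmeas_hull_peval.
by apply: (psumr_eq0P _ D0) => // L _; apply: vol_ge0 => x _; exact: sqr_ge0.
Qed.

End boundary_sums.

(** * The penalty parameter and the viscous terms *)

Section penalty.
Variables (R : realType) (n k : nat) (M : simplices R n.+1).
Local Notation S := {set vertex M}.
Implicit Types (K F : S) (v w : vpoly R n.+1).

(** The diameter is at least the length of an edge; being a supremum, it also needs an upper bound
    on distances in the hull to be meaningful. *)
Lemma diameter_gt0 K : injective (@vertex_pos _ _ M) -> is_dsimplex K -> 0 < diameter K.
Proof.
move=> ip [cK _]; have [C hC] := bounded_hull K.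
have [v vK] : exists v : vertex M, v \in K by apply/set0Pn; rewrite -card_gt0 cK.
have [w] : exists w : vertex M, w \in K :\ v.
  by apply/set0Pn; rewrite -card_gt0; have := cardsD1 v K; rewrite vK cK add1n => -[<-].
rewrite !inE => /andP[wv wK].
have pvw : 0 < norm2 (vertex_pos w - vertex_pos v).
  rewrite sqrtr_gt0 lt_neqAle dotp_ge0 andbT eq_sym.
  apply: contra wv => /eqP/dotp_eq0/eqP; rewrite subr_eq0 => /eqP/ip ->; exact: eqxx.
apply: (lt_le_trans pvw); apply: ub_le_sup; last first.
  by exists (vertex_pos w), (vertex_pos v); split => //; exact: hull_vertex.
exists (Num.sqrt (\sum_(i < n.+1) (2 * C) ^+ 2)) => _ [x [y [xK yK ->]]].
rewrite ler_wsqrtr//; apply: ler_sum => i _; rewrite -expr2 -real_normK ?num_real//.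
rewrite ler_sqr ?nnegrE//; last first.
  by rewrite mulr_ge0//; apply: le_trans (hC x xK i).
rewrite !mxE mulr2n mulrDl mul1r; apply: le_trans (ler_normB _ _) _.
by apply: lerD; exact: hC.
Qed.

Definition sqr_grad v : spoly R n.+1 := \sum_i \sum_j mderiv j (v i) * mderiv j (v i).

Lemma peval_sqr_grad v x : peval (sqr_grad v) x = ddot (vgrad v x) (vgrad v x).
Proof.
rewrite peval_sum; apply: eq_bigr => i _; rewrite peval_sum; apply: eq_bigr => j _.
by rewrite pevalM !mxE.
Qed.

Definition gradient_trace K F (C : R) := forall v, (forall i, has_deg k (v i)) ->
  facet_integral F (fun x => ddot (vgrad v x) (vgrad v x)) <=
  C * cell_integral K (fun x => ddot (vgrad v x) (vgrad v x)).

Lemma gradient_trace_inequality K F : is_dsimplex K -> exists C, gradient_trace K F C.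
Proof.
move=> hK; have [C C0 hC] := trace_inequality F k.-1 hK; exists C => v vk.
rewrite -(funext (peval_sqr_grad v)) -/(facetI F _) -/(cellI K _).
have -> : facetI F (sqr_grad v) = \sum_i \sum_j facet_integral F (fun x => peval (mderiv j (v i)) x ^+ 2).
  rewrite /facetI (funext (@peval_sum _ _ _ _ _ _)) facet_integral_sum => [|i _]; last exact: facet_bmeas_peval.
  apply: eq_bigr => i _.
  rewrite (funext (@peval_sum _ _ _ _ _ _)) facet_integral_sum => [|j _]; last exact: facet_bmeas_peval.
  by apply: eq_bigr => j _; congr facet_integral; apply/funext => x; rewrite pevalM expr2.
have -> : cellI K (sqr_grad v) = \sum_i \sum_j cell_integral K (fun x => peval (mderiv j (v i)) x ^+ 2).
  have fK := finite_vol_hull hK.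
  rewrite /cellI /cell_integral (funext (@peval_sum _ _ _ _ _ _)) (vol_sum fK) => [|i _]; last exact: bmeas_hull_peval.
  apply: eq_bigr => i _.
  rewrite (funext (@peval_sum _ _ _ _ _ _)) (vol_sum fK) => [|j _]; last exact: bmeas_hull_peval.
  by apply: eq_bigr => j _; apply: eq_vol => x _; rewrite pevalM expr2.
rewrite mulr_sumr; apply: ler_sum => i _; rewrite mulr_sumr; apply: ler_sum => j _.
by apply: hC; exact: has_deg_mderiv.
Qed.

(** The difference of the two sides is the square of [A + e *: B] divided by [e]. *)
Lemma young_ddot (e : R) (A B : 'M[R]_n.+1) : 0 < e ->
  - (e^-1 * ddot A A) <= 2 * ddot A B + e * ddot B B.
Proof.
move=> e0; rewrite lerNl opprD -subr_ge0 opprD !opprK.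
have -> : e^-1 * ddot A A + (2 * ddot A B + e * ddot B B) =
    \sum_i \sum_j e^-1 * (A i j + e * B i j) ^+ 2.
  rewrite /ddot !mulr_sumr -!big_split; apply: eq_bigr => i _.
  rewrite !mulr_sumr -!big_split; apply: eq_bigr => j _ /=.
  by field; rewrite gt_eqF.
by do 2!apply: sumr_ge0 => ? _; rewrite mulr_ge0 ?sqr_ge0// invr_ge0 ltW.
Qed.

(** Young's inequality with [e = alpha / diameter K] costs [C F / e] times the gradient integral on
    each facet; the condition says that these costs add up to at most one such integral. *)
Definition penalized alpha K := exists C : S -> R,
  (forall F, F \in facets_of K -> gradient_trace K F (C F)) /\
  diameter K * \sum_(F in facets_of K) C F <= alpha.

Lemma exists_penalty (Omega : set 'rV[R]_n.+1) : triangulation M Omega ->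
  exists2 alpha0 : R, 0 < alpha0 &
    forall alpha K, alpha0 <= alpha -> K \in cells M -> penalized alpha K.
Proof.
move=> hM; have : forall KF : S * S, exists C, KF.1 \in cells M -> gradient_trace KF.1 KF.2 C.
  move=> [K F]; have [cK|cK] := boolP (K \in cells M); last by exists 0.
  by have [C hC] := gradient_trace_inequality F (cell_simplex hM cK); exists C.
move=> /choice[C hC]; pose c K := diameter K * \sum_(F in facets_of K) C (K, F).
(* Absolute values let the sum dominate the constant of each cell, and the 1 makes the threshold
   positive. *)
exists (1 + \sum_(K in cells M) `|c K|) => [|alpha K ha cK].
  by rewrite ltr_pwDl// sumr_ge0.
exists (fun F => C (K, F)); split => [F _|]; first exact: (hC (K, F) cK).
apply: le_trans ha; rewrite -/(c K) (bigD1 K)//= addrCA ler_wpDr ?ler_norm//.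
by rewrite addr_ge0// sumr_ge0.
Qed.

(** Young's inequality on each facet, where the tensor of [w] with a unit normal has the length of
    [w], leaves gradient integrals that the trace inequality moves into the cell. *)
Lemma viscous_bound alpha K v (w : S -> vpoly R n.+1) (Omega : set 'rV[R]_n.+1) :
  triangulation M Omega -> K \in cells M -> 0 < alpha -> penalized alpha K ->
  (forall i, has_deg k (v i)) ->
  0 <= cell_integral K (fun x => ddot (vgrad v x) (vgrad v x)) +
    \sum_(F in facets_of K) facet_integral F (fun x =>
      2 * ddot (vgrad v x) (tensor (veval (w F) x) (normal K F)) +
      alpha / diameter K * dotp (veval (w F) x) (veval (w F) x)).
Proof.
move=> hM cK a0 [C [hC Ca]] vk; have hK := cell_simplex hM cK.
have h0 : 0 < diameter K by apply: diameter_gt0 => //; case: hM.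
set e := alpha / diameter K; have e0 : 0 < e by rewrite divr_gt0.
set g := cell_integral K _.
have g0 : 0 <= g.
  apply: vol_ge0 => x _; apply: sumr_ge0 => i _; apply: sumr_ge0 => j _.
  by rewrite -expr2 sqr_ge0.
have hF F : F \in facets_of K -> - (e^-1 * (C F * g)) <= facet_integral F (fun x =>
      2 * ddot (vgrad v x) (tensor (veval (w F) x) (normal K F)) +
      e * dotp (veval (w F) x) (veval (w F) x)).
  move=> FK; apply: (@le_trans _ _ (facet_integral F (fun x => - e^-1 * ddot (vgrad v x) (vgrad v x)))).
    rewrite facet_integralZ; last exact: facet_bmeas_sqr_grad.
    by rewrite mulNr lerN2 ler_wpM2l ?invr_ge0 ?(ltW e0)// hC.
  apply: le_facet_integral.
  - by apply: facet_bmeasM; [exact: facet_bmeas_cst|exact: facet_bmeas_sqr_grad].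
  - apply: facet_bmeasD; apply: facet_bmeasM; do ?exact: facet_bmeas_cst.
      exact: facet_bmeas_grad.
    exact: facet_bmeas_vdot.
  - move=> x; have := young_ddot (vgrad v x) (tensor (veval (w F) x) (normal K F)) e0.
    by rewrite ddot_tensor (unit_normal hM cK FK) mulr1 mulNr.
apply: (@le_trans _ _ (g + \sum_(F in facets_of K) - (e^-1 * (C F * g)))); last first.
  by rewrite lerD2l; apply: ler_sum.
rewrite sumrN -mulr_sumr -mulr_suml mulrA subr_ge0 -[leRHS]mul1r ler_wpM2r//.
by rewrite mulrC ler_pdivrMr// mul1r /e ler_pdivlMr// mulrC.
Qed.

End penalty.

(** * The energy inequality at a fixed time *)

Section energy_inequality.
Variables (R : realType) (n k : nat) (M : simplices R n.+1).
Local Notation S := {set vertex M}.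
Implicit Types (K F : S).
Variables Omega GammaD GammaN : set 'rV[R]_n.+1.
Hypotheses (hOmega : polyhedral_domain Omega) (hM : triangulation M Omega) (hGamma : GammaD `|` GammaN = frontier Omega).
Hypothesis mN : borel_set GammaN.
Variables (nu alpha : R).
Hypotheses (nu0 : 0 < nu) (a0 : 0 < alpha).
Hypothesis ha : forall K, K \in cells M -> penalized k alpha K.
Variables (u ub : S -> vpoly R n.+1) (p pb : S -> spoly R n.+1).
Hypotheses (uk : in_Vh k u) (ubk : in_barVh GammaD k ub).
Variable du : S -> vpoly R n.+1.
Hypotheses (M1 : cell_continuity k u) (M2 : facet_continuity Omega k u ub).
Hypothesis M3 : cell_momentum k nu alpha u ub p pb (fun=> 0) (fun K x => veval (du K) x).
Hypothesis M4 : facet_momentum Omega GammaD GammaN k nu alpha u ub pb (fun=> 0).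
Local Notation N := (@normal R n.+1 M).
Local Notation U K x := (veval (u K) x).
Local Notation Ub F x := (veval (ub F) x).
Local Notation J := (jump u ub).
Local Notation G K x := (vgrad (u K) x).
Local Notation lam := (upwind u).

Let dotp0l (e : 'rV[R]_n.+1) : dotp 0 e = 0.
Proof. by rewrite -(scale0r 0) dotpZl mul0r. Qed.

(** The convective part equals half of [u] dotted with the gradient of [|u|^2]; integration by parts
    with zero divergence sends it to the boundary. The pressure part is [p] times the divergence and
    vanishes. *)
Lemma cell_energy K : K \in cells M ->
  cell_integral K (fun x => ddot (sigma nu u p K x) (G K x)) =
  2^-1 * (\sum_(F in facets_of K) facet_integral F (fun x =>
    dotp (U K x) (N K F) * dotp (U K x) (U K x)))
  - nu * cell_integral K (fun x => ddot (G K x) (G K x)).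
Proof.
move=> cK; have hK := cell_simplex hM cK; pose q := vdot (u K) (u K).
pose A : spoly R n.+1 := \sum_j u K j * mderiv j q.
have AE x : peval A x = dotp (U K x) (grad q x).
  by rewrite peval_sum; apply: eq_bigr => j _; rewrite pevalM !mxE.
have -> : (fun x => ddot (sigma nu u p K x) (G K x)) =
    peval (2^-1 *: A + (vdiv (u K) * p K + (- nu) *: sqr_grad (u K))).
  apply/funext => x; rewrite !pevalD !pevalZ pevalM peval_sqr_grad ddotDl ddotBl ddotZl.
  rewrite mulNr; congr (_ + (_ - _)); last first.
    rewrite ddot_scalar mulrC peval_sum; congr (_ * _).
    by apply: eq_bigr => i _; rewrite mxE.
  rewrite AE /ddot exchange_big/= mulr_sumr; apply: eq_bigr => j _.
  have -> : grad q x 0 j = \sum_i peval (mderiv j (u K i * u K i)) x.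
    by rewrite gradE -peval_sum; congr peval; exact: raddf_sum.
  rewrite !mulr_sumr; apply: eq_bigr => i _.
  by rewrite mderivM pevalD !pevalM tensorE !mxE; field.
rewrite -/(cellI K _) !(cellID _ _ hK) !(cellIZ _ _ hK) mulNr.
have -> : cellI K (sqr_grad (u K)) = cell_integral K (fun x => ddot (G K x) (G K x)).
  by rewrite /cellI (funext (peval_sqr_grad _)).
have -> : cellI K (vdiv (u K) * p K) = 0.
  by rewrite /cellI (funext (pevalM _ _)) (divergence_free hM uk M1).
have -> : cellI K A = cell_integral K (fun x => dotp (U K x) (grad q x)).
  by rewrite /cellI (funext AE).
rewrite add0r; congr (_ * _ - _); have := div_theorem (u K) q hK.
rewrite (divergence_free hM uk M1 _ cK) add0r => ->; apply: eq_bigr => F _.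
by congr facet_integral; apply/funext => x; rewrite peval_vdot.
Qed.

Lemma hat_sigmaE (v : vpoly R n.+1) K F x : K \in cells M -> F \in facets_of K ->
  ddot (hat_sigma nu alpha u ub pb K F x) (tensor (veval v x) (N K F)) =
  dotp (U K x) (veval v x) * dotp (U K x) (N K F)
  + lam K F x * (dotp (veval (jump_poly u ub K F) x) (veval v x) * dotp (U K x) (N K F))
  + (peval (pb F) x * dotp (veval v x) (N K F)
  - nu * ddot (G K x) (tensor (veval v x) (N K F))
  - nu * alpha / diameter K * dotp (veval (jump_poly u ub K F) x) (veval v x)).
Proof.
move=> cK FK; rewrite /hat_sigma /hat_sigma_a /hat_sigma_d /sigma_a.
rewrite ddotDl ddotDl !ddotBl !ddotZl !ddot_tensor ddot_scalar_tensor.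
rewrite -jumpE (unit_normal hM cK FK) mulr1 dotpZl mulrCA.
by [].
Qed.

Let facet_bmeas_hat (v : S -> S -> vpoly R n.+1) : boundary_bmeas (fun K F x =>
  ddot (hat_sigma nu alpha u ub pb K F x) (tensor (veval (v K F) x) (N K F))).
Proof.
move=> K F cK FK.
under eq_fun do rewrite (hat_sigmaE (v K F) _ cK FK).
have c := facet_bmeas_cst F.
apply: facet_bmeasD; first apply: facet_bmeasD.
- by apply: facet_bmeasM; [exact: facet_bmeas_vdot|exact: facet_bmeas_ndot].
- apply: facet_bmeasM; first exact: facet_bmeas_upwind.
  by apply: facet_bmeasM; [exact: facet_bmeas_vdot|exact: facet_bmeas_ndot].
- apply: facet_bmeasB; last by apply: facet_bmeasM => //; exact: facet_bmeas_vdot.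
  apply: facet_bmeasB; last by apply: facet_bmeasM => //; exact: facet_bmeas_grad.
  by apply: facet_bmeasM; [exact: facet_bmeas_peval|exact: facet_bmeas_ndot].
Qed.

(** A boundary point outside [GammaN] lies in [GammaD], where [ub] vanishes up to a null set, so
    nothing is lost by integrating over whole boundary facets. *)
Lemma boundary_outflow :
  boundary_integral_on Omega GammaN (fun K F x =>
    (1 - lam K F x) * dotp (Ub F x) (N K F) * dotp (Ub F x) (Ub F x)) =
  sum_cell_boundaries (fun K F x => bdry Omega F *
    ((1 - lam K F x) * dotp (Ub F x) (N K F) * dotp (Ub F x) (Ub F x))).
Proof.
apply: eq_bigr => K cK; rewrite big_mkcondr; apply: eq_bigr => F FK; rewrite /bdry.
case: asboolP => Fb; last first.
  by under eq_fun do rewrite mul0r; rewrite facet_integral0.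
under [in RHS]eq_fun do rewrite mul1r.
apply: facet_integral_on_null => //.
  apply: facet_bmeasM; last exact: facet_bmeas_vdot.
  apply: facet_bmeasM; last exact: facet_bmeas_ndot.
  by apply: facet_bmeasB; [exact: facet_bmeas_cst|exact: facet_bmeas_upwind].
have [_] : (forall i, has_deg k (ub F i)) /\ facet_null F [set x | GammaD x /\ Ub F x != 0].
  by apply: ubk; apply/bigcupP; exists K.
apply: negligibleS => t [] rt [] /= nN H0; split => //=; split; last first.
  by apply: contra_neq H0 => ->; rewrite !dotp0l mulr0.
have cF : #|F| = n.+1.
  have [cK' _] := cell_simplex hM cK; have [w wK ->] := facets_ofP _ _ FK.
  by have := cardsD1 w K; rewrite wK cK' add1n => -[<-].
have := Fb _ (facet_param_hull cF rt); rewrite -hGamma => -[//|h].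
by case: nN.
Qed.

Lemma boundary_integral_on0 A (v : S -> vpoly R n.+1) :
  boundary_integral_on Omega A (fun K F x => dotp 0 (veval (v F) x)) = 0.
Proof.
apply: big1 => K _; apply: big1 => F _; rewrite /facet_integral_on.
rewrite (_ : _ \o _ = fun=> 0); last first.
  by apply/funext => y; rewrite /= dotp0l.
by rewrite /vol_integral /Rintegral integral0 mulr0.
Qed.

Let FM K F : K \in cells M -> F \in facets_of K -> F \in facets M.
Proof. by move=> cK FK; apply/bigcupP; exists K. Qed.

Let ubdeg F : F \in facets M -> forall i, has_deg k (ub F i).
Proof. by move=> /ubk[]. Qed.

(** [jump_flux] replaces [u.n] by [ub.n], after which only boundary facets remain. There the
    difference of the two sides has integrand [(lam - 1/2) (ub.n) |ub|^2]; a second use of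
    [jump_flux] restores [u.n], and [(lam - 1/2) (u.n)] is [- |u.n| / 2]. *)
Lemma advective_bound :
  sum_cell_boundaries (fun K F x => 2^-1 * (dotp (U K x) (N K F) * dotp (Ub F x) (Ub F x))) <=
  boundary_integral_on Omega GammaN (fun K F x =>
    (1 - lam K F x) * dotp (Ub F x) (N K F) * dotp (Ub F x) (Ub F x)).
Proof.
pose sq F x := dotp (Ub F x) (Ub F x).
have nsq F : facet_bmeas F (sq F) by exact: facet_bmeas_vdot.
(* The upwind switch depends on the cell, but [jump_flux] wants a single-valued weight. On a
   boundary facet this sum has a single term, by [boundary_facet_unique]. *)
pose kappa F x := \sum_(K in cells M | F \in facets_of K) (lam K F x - 2^-1).
have nk F : facet_bmeas F (fun x => bdry Omega F * (kappa F x * sq F x)).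
  apply: facet_bmeasM; first exact: facet_bmeas_cst.
  apply: facet_bmeasM => //; apply: facet_bmeas_sum => K _.
  by apply: facet_bmeasB; [exact: facet_bmeas_upwind|exact: facet_bmeas_cst].
have kE K F x : K \in cells M -> F \in facets_of K ->
    bdry Omega F * kappa F x = bdry Omega F * (lam K F x - 2^-1).
  move=> cK FK; rewrite /bdry; case: asboolP => Fb; last by rewrite !mul0r.
  congr (_ * _); rewrite /kappa (bigD1 K) ?cK//= big1 ?addr0// => L /andP[/andP[cL FL] /eqP LK].
  by case: LK; symmetry; exact: (boundary_facet_unique hOmega hM cK cL FK FL Fb).
have nub K F c : facet_bmeas F (fun x => dotp (Ub F x) (N K F) * (c * sq F x)).
  apply: facet_bmeasM; first exact: facet_bmeas_ndot.
  by apply: facet_bmeasM => //; exact: facet_bmeas_cst.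
have nj K F g : facet_bmeas F g -> facet_bmeas F (fun x => dotp (J K F x) (N K F) * g x).
  move=> ng; under eq_fun do rewrite jumpE.
  by apply: facet_bmeasM => //; exact: facet_bmeas_ndot.
have nbo : boundary_bmeas (fun K F x => bdry Omega F *
    ((1 - lam K F x) * dotp (Ub F x) (N K F) * dotp (Ub F x) (Ub F x))).
  move=> K F _ _; apply: facet_bmeasM; first exact: facet_bmeas_cst.
  apply: facet_bmeasM => //; apply: facet_bmeasM; last exact: facet_bmeas_ndot.
  by apply: facet_bmeasB; [exact: facet_bmeas_cst|exact: facet_bmeas_upwind].
have -> : sum_cell_boundaries (fun K F x => 2^-1 * (dotp (U K x) (N K F) * dotp (Ub F x) (Ub F x))) =
    sum_cell_boundaries (fun K F x => bdry Omega F * (dotp (Ub F x) (N K F) * (2^-1 * sq F x))).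
  rewrite -(interior_flux hM) => [|F FM']; last by apply: facet_bmeasM => //; exact: facet_bmeas_cst.
  have j0 := jump_flux hM uk ubdeg M2 (g := fun F x => 2^-1 * sq F x).
  rewrite -[LHS]addr0 -j0 => [|F FM']; last by apply: facet_bmeasM => //; exact: facet_bmeas_cst.
  rewrite -sum_cell_boundariesD => [|K F _ _|K F _ _].
  - by apply: eq_sum_cell_boundaries => K F x _ _; rewrite dotpBl /sq; ring.
  - apply: facet_bmeasM; first exact: facet_bmeas_cst.
    by apply: facet_bmeasM => //; exact: facet_bmeas_ndot.
  - by apply: nj; apply: facet_bmeasM => //; exact: facet_bmeas_cst.
rewrite boundary_outflow -subr_le0 -sum_cell_boundariesB => [|K F _ _|//]; last first.
  by apply: facet_bmeasM => //; exact: facet_bmeas_cst.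
have j0 := jump_flux hM uk ubdeg M2 (fun F _ => nk F).
rewrite -[leLHS]subr0 -[X in _ - X <= _]j0 -sum_cell_boundariesB => [|K F cK FK|K F _ _]; last 2 first.
- by apply: facet_bmeasB; [apply: facet_bmeasM => //; exact: facet_bmeas_cst|exact: nbo].
- exact: nj.
apply: sum_cell_boundaries_le0 => [K F cK FK|K F x cK FK].
  apply: facet_bmeasB; last exact: nj.
  by apply: facet_bmeasB; [apply: facet_bmeasM => //; exact: facet_bmeas_cst|exact: nbo].
have -> : bdry Omega F * (dotp (Ub F x) (N K F) * (2^-1 * sq F x)) - bdry Omega F *
    ((1 - lam K F x) * dotp (Ub F x) (N K F) * dotp (Ub F x) (Ub F x)) -
    dotp (J K F x) (N K F) * (bdry Omega F * (kappa F x * sq F x)) =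
    bdry Omega F * (((lam K F x - 2^-1) * dotp (U K x) (N K F)) * sq F x).
  rewrite [bdry _ _ * (kappa _ _ * _)]mulrA (kE _ _ _ cK FK) dotpBl /sq; by field.
rewrite mulr_ge0_le0 ?ler0n// mulr_le0_ge0 ?dotp_ge0//.
by rewrite /upwind; case: ltP => h; nra.
Qed.

Let boundary_bmeasD G1 G2 : boundary_bmeas G1 -> boundary_bmeas G2 -> boundary_bmeas (fun K F x => G1 K F x + G2 K F x : R).
Proof. by move=> n1 n2 K F cK FK; apply: facet_bmeasD; [exact: n1|exact: n2]. Qed.

Let ddot_tensorBl (A : 'M[R]_n.+1) (a b e : 'rV[R]_n.+1) :
  ddot A (tensor (a - b) e) = ddot A (tensor a e) - ddot A (tensor b e).
Proof. by rewrite ddotC /tensor linearB/= mulmxBl ddotBl !(ddotC _ A). Qed.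

Lemma energy_decay : sum_cells (fun K x => dotp (veval (du K) x) (U K x)) <= 0.
Proof.
have jn K F x : J K F x = veval (jump_poly u ub K F) x := jumpE u ub K F x.
pose hu K F x := ddot (hat_sigma nu alpha u ub pb K F x) (tensor (U K x) (N K F)).
pose hub K F x := ddot (hat_sigma nu alpha u ub pb K F x) (tensor (Ub F x) (N K F)).
pose cons K F x := dotp (U K x) (N K F) * dotp (U K x) (U K x).
pose sym K F x := nu * ddot (tensor (J K F x) (N K F)) (G K x).
pose adv K F x := 2^-1 * (dotp (U K x) (N K F) * dotp (Ub F x) (Ub F x)).
pose upw K F x := (lam K F x - 2^-1) * dotp (U K x) (N K F) * dotp (J K F x) (J K F x).
pose pre K F x := dotp (J K F x) (N K F) * peval (pb F) x.
pose vis K F x := 2 * ddot (G K x) (tensor (veval (jump_poly u ub K F) x) (N K F)) +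
   alpha / diameter K * dotp (veval (jump_poly u ub K F) x) (veval (jump_poly u ub K F) x).
have c F := facet_bmeas_cst F.
have nhu : boundary_bmeas hu by exact: (facet_bmeas_hat (fun K _ => u K)).
have nhub : boundary_bmeas hub by exact: (facet_bmeas_hat (fun _ F => ub F)).
have ncons : boundary_bmeas cons.
  by move=> K F _ _; apply: facet_bmeasM; [exact: facet_bmeas_ndot|exact: facet_bmeas_vdot].
have nsym : boundary_bmeas sym.
  move=> K F _ _; apply: facet_bmeasM => //; under eq_fun do rewrite jn ddotC.
  exact: facet_bmeas_grad.
have nadv : boundary_bmeas adv.
  move=> K F _ _; apply: facet_bmeasM => //.
  by apply: facet_bmeasM; [exact: facet_bmeas_ndot|exact: facet_bmeas_vdot].
have nupw : boundary_bmeas upw.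
  move=> K F _ _; rewrite /upw; under eq_fun do rewrite jn.
  apply: facet_bmeasM; last exact: facet_bmeas_vdot.
  apply: facet_bmeasM; last exact: facet_bmeas_ndot.
  by apply: facet_bmeasB => //; exact: facet_bmeas_upwind.
have npre : boundary_bmeas pre.
  move=> K F _ _; rewrite /pre; under eq_fun do rewrite jn.
  by apply: facet_bmeasM; [exact: facet_bmeas_ndot|exact: facet_bmeas_peval].
have nvis : boundary_bmeas vis.
  move=> K F _ _; apply: facet_bmeasD; apply: facet_bmeasM => //.
    exact: facet_bmeas_grad.
  exact: facet_bmeas_vdot.
have nZ a G1 : boundary_bmeas G1 -> boundary_bmeas (fun K F x => a * G1 K F x).
  by move=> n1 K F cK FK; apply: facet_bmeasM => //; exact: n1.
(* A pointwise identity. With [J = ub - u], the relation [u.J + |u|^2 / 2 = |ub|^2 / 2 - |J|^2 / 2]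
   splits the convective terms into [adv] and [upw]; the viscous ones match because [vis] counts the
   gradient term twice. *)
have balance : sum_cell_boundaries hub + (nu * sum_cell_boundaries vis +
      2^-1 * sum_cell_boundaries cons) =
    sum_cell_boundaries hu + (sum_cell_boundaries sym + (sum_cell_boundaries adv +
      (sum_cell_boundaries upw + sum_cell_boundaries pre))).
  rewrite -!sum_cell_boundariesZ// -!sum_cell_boundariesD//; do ?[apply: boundary_bmeasD => //|exact: nZ].
  apply: eq_sum_cell_boundaries => K F x cK FK.
  rewrite /hub /hu !hat_sigmaE// /cons /sym /adv /upw /pre /vis -!jn /jump.
  rewrite [ddot (tensor _ _) _]ddotC !ddot_tensorBl !dotpBl !dotpBr [dotp (Ub F x) (U K x)]dotpC.
  by move: (diameter K)^-1 => r; field.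
have upw0 : sum_cell_boundaries upw <= 0.
  apply: sum_cell_boundaries_le0 => // K F x _ _; rewrite /upw mulr_le0_ge0 ?dotp_ge0//.
  by rewrite /upwind; case: ltP => h; nra.
have pre0 : sum_cell_boundaries pre = 0.
  by apply: (jump_flux hM uk ubdeg M2) => F _; exact: facet_bmeas_peval.
have vis0 : 0 <= sum_cells (fun K x => ddot (G K x) (G K x)) + sum_cell_boundaries vis.
  rewrite -big_split; apply: sumr_ge0 => K cK.
  exact: (viscous_bound _ hM cK a0 (ha cK) (uk cK)).
have cells0 : sum_cells (fun K x => ddot (sigma nu u p K x) (G K x)) =
    2^-1 * sum_cell_boundaries cons - nu * sum_cells (fun K x => ddot (G K x) (G K x)).
  rewrite !mulr_sumr -sumrB; apply: eq_bigr => K cK; exact: cell_energy.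
have force0 : sum_cells (fun K x => dotp 0 (U K x)) = 0.
  apply: big1 => K cK; rewrite /cell_integral -(vol0 (finite_vol_hull (cell_simplex hM cK))).
  by apply: eq_vol => x _; exact: dotp0l.
(* Eliminating [hu], [hub], [sym] and [cons] by (M3), (M4) and [balance] leaves [adv] minus the
   outflow, plus [upw], minus [nu] times the quantity in [vis0]: no term is positive. *)
have := M3 uk; rewrite force0 cells0 => m3.
have := M4 ubk; rewrite boundary_integral_on0 => m4.
have := advective_bound; move: m3 m4.
rewrite -/hu -/hub -/sym -/adv.
have vis1 := mulr_ge0 (ltW nu0) vis0.
move: balance; rewrite mulrDr in vis1; move: vis1 upw0; rewrite pre0.
lra.
Qed.

End energy_inequality.

Theorem proposition3 (R : realType) (d : nat) (hd : d = 2%N \/ d = 3%N)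
  (Omega GammaD GammaN : set 'rV[R]_d)
  (hOmega : polyhedral_domain Omega)
  (hGamma : GammaD `|` GammaN = frontier Omega)
  (hDN : GammaD `&` GammaN = set0)
  (mD : borel_set GammaD) (mN : borel_set GammaN)
  (M : simplices R d) (hM : triangulation M Omega)
  (k : nat) (hk : (2 <= k)%N)
  (nu : R) (hnu : 0 < nu)
  (tN : R) (htN : 0 < tN) :
  exists2 alpha0 : R, 0 < alpha0 &
  forall alpha : R, alpha0 <= alpha ->
  forall (u ub : R -> {set vertex M} -> vpoly R d)
         (p pb : R -> {set vertex M} -> spoly R d),
  semidiscrete_solution Omega GammaD GammaN k nu alpha `]0, tN]
    (fun _ _ => 0) (fun _ _ => 0) u ub p pb ->
  forall t : R, `]0, tN]%classic t ->
    time_derivable (V := R^o) `]0, tN] (fun s => kinetic_energy (u s)) t /\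
    time_derive (V := R^o) `]0, tN] (fun s => kinetic_energy (u s)) t <= 0.
Proof.
have [n En] : exists n, d = n.+1 by case: hd => ->; eexists; reflexivity.
subst d; have [alpha0 alpha0_gt0 pen] := exists_penalty k hM.
exists alpha0 => // alpha ha u ub p pb sol t It.
have [[uk ubk pk pbk] du M1 M2 [M3 M4]] := sol t It.
have us s : `]0, tN]%classic s -> in_Vh k (u s) by move=> /sol[[]].
have [w [wk wE dE ->]] := energy_derivative (fun K cK => cell_simplex hM cK) It (proper_within_itv It) us du.
split => //; rewrite mulr_ge0_le0//.
(* The pointwise time derivative agrees with its polynomial representative [w] on each cell, which
   is all that the integrals see. *)
have {}M3 : cell_momentum k nu alpha (u t) (ub t) (p t) (pb t) (fun=> 0)
    (fun K x => veval (w K) x).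
  move=> v vk; rewrite (M3 v vk); congr (_ - _ + _ + _); apply: eq_bigr => K cK.
  by apply: eq_vol => x xK; rewrite wE.
have a0 : 0 < alpha by exact: lt_le_trans alpha0_gt0 ha.
have := energy_decay hOmega hM hGamma mN hnu a0 (fun K => pen alpha K ha) uk ubk M1 M2 M3 M4; exact.
Qed.
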